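(* For every integer $k\ge2$, each of the sequences $a(n)=p_k(n)$ and $a(n)=\overline{p}_k(n)$ satisfies, for all sufficiently large $n$, $$a^2(n)\left(a^2(n)-a(n-1)a(n+1)\right)>a^2(n-1)\left(a^2(n+1)-a(n)a(n+2)\right).$$
   Context: For $k\ge2$, $p_k(n)$ denotes the number of $k$-regular partitions of $n$, i.e. partitions of $n$ in which no part is divisible by $k$. $\overline{p}_k(n)$ denotes the number of $k$-regular overpartitions of $n$, i.e. overpartitions of $n$ (partitions in which the first occurrence of each part may be overlined) with no part divisible by $k$; its generating function is $\sum_{n\ge 0}\overline{p}_k(n)q^n=\frac{(-q;q)_\infty(q^k;q^k)_\infty}{(q;q)_\infty(-q^k;q^k)_\infty}$, where $(a;q)_\infty:=\prod_{j\ge0}(1-aq^j)$. *)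

(* Defs.v *)
From mathcomp Require Import all_boot.
Set Implicit Arguments.
Unset Strict Implicit.
Unset Printing Implicit Defensive.

Definition is_partition (n : nat) (s : seq nat) : bool :=
  [&& sorted geq s, all (ltn 0) s & sumn s == n].

Definition regular (k : nat) (s : seq nat) : bool := all (fun x => ~~ (k %| x)) s.

(* The boolean attached to a part says whether that occurrence is overlined. *)
Definition is_overpartition (n : nat) (s : seq (nat * bool)) : bool :=
  is_partition n (unzip1 s) &&
  [forall i : 'I_(size s),
     (nth (0, false) s i).2 ==>
       ((nth (0, false) s i).1 \notin take i (unzip1 s))].

(* A partition of n has at most n parts, all at most n, so counting inside the
   finite type of sequences of length <= n over {0, ..., n} loses nothing;
   see partition_bounds and the two reindexing lemmas below. *)
Definition reg_partitions (k n : nat) : nat :=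
  #|[set s : {bseq n of 'I_n.+1} |
       let t := [seq val x | x <- s] in is_partition n t && regular k t]|.

Definition reg_overpartitions (k n : nat) : nat :=
  #|[set s : {bseq n of 'I_n.+1 * bool} |
       let t := [seq (val x.1, x.2) | x <- s] in
       is_overpartition n t && regular k (unzip1 t)]|.

Lemma partition_bounds n s :
  is_partition n s -> size s <= n /\ {in s, forall x, x <= n}.
Proof.
case/and3P=> _ pos /eqP <- {n}; elim: s pos => [|x s IH] //= /andP[x0 /IH[sz bd]].
split=> [|y]; first by rewrite -add1n leq_add.
rewrite inE => /orP[/eqP->|/bd ys]; first exact: leq_addr.
exact: leq_trans ys (leq_addl _ _).
Qed.

Lemma partition_bseq n (t : seq nat) : is_partition n t ->
  exists s : {bseq n of 'I_n.+1}, t = [seq val x | x <- s].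
Proof.
case/partition_bounds=> sz bd.
have szm : size [seq inord x : 'I_n.+1 | x <- t] <= n by rewrite size_map.
exists (Bseq szm) => /=; rewrite -map_comp -[LHS]map_id.
by apply/eq_in_map => x /bd xn /=; rewrite inordK.
Qed.

Lemma overpartition_bseq n (t : seq (nat * bool)) : is_overpartition n t ->
  exists s : {bseq n of 'I_n.+1 * bool}, t = [seq (val x.1, x.2) | x <- s].
Proof.
case/andP=> /partition_bounds[]; rewrite size_map => sz bd _.
have szm : size [seq (inord x.1 : 'I_n.+1, x.2) | x <- t] <= n.
  by rewrite size_map.
exists (Bseq szm) => /=; rewrite -map_comp -[LHS]map_id.
apply/eq_in_map => -[x b] xt /=.
by rewrite inordK // ltnS; apply: bd; apply/mapP; exists (x, b).
Qed.

(* Main.v *)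
(**
  Put q = exp (-z) with Re z > 0, and let F be the generating function.  Both
  products are exp of T(z) = sum_m c_m phi(m z) / m, where
  phi(w) = 1/(e^w - 1) - 1/(e^(k w) - 1) is the sum of e^(-j w) over k not
  dividing j, and c_m = 1 for partitions, c_m = 2 [m odd] for overpartitions.
  Writing the two terms of phi as partial fractions and exchanging the
  summations over m and n in 2 z / (m^2 z^2 + 4 pi^2 n^2) gives, as for the eta
  function, T(z) = A/z + c0 + s z + (an error smaller than every power) in every
  sector |Im z| <= M Re z, while F is exponentially smaller on the rest of the
  circle |q| = e^(-Re z).

  Instead of a saddle point analysis, F is compared with
  e^(A/(1-q)) (d_0 + d_1 (1-q) + ... + d_(K-1) (1-q)^(K-1)): by Cauchy's
  estimate, at Re z = sqrt (A/n), the coefficients differ by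
  O(n^(-K/2) e^(2 sqrt (A n))).  The coefficients l_n of e^(A/(1-q)) obey
  (n+2) l_(n+2) = (2n+2+A) l_(n+1) - n l_n, from which l_(n+1)/l_n has an
  expansion in powers of t = n^(-1/2), and l_n >= c n^(-b) e^(2 sqrt (A n)).
  Hence R_n = a(n+1)/a(n) = 1 + sqrt A t + ... up to O(t^6).  Dividing the
  inequality by a(n-1)^2 a(n)^2 it says that R_n (R_n - R_(n+1)) is decreasing,
  and its difference is (3 sqrt A / 4) t^5 + O(t^6).
*)
Require Import Defs.
From HB Require Import structures.
From Stdlib Require Import Reals Lra Lia.
From Coquelicot Require Import Coquelicot.
From mathcomp Require Import all_boot zify.
Set Implicit Arguments.
Unset Strict Implicit.
Unset Printing Implicit Defensive.

(** * Counting regular partitions and overpartitions *)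

Local Open Scope nat_scope.

(** No infinite product is handled: [reg_prod k E N] already has the wanted coefficients up to index
    N and converges uniformly on each circle. The l_n are bounded below only up to a power of n, so
    the degree K has to absorb that loss; this is why the error near q = 1 must beat every power.
    The sum of tau (m z) / m diverges like the harmonic series; only the difference of the sums for
    z and k z, cut at kP and P, converges, and its cut-offs create the constant c0. Away from q = 1
    the single term m = 1 of T supplies the exponential loss, because every term is largest on the
    real axis. The unknown d_i are harmless: a(m + K) / l_m has an expansion with limit d_0 > 0, so
    its consecutive ratios are 1 + O(t^2) and R_n inherits 1 + sqrt A t from l_(n+1) / l_n. No
    further coefficient of R_n is computed: t_n^j - t_(n+1)^j has order t^(j+2), so one difference
    turns sqrt A t into (sqrt A / 2) t^3 and the next gives (3 sqrt A / 4) t^5, while an error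
    O(t^6) stays below. *)

Definition counted (T : eqType) (P : pred T) (m : nat) := exists s, [/\ uniq s, s =i P & size s = m].

Lemma counted_ext (T : eqType) (P Q : pred T) m : P =1 Q -> counted P m -> counted Q m.
Proof. by move=> e [s [us ms ss]]; exists s; split=> // x; rewrite ms; apply: e. Qed.

Lemma counted_uniq (T : eqType) (P : pred T) m m' : counted P m -> counted P m' -> m = m'.
Proof.
move=> [s [us ms <-]] [s' [us' ms' <-]]; apply/perm_size/uniq_perm => // x.
by rewrite ms ms'.
Qed.

(** Deleting the leading [x] maps the second class bijectively onto [Q]; the classes are disjoint
    because [P] admits no sequence that starts with [x]. *)
Lemma counted_cons (T : eqType) (x : T) (P Q R : pred (seq T)) m1 m2 :
  (forall s, R s = P s || (if s is y :: s' then (y == x) && Q s' else false)) ->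
  (forall s, ~~ P (x :: s)) -> counted P m1 -> counted Q m2 -> counted R (m1 + m2).
Proof.
move=> e d [s1 [u1 e1 <-]] [s2 [u2 e2 <-]]; exists (s1 ++ map (cons x) s2); split.
- rewrite cat_uniq u1 map_inj_uniq ?u2 ?andbT; last by move=> ? ? [].
  apply/hasPn => _ /mapP[s _ ->]; rewrite [X in ~~ X](e1 (x :: s)); exact: d.
- move=> s; rewrite mem_cat e1 [RHS]e; congr (_ || _); apply/mapP/idP.
    by move=> [t]; rewrite e2 => ht ->; rewrite eqxx.
  by case: s => // y s /andP[/eqP-> hs]; exists s; rewrite ?e2.
by rewrite size_cat size_map.
Qed.

Lemma counted_pred0 (T : eqType) (P : pred T) : P =1 pred0 -> counted P 0.
Proof. by move=> e; exists [::]; split=> // x; rewrite [RHS]e. Qed.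

Lemma counted_pred1 (T : eqType) (P : pred T) x : P =1 pred1 x -> counted P 1.
Proof. by move=> e; exists [:: x]; split=> // y; rewrite inE [RHS]e. Qed.

Lemma counted_card (I : finType) (T : eqType) (g : I -> T) (P : pred T) :
  injective g -> (forall t, P t -> exists i, t = g i) -> counted P #|[set i | P (g i)]|.
Proof.
move=> gi gs; exists (map g (enum [set i | P (g i)])); split.
- by rewrite map_inj_uniq ?enum_uniq.
- move=> t; apply/mapP/idP => [[i]|ht]; first by rewrite mem_enum inE => h ->.
  have [i e] := gs t ht; exists i; rewrite // mem_enum inE -e; exact: ht.
by rewrite size_map -cardE.
Qed.

(* The coefficients of b(q) / (1 - q^N). *)
Definition progression_sum (N : nat) (b : nat -> nat) (n : nat) : nat :=
  \sum_(j < (n %/ N).+1) b (n - j * N).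

(** Coefficient form of B = b + q^N B for B = b / (1 - q^N). *)
Lemma progression_sumE N b n : 0 < N ->
  progression_sum N b n = b n + (if N <= n then progression_sum N b (n - N) else 0).
Proof.
move=> N0; rewrite /progression_sum big_ord_recl /= mul0n subn0; congr (_ + _).
case: leqP => h; last by rewrite divn_small // big_ord0.
have -> : n %/ N = ((n - N) %/ N).+1.
  by rewrite -{1}(subnK h) divnDr ?dvdnn // divnn N0 addn1.
by apply: eq_bigr => i _; congr b; rewrite /= /bump /=; nia.
Qed.

Section RegularPartitions.
Variable k : nat.

(* The coefficients of the product over j <= N, j not divisible by k, of
   1 + w q^j / (1 - q^j): w = 1 gives partitions, w = 2 overpartitions. *)
Fixpoint reg_count (w N n : nat) : nat :=
  match N with
  | 0 => n == 0
  | N'.+1 => reg_count w N' n +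
      (if (k %| N'.+1) || (n < N'.+1) then 0 else w * progression_sum N'.+1 (reg_count w N') (n - N'.+1))
  end.

Lemma reg_countS w N n : reg_count w N.+1 n = reg_count w N n +
  (if (k %| N.+1) || (n < N.+1) then 0 else w * progression_sum N.+1 (reg_count w N) (n - N.+1)).
Proof. by []. Qed.

Definition partition_le N n s := [&& is_partition n s, regular k s & all (leq^~ N) s].

Lemma partition_le_nil N n : partition_le N n [::] = (n == 0).
Proof. by rewrite /partition_le /is_partition /= andbT eq_sym. Qed.

(** In a weakly decreasing sequence the head bounds the tail, so sortedness turns into the new bound
    [x]. *)
Lemma partition_le_cons N n x s :
  partition_le N n (x :: s) = [&& 0 < x, x <= n, x <= N, ~~ (k %| x) & partition_le x (n - x) s].
Proof.
rewrite /partition_le /is_partition /= path_sortedE; last by move=> a b c /=; lia.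
apply/idP/idP.
  case/and3P => /and3P[/andP[a1 a2] /andP[a3 a4] /eqP a5] /andP[a6 a7] /andP[a8 a9].
  rewrite a3 a8 a6 a2 a4 a7 a1 andbT /= -a5 leq_addr /=; apply/eqP; lia.
case/and5P => a1 a2 a3 a4 /and3P[/and3P[a5 a6 /eqP a7] a8 a9].
rewrite a5 a1 a6 a4 a8 a3 !andbT /=; apply/andP; split.
  by rewrite (a9 : all (geq x) s) /=; apply/eqP; lia.
by apply: sub_all a9 => y h; apply: leq_trans h a3.
Qed.

Lemma partition_le_wide N n s : n <= N -> partition_le N n s = is_partition n s && regular k s.
Proof.
move=> hn; rewrite /partition_le; case h: (is_partition n s) => //=.
rewrite andb_idr // => _; apply/allP => x hx.
by have [_ /(_ _ hx)] := partition_bounds h; lia.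
Qed.

Lemma partition_le0 : forall n, counted (partition_le 0 n) (n == 0).
Proof.
move=> n; case: eqP => [->|/eqP h].
  apply: (@counted_pred1 _ _ [::]) => -[|x s]; first by rewrite partition_le_nil.
  by rewrite partition_le_cons; case: x.
apply: counted_pred0 => -[|x s]; first by rewrite partition_le_nil (negbTE h).
by rewrite partition_le_cons; case: x => //= x; rewrite andbF.
Qed.

(** The largest part is at most [N] or equal to [N.+1]; further copies of [N.+1] may follow the
    first, so the tail keeps the bound [N.+1]. *)
Lemma partition_le_step N n s : partition_le N.+1 n s = partition_le N n s ||
  (if s is y :: s' then (y == N.+1) && [&& N.+1 <= n, ~~ (k %| N.+1) & partition_le N.+1 (n - N.+1) s'] else false).
Proof.
case: s => [|x s]; first by rewrite !partition_le_nil orbF.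
rewrite !partition_le_cons; case: (eqVneq x N.+1) => [->|ne].
  by rewrite ltnn !andbF /= leqnn.
by rewrite orbF (leq_eqVlt x N.+1) (negbTE ne) ltnS.
Qed.

Lemma partition_le_count N n : counted (partition_le N n) (reg_count 1 N n).
Proof.
elim: N n => [|N IH] n; first exact: partition_le0.
have nP m s : ~~ partition_le N m (N.+1 :: s) by rewrite partition_le_cons ltnn !andbF.
apply: (counted_cons (fun s => partition_le_step N n s) (nP n) (IH n)).
case: ifP => h.
  by apply: counted_pred0 => s /=; case/orP: h => h; [rewrite h andbF | rewrite leqNgt h].
move/norP: h => [hk hn]; rewrite mul1n.
apply: counted_ext (_ : counted (partition_le N.+1 (n - N.+1)) _) => [s|].
  by rewrite hk leqNgt hn.
(* After the first part N+1 any number of copies may follow; strong induction on the remaining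
   weight matches [progression_sumE]. *)
move: (n - N.+1) => m {n hn}; elim/ltn_ind: m => m IHm.
rewrite progression_sumE //.
apply: (counted_cons (fun s => partition_le_step N m s) (nP m) (IH m)).
case: leqP => h; first by apply: counted_pred0.
apply: counted_ext (IHm (m - N.+1) _) => [s|]; first by rewrite hk.
by lia.
Qed.

Lemma reg_partitions_count N n : n <= N -> reg_count 1 N n = reg_partitions k n.
Proof.
move=> hn; apply: counted_uniq (partition_le_count N n) _.
rewrite /reg_partitions.
apply: counted_ext (@counted_card _ _ (fun s : {bseq n of 'I_n.+1} => [seq val x | x <- s])
  (fun t => is_partition n t && regular k t) _ _) => [s|s1 s2|t /andP[/partition_bseq h _] //].
  by rewrite partition_le_wide.
by move/(inj_map val_inj)/val_inj.
Qed.

(** * Counting overpartitions *)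

Definition first_marked (t : seq (nat * bool)) : bool :=
  [forall i : 'I_(size t), (nth (0, false) t i).2 ==> ((nth (0, false) t i).1 \notin take i (unzip1 t))].

(** A new head [x] makes every later [x] a repeated occurrence, so exactly the overlined copies of
    [x] in the tail become forbidden. *)
Lemma first_marked_cons x b t : first_marked ((x, b) :: t) = first_marked t && ((x, true) \notin t).
Proof.
apply/forallP/andP => [h|[/forallP h hx]].
  split.
    apply/forallP => -[i hi] /=; have := h (Ordinal (hi : i.+1 < size ((x, b) :: t))) => /=.
    by move=> /implyP hh; apply/implyP => /hh; rewrite inE negb_or => /andP[].
  apply/negP => /(nthP (0, false)) [i hi e].
  have := h (Ordinal (hi : i.+1 < size ((x, b) :: t))) => /=.
  by rewrite e /= inE eqxx.
case=> -[|i] hi /=; first by rewrite implybT.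
have := h (Ordinal (hi : i < size t)) => /= /implyP hh; apply/implyP => m.
rewrite inE negb_or hh // andbT; apply: contraNN hx => /eqP <-.
by rewrite -m -surjective_pairing mem_nth.
Qed.

Definition overpartition_le N n t := partition_le N n (unzip1 t) && first_marked t.

Lemma overpartition_le_nil N n : overpartition_le N n [::] = (n == 0).
Proof.
by rewrite /overpartition_le partition_le_nil /= andb_idr // => _; apply/forallP => -[].
Qed.

Lemma overpartition_le_cons N n x b t : overpartition_le N n ((x, b) :: t) =
  [&& 0 < x, x <= n, x <= N, ~~ (k %| x) & overpartition_le x (n - x) t && ((x, true) \notin t)].
Proof. by rewrite /overpartition_le /= partition_le_cons first_marked_cons -!andbA. Qed.

Lemma overpartition_le_notin N M n t b : N < M -> overpartition_le N n t -> (M, b) \notin t.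
Proof.
move=> h /andP[/and3P[_ _ /allP hN] _]; apply/negP => ht.
have /hN : M \in unzip1 t by apply/mapP; exists (M, b).
by rewrite leqNgt h.
Qed.

(* Adding a part [N], overlined or not, in front of such an overpartition keeps
   the overlined part first among the parts [N]. *)
Definition unmarked_le N n t := overpartition_le N n t && ((N, true) \notin t).

Lemma unmarked_le_step N n t : unmarked_le N.+1 n t = overpartition_le N n t ||
  (if t is y :: t' then (y == (N.+1, false)) && [&& N.+1 <= n, ~~ (k %| N.+1) & unmarked_le N.+1 (n - N.+1) t'] else false).
Proof.
case: t => [|[x b] t]; first by rewrite /unmarked_le !overpartition_le_nil orbF in_nil andbT.
rewrite /unmarked_le !overpartition_le_cons xpair_eqE inE xpair_eqE [N.+1 == x]eq_sym.
case: (eqVneq x N.+1) => [->|ne] /=.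
  rewrite ltnn !andbF /= leqnn /=; case: b => /=; first by rewrite andbF.
  by case: (_ \notin t); rewrite ?andbT ?andbF.
rewrite orbF (leq_eqVlt x N.+1) (negbTE ne) /= ltnS; case xN: (x <= N); last by rewrite !andbF.
rewrite andb_idr // => /and5P[_ _ _ _ /andP[h _]].
by apply: overpartition_le_notin h; rewrite ltnS.
Qed.

(** An overlined [N.+1] can only stand in front. Whether the first copy of [N.+1] is overlined or
    plain, what follows lies in [unmarked_le]; the two equal contributions are the weight w = 2. *)
Lemma overpartition_le_step N n t : overpartition_le N.+1 n t = unmarked_le N.+1 n t ||
  (if t is y :: t' then (y == (N.+1, true)) && [&& N.+1 <= n, ~~ (k %| N.+1) & unmarked_le N.+1 (n - N.+1) t'] else false).
Proof.
case: t => [|[x b] t]; first by rewrite /unmarked_le !overpartition_le_nil orbF in_nil andbT.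
rewrite unmarked_le_step !overpartition_le_cons !xpair_eqE.
case: (eqVneq x N.+1) => [->|ne] /=.
  by rewrite ltnn leqnn !andbF /=; case: b; rewrite /= ?orbF.
by rewrite !orbF (leq_eqVlt x N.+1) (negbTE ne) ltnS.
Qed.

Lemma overpartition_le_count N n : counted (overpartition_le N n) (reg_count 2 N n).
Proof.
elim: N n => [|N IH] n.
  rewrite /reg_count; case: eqP => [->|/eqP h].
    apply: (@counted_pred1 _ _ [::]) => -[|[x b] s]; first by rewrite overpartition_le_nil.
    by rewrite overpartition_le_cons; case: x.
  apply: counted_pred0 => -[|[x b] s]; first by rewrite overpartition_le_nil (negbTE h).
  by rewrite overpartition_le_cons; case: x => //= x; rewrite andbF.
have nP m b s : ~~ overpartition_le N m ((N.+1, b) :: s) by rewrite overpartition_le_cons ltnn !andbF.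
have nU m s : ~~ unmarked_le N.+1 m ((N.+1, true) :: s) by rewrite /unmarked_le inE eqxx andbF.
rewrite reg_countS; case: ifP => h.
  have Q0 : counted (fun t' => [&& N.+1 <= n, ~~ (k %| N.+1) & unmarked_le N.+1 (n - N.+1) t']) 0.
    by apply: counted_pred0 => s /=; case/orP: h => h; [rewrite h andbF | rewrite leqNgt h].
  apply: (counted_cons (fun s => overpartition_le_step N n s) (nU n) _ Q0).
  rewrite -[reg_count _ _ _]addn0; exact: (counted_cons (fun s => unmarked_le_step N n s) (nP n false) (IH n) Q0).
move/norP: h => [hk hn].
(* In the unmarked class all copies of N+1 are plain, so it obeys the recursion of ordinary
   partitions. *)
have U m : counted (unmarked_le N.+1 m) (progression_sum N.+1 (reg_count 2 N) m).
  elim/ltn_ind: m => m IHm; rewrite progression_sumE //.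
  apply: (counted_cons (fun s => unmarked_le_step N m s) (nP m false) (IH m)).
  case: leqP => h; first by apply: counted_pred0.
  apply: counted_ext (IHm (m - N.+1) _) => [s|]; first by rewrite hk.
  by lia.
have Q : counted (fun t' => [&& N.+1 <= n, ~~ (k %| N.+1) & unmarked_le N.+1 (n - N.+1) t'])
    (progression_sum N.+1 (reg_count 2 N) (n - N.+1)).
  by apply: counted_ext (U (n - N.+1)) => s; rewrite hk leqNgt hn.
rewrite mul2n -addnn addnA.
apply: (counted_cons (fun s => overpartition_le_step N n s) (nU n) _ Q).
exact: (counted_cons (fun s => unmarked_le_step N n s) (nP n false) (IH n) Q).
Qed.

Lemma reg_overpartitions_count N n : n <= N -> reg_count 2 N n = reg_overpartitions k n.
Proof.
move=> hn; apply: counted_uniq (overpartition_le_count N n) _.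
rewrite /reg_overpartitions.
apply: counted_ext (@counted_card _ _ (fun s : {bseq n of 'I_n.+1 * bool} => [seq (val x.1, x.2) | x <- s])
  (fun t => is_overpartition n t && regular k (unzip1 t)) _ _) => [s|s1 s2|t /andP[/overpartition_bseq h _] //].
  by rewrite /overpartition_le partition_le_wide // andbAC.
have inj : injective (fun x : 'I_n.+1 * bool => (val x.1, x.2)).
  by move=> [x1 b1] [x2 b2] [] /= /val_inj -> ->.
by move/(inj_map inj)/val_inj.
Qed.

End RegularPartitions.

Local Open Scope R_scope.
Local Notation "n %:C" := (RtoC (INR n)) (at level 2, left associativity, format "n %:C").
Local Notation fact := Factorial.fact.

(** * Finite sums and limits of complex sequences *)

HB.instance Definition _ := Monoid.isComLaw.Build R 0 Rplus
  (fun x y z => esym (Rplus_assoc x y z)) Rplus_comm Rplus_0_l.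
HB.instance Definition _ := Monoid.isMulLaw.Build R 0 Rmult Rmult_0_l Rmult_0_r.
HB.instance Definition _ := Monoid.isAddLaw.Build R Rmult Rplus
  (fun x y z => Rmult_plus_distr_r x y z) (fun x y z => Rmult_plus_distr_l x y z).
HB.instance Definition _ := Monoid.isComLaw.Build C (RtoC 0) Cplus
  Cplus_assoc Cplus_comm Cplus_0_l.
HB.instance Definition _ := Monoid.isMulLaw.Build C (RtoC 0) Cmult Cmult_0_l Cmult_0_r.
HB.instance Definition _ := Monoid.isAddLaw.Build C Cmult Cplus
  (fun x y z => Cmult_plus_distr_r x y z) (fun x y z => Cmult_plus_distr_l x y z).

Definition rsum (f : nat -> R) (n : nat) : R := \big[Rplus/0]_(i < n) f i.
Definition csum (f : nat -> C) (n : nat) : C := \big[Cplus/RtoC 0]_(i < n) f i.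

Lemma csum0 f : csum f 0 = 0.
Proof. by rewrite /csum big_ord0. Qed.

Lemma csumS f n : csum f n.+1 = (csum f n + f n)%C.
Proof. by rewrite /csum big_ord_recr. Qed.

Lemma rsum0 f : rsum f 0 = 0.
Proof. by rewrite /rsum big_ord0. Qed.

Lemma rsumS f n : rsum f n.+1 = rsum f n + f n.
Proof. by rewrite /rsum big_ord_recr. Qed.

Lemma csum_ext f g n : (forall i, (i < n)%N -> f i = g i) -> csum f n = csum g n.
Proof. by move=> H; apply: eq_bigr => i _; apply: H. Qed.

Lemma rsum_ext f g n : (forall i, (i < n)%N -> f i = g i) -> rsum f n = rsum g n.
Proof. by move=> H; apply: eq_bigr => i _; apply: H. Qed.

Lemma csum_plus f g n : csum (fun i => f i + g i)%C n = (csum f n + csum g n)%C.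
Proof. exact: big_split. Qed.

Lemma rsum_plus f g n : rsum (fun i => f i + g i) n = rsum f n + rsum g n.
Proof. exact: big_split. Qed.

Lemma csum_scal c f n : csum (fun i => c * f i)%C n = (c * csum f n)%C.
Proof. by rewrite /csum big_distrr. Qed.

Lemma rsum_scal c f n : rsum (fun i => c * f i) n = c * rsum f n.
Proof. by rewrite /rsum big_distrr. Qed.

Lemma csum_minus f g n : csum (fun i => f i - g i)%C n = (csum f n - csum g n)%C.
Proof. elim: n => [|n IH]; rewrite ?csum0 ?csumS ?IH; ring. Qed.

Lemma csum_swap (f : nat -> nat -> C) n m :
  csum (fun i => csum (f i) m) n = csum (fun j => csum (fun i => f i j) n) m.
Proof. exact: exchange_big. Qed.

Lemma csum_recl f n : csum f n.+1 = (f 0%N + csum (fun i => f i.+1) n)%C.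
Proof. by rewrite /csum big_ord_recl. Qed.

Lemma csum_add f n m : csum f (n + m) = (csum f n + csum (fun i => f (n + i)%N) m)%C.
Proof. by rewrite /csum big_split_ord. Qed.

Lemma rsum_add f n m : rsum f (n + m) = rsum f n + rsum (fun i => f (n + i)%N) m.
Proof. by rewrite /rsum big_split_ord. Qed.

Lemma rsum_le f g n : (forall i, (i < n)%N -> f i <= g i) -> rsum f n <= rsum g n.
Proof.
elim: n => [|n IH] H; first by rewrite !rsum0; lra.
rewrite !rsumS; have := IH (fun i Hi => H i (ltnW Hi)); have := H n (leqnn _); lra.
Qed.

Lemma rsum_ge0 f n : (forall i, 0 <= f i) -> 0 <= rsum f n.
Proof. by move=> H; elim: n => [|n IH]; rewrite ?rsum0 ?rsumS; [lra | have := H n; lra]. Qed.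

Lemma rsum_mono f n m : (forall i, 0 <= f i) -> (n <= m)%N -> rsum f n <= rsum f m.
Proof.
move=> H /subnKC <-; rewrite rsum_add.
by have := rsum_ge0 (m - n) (fun i => H (n + i)%N); lra.
Qed.

Lemma csum_const (c : C) n : csum (fun _ => c) n = (n%:C * c)%C.
Proof.
elim: n => [|n IH]; first by rewrite csum0 /=; ring.
by rewrite csumS IH S_INR RtoC_plus; ring.
Qed.

Lemma rsum_const c n : rsum (fun _ => c) n = INR n * c.
Proof. elim: n => [|n IH]; rewrite ?rsum0 ?rsumS ?IH ?S_INR /=; ring. Qed.

Lemma csum_zero n : csum (fun _ => RtoC 0) n = 0.
Proof. by elim: n => [|n IH]; rewrite ?csum0 // csumS IH Cplus_0_l. Qed.

Lemma Cmod_csum f n : Cmod (csum f n) <= rsum (fun i => Cmod (f i)) n.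
Proof.
elim: n => [|n IH]; rewrite ?csum0 ?rsum0 ?Cmod_0 ?csumS ?rsumS; first lra.
by apply: Rle_trans (Cmod_triangle _ _) _; lra.
Qed.

Lemma csum_RtoC f n : csum (fun i => RtoC (f i)) n = RtoC (rsum f n).
Proof. by elim: n => [|n IH]; rewrite ?csum0 ?rsum0 ?csumS ?rsumS // IH RtoC_plus. Qed.

Lemma Re_csum f n : Re (csum f n) = rsum (fun i => Re (f i)) n.
Proof. by elim: n => [|n IH]; rewrite ?csum0 ?rsum0 ?csumS ?rsumS -?IH. Qed.

Lemma Im_csum f n : Im (csum f n) = rsum (fun i => Im (f i)) n.
Proof. by elim: n => [|n IH]; rewrite ?csum0 ?rsum0 ?csumS ?rsumS -?IH. Qed.

Lemma sum_n_rsum f n : sum_n f n = rsum f n.+1.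
Proof.
elim: n => [|n IH]; first by rewrite sum_O rsumS rsum0 Rplus_0_l.
by rewrite sum_Sn IH [RHS]rsumS.
Qed.

Lemma is_series_rsum f (l : R) : is_series f l <-> is_lim_seq (rsum f) l.
Proof.
have E : is_series f l <-> is_lim_seq (sum_n f) l by [].
rewrite E (is_lim_seq_incr_1 (rsum f)); split; apply: is_lim_seq_ext => n.
  exact: sum_n_rsum.
by rewrite sum_n_rsum.
Qed.

Lemma rsum_le_Series f n : (forall i, 0 <= f i) -> ex_series f -> rsum f n <= Series f.
Proof.
move=> H /Series_correct/is_series_rsum/is_lim_seq_incr_compare; apply => i.
by rewrite rsumS; have := H i; lra.
Qed.

Lemma ex_series_bounded f M : (forall i, 0 <= f i) -> (forall n, rsum f n <= M) -> ex_series f.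
Proof.
move=> H HM.
have [l Hl] : ex_finite_lim_seq (rsum f).
  by apply: (ex_finite_lim_seq_incr _ M) => // n; rewrite rsumS; have := H n; lra.
by exists l; apply/is_series_rsum.
Qed.

Lemma ex_series_dom f g : (forall i, 0 <= f i <= g i) -> ex_series g -> ex_series f.
Proof.
move=> H; apply: ex_series_le => n.
by rewrite /norm /= /abs /= Rabs_pos_eq; have := H n; lra.
Qed.

Lemma exp_le_compat a b : a <= b -> exp a <= exp b.
Proof. by case=> [/exp_increasing|->]; lra. Qed.

Lemma RtoC_neq0 (x : R) : x <> 0 -> RtoC x <> 0.
Proof. by move=> H; rewrite /RtoC => -[]. Qed.

Lemma INR_S_pos n : 0 < INR n.+1.
Proof. by apply: lt_0_INR; lia. Qed.

Lemma CINR_neq0 n : n.+1%:C <> 0.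
Proof. by apply: RtoC_neq0; have := INR_S_pos n; lra. Qed.

Lemma Cpow_addn (q : C) n m : (q ^ (n + m) = q ^ n * q ^ m)%C.
Proof. exact: Cpow_add_r. Qed.

Lemma Cpow_muln (q : C) n m : (q ^ (n * m) = (q ^ n) ^ m)%C.
Proof. exact: Cpow_mult_r. Qed.

Lemma Re_mult z w : Re (z * w) = Re z * Re w - Im z * Im w. Proof. by []. Qed.
Lemma Im_mult z w : Im (z * w) = Re z * Im w + Im z * Re w. Proof. by []. Qed.
Lemma Re_plus z w : Re (z + w) = Re z + Re w. Proof. by []. Qed.
Lemma Im_plus z w : Im (z + w) = Im z + Im w. Proof. by []. Qed.
Lemma Re_minus z w : Re (z - w) = Re z - Re w. Proof. by []. Qed.
Lemma Im_minus z w : Im (z - w) = Im z - Im w. Proof. by []. Qed.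
Lemma Re_opp z : Re (- z) = - Re z. Proof. by []. Qed.
Lemma Im_opp z : Im (- z) = - Im z. Proof. by []. Qed.
Lemma Re_scal x z : Re (RtoC x * z) = x * Re z.
Proof. by rewrite Re_mult /=; ring. Qed.

Definition ReIm := (Re_mult, Im_mult, Re_plus, Im_plus, Re_minus, Im_minus, Re_opp, Im_opp).

Lemma C_ext z w : Re z = Re w -> Im z = Im w -> z = w.
Proof. by case: z => a b; case: w => c d /= -> ->. Qed.

Lemma Cmod_minus_sym z w : Cmod (z - w) = Cmod (w - z).
Proof. by rewrite -Cmod_opp; congr Cmod; ring. Qed.

Lemma Cmod_triang_inv z w : Cmod z - Cmod w <= Cmod (z - w).
Proof. have := Cmod_triangle (z - w) w; rewrite (_ : (z - w + w)%C = z); [lra | ring]. Qed.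

Lemma Im_le_Cmod z : Rabs (Im z) <= Cmod z.
Proof. exact: Rle_trans (Rmax_r _ _) (Rmax_Cmod _). Qed.

Lemma Cmod_le_ReIm z : Cmod z <= Rabs (Re z) + Rabs (Im z).
Proof.
rewrite -[z in Cmod z](_ : (RtoC (Re z) + Ci * RtoC (Im z))%C = z).
  apply: Rle_trans (Cmod_triangle _ _) _.
  by rewrite Cmod_mult Cmod_Ci !Cmod_R; lra.
by apply: C_ext; rewrite /=; ring.
Qed.

(** * Limits of complex sequences and dominated convergence *)

Definition Clim (u : nat -> C) (l : C) := is_lim_seq (fun n => Cmod (u n - l)%C) 0.

Lemma Clim_spec u l : Clim u l <-> forall eps : posreal, eventually (fun n => Cmod (u n - l) < eps).
Proof.
split=> [/is_lim_seq_spec H eps|H].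
  by apply: filter_imp (H eps) => n; rewrite Rminus_0_r Rabs_pos_eq //; apply: Cmod_ge_0.
apply/is_lim_seq_spec => eps; apply: filter_imp (H eps) => n.
by rewrite Rminus_0_r Rabs_pos_eq //; apply: Cmod_ge_0.
Qed.

Lemma Clim_squeeze u l e : eventually (fun n => Cmod (u n - l)%C <= e n) ->
  is_lim_seq e 0 -> Clim u l.
Proof.
move=> H He; apply: is_lim_seq_le_le_loc (is_lim_seq_const 0) He.
by apply: filter_imp H => n; have := Cmod_ge_0 (u n - l); split.
Qed.

Lemma Clim_ext_loc u v l : eventually (fun n => u n = v n) -> Clim u l -> Clim v l.
Proof. by move=> H; apply: is_lim_seq_ext_loc; apply: filter_imp H => n ->. Qed.

Lemma Clim_ext u v l : (forall n, u n = v n) -> Clim u l -> Clim v l.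
Proof. by move=> H; apply: is_lim_seq_ext => n; rewrite H. Qed.

Lemma Clim_const l : Clim (fun _ => l) l.
Proof.
apply: is_lim_seq_ext (is_lim_seq_const 0) => n.
by rewrite (_ : (l - l)%C = 0) ?Cmod_0 //; ring.
Qed.

Lemma lim0_plus u v : is_lim_seq u 0 -> is_lim_seq v 0 -> is_lim_seq (fun n => u n + v n) 0.
Proof. by move=> Hu Hv; rewrite -(Rplus_0_l 0); apply: is_lim_seq_plus'. Qed.

Lemma lim0_scal c u : is_lim_seq u 0 -> is_lim_seq (fun n => c * u n) 0.
Proof. by move=> Hu; rewrite -(Rmult_0_r c); apply: is_lim_seq_scal_l Hu. Qed.

Lemma Clim_plus u v l m : Clim u l -> Clim v m -> Clim (fun n => u n + v n)%C (l + m)%C.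
Proof.
move=> Hu Hv; apply: Clim_squeeze (lim0_plus Hu Hv); exists 0%N => n _.
rewrite (_ : (u n + v n - (l + m))%C = ((u n - l) + (v n - m))%C); last ring.
exact: Cmod_triangle.
Qed.

Lemma Clim_scal c u l : Clim u l -> Clim (fun n => c * u n)%C (c * l)%C.
Proof.
move=> Hu; apply: Clim_squeeze (lim0_scal (Cmod c) Hu); exists 0%N => n _.
by rewrite -Cmod_mult (_ : (c * (u n - l))%C = (c * u n - c * l)%C); [lra | ring].
Qed.

Lemma Clim_opp u l : Clim u l -> Clim (fun n => - u n)%C (- l)%C.
Proof.
move=> /(@Clim_scal (-(1))); rewrite (_ : (- (1) * l)%C = (- l)%C); last ring.
by apply: Clim_ext => n; ring.
Qed.

Lemma Clim_minus u v l m : Clim u l -> Clim v m -> Clim (fun n => u n - v n)%C (l - m)%C.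
Proof. by move=> Hu /Clim_opp; apply: Clim_plus Hu. Qed.

Lemma Clim_bounded u l : Clim u l -> eventually (fun n => Cmod (u n) <= Cmod l + 1).
Proof.
move/Clim_spec/(_ (mkposreal 1 Rlt_0_1)); apply: filter_imp => n /=.
by have := Cmod_triang_inv (u n) l; lra.
Qed.

Lemma Clim_mult u v l m : Clim u l -> Clim v m -> Clim (fun n => u n * v n)%C (l * m)%C.
Proof.
move=> Hu Hv.
apply: Clim_squeeze (lim0_plus (lim0_scal (Cmod l + 1) Hv) (lim0_scal (Cmod m) Hu)).
apply: filter_imp (Clim_bounded Hu) => n H.
rewrite (_ : (u n * v n - l * m)%C = (u n * (v n - m) + m * (u n - l))%C); last ring.
apply: Rle_trans (Cmod_triangle _ _) _; rewrite !Cmod_mult.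
have := Rmult_le_compat_r _ _ _ (Cmod_ge_0 (v n - m)) H; lra.
Qed.

Lemma Clim_uniq u l m : Clim u l -> Clim u m -> l = m.
Proof.
move=> Hl Hm; have H := lim0_plus Hl Hm.
have : Cmod (l - m) <= 0.
  have := is_lim_seq_le (fun _ => Cmod (l - m)) _ _ 0 _ (is_lim_seq_const _) H; apply=> n.
  rewrite (_ : (l - m)%C = ((l - u n) + (u n - m))%C); last ring.
  by apply: Rle_trans (Cmod_triangle _ _) _; rewrite (Cmod_minus_sym l); lra.
have := Cmod_ge_0 (l - m) => h1 h2.
have /Cmod_eq_0 h : Cmod (l - m) = 0 by lra.
rewrite -[l](_ : (l - m + m)%C = l); first by rewrite h; ring.
by ring.
Qed.

Lemma Clim_Cmod u l : Clim u l -> is_lim_seq (fun n => Cmod (u n)) (Cmod l).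
Proof.
move=> H; rewrite -[Cmod l]Rplus_0_l.
apply: (is_lim_seq_ext (fun n => (Cmod (u n) - Cmod l) + Cmod l)) => [n|]; first by ring.
apply: is_lim_seq_plus' (is_lim_seq_const _).
apply: (proj2 (is_lim_seq_abs_0 _)); apply: is_lim_seq_le_le (is_lim_seq_const 0) H => n.
split; first exact: Rabs_pos.
apply: Rabs_le; split.
  by have := Cmod_triang_inv l (u n); rewrite Cmod_minus_sym; lra.
exact: Cmod_triang_inv.
Qed.

Lemma Clim_Re u l : Clim u l -> is_lim_seq (fun n => Re (u n)) (Re l).
Proof.
move=> H; rewrite -[Re l]Rplus_0_l.
apply: (is_lim_seq_ext (fun n => (Re (u n) - Re l) + Re l)) => [n|]; first by ring.
apply: is_lim_seq_plus' (is_lim_seq_const _).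
apply: (proj2 (is_lim_seq_abs_0 _)); apply: is_lim_seq_le_le (is_lim_seq_const 0) H => n.
split; [exact: Rabs_pos | exact: (re_le_Cmod (u n - l))].
Qed.

Lemma Clim_Im u l : Clim u l -> is_lim_seq (fun n => Im (u n)) (Im l).
Proof.
move=> /(@Clim_scal (- Ci)%C)/Clim_Re H.
rewrite (_ : Im l = Re (- Ci * l)%C); last by rewrite !Re_mult /=; ring.
by apply: is_lim_seq_ext H => n; rewrite !Re_mult /=; ring.
Qed.

Lemma Clim_ReIm u (a b : R) : is_lim_seq (fun n => Re (u n)) a ->
  is_lim_seq (fun n => Im (u n)) b -> Clim u (a, b).
Proof.
have h (v : nat -> R) (c : R) : is_lim_seq v c -> is_lim_seq (fun n => Rabs (v n - c)) 0.
  move=> H; apply: (proj1 (is_lim_seq_abs_0 (fun n => v n - c))); rewrite -(Rminus_diag_eq c c erefl).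
  by apply: is_lim_seq_minus' => //; apply: is_lim_seq_const.
move=> /h Ha /h Hb; apply: Clim_squeeze (lim0_plus Ha Hb); exists 0%N => n _.
exact: (Cmod_le_ReIm (u n - (a, b))).
Qed.

Lemma Clim_RtoC (u : nat -> R) (l : R) : is_lim_seq u l -> Clim (fun n => RtoC (u n)) l.
Proof. by move=> H; apply: Clim_ReIm => //=; apply: is_lim_seq_const. Qed.

Lemma Clim_inv u (l : C) : l <> 0 -> Clim u l -> Clim (fun n => / u n)%C (/ l)%C.
Proof.
move=> l0 H; have lp : 0 < Cmod l by apply/Cmod_gt_0.
have h : eventually (fun n => Cmod l / 2 <= Cmod (u n)).
  have lp2 : 0 < Cmod l / 2 by lra.
  move/Clim_spec: (H) => /(_ (mkposreal _ lp2)); apply: filter_imp => n /=.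
  by have := Cmod_triang_inv l (u n); rewrite Cmod_minus_sym; lra.
apply: Clim_squeeze (lim0_scal (2 / (Cmod l * Cmod l)) H).
apply: filter_imp h => n h.
have un0 : u n <> 0 by apply/Cmod_gt_0; lra.
rewrite (_ : (/ u n - / l)%C = ((l - u n) / (u n * l))%C); last by field.
rewrite Cmod_div ?Cmod_mult; last exact: Cmult_neq_0.
rewrite Cmod_minus_sym /Rdiv Rmult_comm; apply: Rmult_le_compat_r; first exact: Cmod_ge_0.
rewrite (_ : 2 * / (Cmod l * Cmod l) = / (Cmod l / 2 * Cmod l)); last by field; lra.
apply: Rinv_le_contravar; first by nra.
by apply: Rmult_le_compat_r; lra.
Qed.

Lemma Clim_subseq u l (phi : nat -> nat) : (forall n, (n <= phi n)%N) ->
  Clim u l -> Clim (fun n => u (phi n)) l.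
Proof.
move=> H; apply: (is_lim_seq_subseq (fun n => Cmod (u n - l)) _ phi) => P [N HN].
exists N => n Hn; apply: HN; have := H n; lia.
Qed.

Lemma Clim_csum_inner (F : nat -> nat -> C) (G : nat -> C) n :
  (forall i, (i < n)%N -> Clim (fun p => F p i) (G i)) -> Clim (fun p => csum (F p) n) (csum G n).
Proof.
elim: n => [|n IH] H.
  by rewrite csum0; apply: Clim_ext (Clim_const 0) => p; rewrite csum0.
rewrite csumS; apply: Clim_ext (Clim_plus (IH _) (H n (leqnn _))) => [p|i Hi].
  by rewrite csumS.
exact: H (ltnW Hi).
Qed.

Lemma Clim_le u l M : (eventually (fun n => Cmod (u n) <= M)) -> Clim u l -> Cmod l <= M.
Proof.
move=> H /Clim_Cmod Hl.
exact: (is_lim_seq_le_loc _ _ (Cmod l) M H Hl (is_lim_seq_const _)).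
Qed.

Lemma csum_abs_cv f : ex_series (fun n => Cmod (f n)) -> exists l, Clim (csum f) l.
Proof.
move=> H.
have hs (g : nat -> R) : (forall n, Rabs (g n) <= Cmod (f n)) -> exists l : R, is_lim_seq (rsum g) l.
  move=> Hg; have [l Hl] : ex_series g.
    by apply: ex_series_le H => n; apply: Hg.
  by exists l; apply/is_series_rsum.
have [a Ha] := hs (fun n => Re (f n)) (fun n => re_le_Cmod _).
have [b Hb] := hs (fun n => Im (f n)) (fun n => Im_le_Cmod _).
exists (a, b); apply: Clim_ReIm.
  by apply: is_lim_seq_ext Ha => n; rewrite Re_csum.
by apply: is_lim_seq_ext Hb => n; rewrite Im_csum.
Qed.

Lemma csum_tail_le f g l n : (forall i, (n <= i)%N -> Cmod (f i) <= g i) -> (forall i, 0 <= g i) ->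
  ex_series g -> Clim (csum f) l -> Cmod (l - csum f n) <= Series g - rsum g n.
Proof.
move=> Hfg Hg Hs Hl.
have H := Clim_minus Hl (Clim_const (csum f n)).
apply: Clim_le H; exists n => m /leP Hm.
rewrite -(subnKC Hm) csum_add (_ : forall a b, (a + b - a)%C = b); last by move=> a b; ring.
have h2 := rsum_le_Series m Hg Hs; rewrite -(subnKC Hm) rsum_add in h2.
apply: Rle_trans (Cmod_csum _ _) _; apply: Rle_trans (_ : rsum (fun i => g (n + i)%N) (m - n) <= _).
  by apply: rsum_le => i _; apply: Hfg; rewrite leq_addr.
lra.
Qed.

Lemma Cmod_csum_lim f g l : (forall i, Cmod (f i) <= g i) -> ex_series g ->
  Clim (csum f) l -> Cmod l <= Series g.
Proof.
move=> H Hs Hl.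
have Hg i : 0 <= g i by apply: Rle_trans (Cmod_ge_0 _) (H i).
have := csum_tail_le (n := 0) (fun i _ => H i) Hg Hs Hl.
by rewrite csum0 rsum0 (_ : (l - 0)%C = l); [lra | ring].
Qed.

(** Dominated convergence for series. The bound [g] is only asked from [n0] on, since the partial
    fraction sums are not controlled for small indices; the initial terms converge one by one. The
    two corollaries differ in which of the two limits is known. *)
Lemma Tannery_aux (a : nat -> nat -> C) (b : nat -> C) (s : nat -> C) (g : nat -> R) n0 :
  (forall P, Clim (csum (a P)) (s P)) -> (forall n, Clim (fun P => a P n) (b n)) ->
  (forall P n, (n0 <= n)%N -> Cmod (a P n) <= g n) -> (forall n, 0 <= g n) -> ex_series g ->
  forall eps : posreal, exists n1, forall n, (n1 <= n)%N ->
    eventually (fun P => Cmod (s P - csum b n) < eps).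
Proof.
move=> Hs Ha Hd Hg Hex eps.
have /is_series_rsum/is_lim_seq_spec/(_ (pos_div_2 eps)) [N HN] := Series_correct _ Hex.
exists (maxn n0 N) => n; rewrite geq_max => /andP [h1 h2].
have H := Clim_csum_inner (n := n) (fun i _ => Ha i).
move/Clim_spec: H => /(_ (pos_div_2 eps)); apply: filter_imp => P /=.
have t := csum_tail_le (n := n) (fun i Hi => Hd P i (leq_trans h1 Hi)) Hg Hex (Hs P).
have /= := HN n (elimT leP h2); have := rsum_le_Series n Hg Hex.
rewrite Rabs_minus_sym => h3; rewrite Rabs_pos_eq; last lra.
rewrite (_ : (s P - csum b n)%C = ((s P - csum (a P) n) + (csum (a P) n - csum b n))%C); last ring.
move=> h4 h5; apply: Rle_lt_trans (Cmod_triangle _ _) _; lra.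
Qed.

Lemma Tannery_sum a b s g n0 l :
  (forall P, Clim (csum (a P)) (s P)) -> (forall n, Clim (fun P => a P n) (b n)) ->
  (forall P n, (n0 <= n)%N -> Cmod (a P n) <= g n) -> (forall n, 0 <= g n) -> ex_series g ->
  Clim s l -> Clim (csum b) l.
Proof.
move=> Hs Ha Hd Hg Hex Hl; apply/Clim_spec => eps.
have [n1 H] := Tannery_aux Hs Ha Hd Hg Hex (pos_div_2 eps).
exists n1 => n /leP/H h.
move/Clim_spec: Hl => /(_ (pos_div_2 eps)) h'.
have [P [/= hP1 hP2]] := filter_ex _ (filter_and _ _ h h').
rewrite (_ : (csum b n - l)%C = ((csum b n - s P) + (s P - l))%C); last ring.
by apply: Rle_lt_trans (Cmod_triangle _ _) _; rewrite Cmod_minus_sym; lra.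
Qed.

Lemma Tannery_lim a b s g n0 l :
  (forall P, Clim (csum (a P)) (s P)) -> (forall n, Clim (fun P => a P n) (b n)) ->
  (forall P n, (n0 <= n)%N -> Cmod (a P n) <= g n) -> (forall n, 0 <= g n) -> ex_series g ->
  Clim (csum b) l -> Clim s l.
Proof.
move=> Hs Ha Hd Hg Hex Hl; apply/Clim_spec => eps.
have [n1 H] := Tannery_aux Hs Ha Hd Hg Hex (pos_div_2 eps).
move/Clim_spec: Hl => /(_ (pos_div_2 eps)) [n2 h'].
have h2 := h' (maxn n1 n2) (elimT leP (leq_maxr _ _)).
apply: filter_imp (H (maxn n1 n2) (leq_maxl _ _)) => P /= hP.
rewrite (_ : (s P - l)%C = ((s P - csum b (maxn n1 n2)) + (csum b (maxn n1 n2) - l))%C); last ring.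
apply: Rle_lt_trans (Cmod_triangle _ _) _; rewrite /= in h2; lra.
Qed.

(** A total choice of the limit, meaningful for convergent sequences only; see [CLim_correct]. *)
Definition CLim (u : nat -> C) : C :=
  (real (Lim_seq (fun n => Re (u n))), real (Lim_seq (fun n => Im (u n)))).

Lemma CLim_correct u l : Clim u l -> Clim u (CLim u).
Proof.
move=> H; rewrite /CLim (is_lim_seq_unique _ _ (Clim_Re H)) (is_lim_seq_unique _ _ (Clim_Im H)) /=.
by case: l H.
Qed.

(** * The complex exponential *)

Definition Cexp (z : C) : C := (exp (Re z) * cos (Im z), exp (Re z) * sin (Im z)).

Lemma Cexp_0 : Cexp 0 = 1.
Proof. rewrite /Cexp /= exp_0 cos_0 sin_0; apply: C_ext => /=. - ring. - ring. Qed.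

Lemma Cexp_plus z w : Cexp (z + w) = (Cexp z * Cexp w)%C.
Proof. by apply: C_ext; rewrite /= exp_plus ?cos_plus ?sin_plus /Re /Im; ring. Qed.

Lemma Cmod_Cexp z : Cmod (Cexp z) = exp (Re z).
Proof.
have e0 := exp_pos (Re z); have h := sin2_cos2 (Im z); rewrite /Rsqr in h.
rewrite /Cmod /= (_ : _ + _ = Rsqr (exp (Re z))); first by rewrite sqrt_Rsqr //; lra.
by rewrite /Rsqr; nra.
Qed.

Lemma Cexp_neq0 z : Cexp z <> 0.
Proof. by apply/Cmod_gt_0; rewrite Cmod_Cexp; apply: exp_pos. Qed.

Lemma Cexp_opp z : Cexp (- z) = (/ Cexp z)%C.
Proof.
have z0 := @Cexp_neq0 z.
rewrite -[LHS]Cmult_1_r -(Cinv_r _ z0) Cmult_assoc -Cexp_plus.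
by rewrite (_ : (- z + z)%C = 0) ?Cexp_0 ?Cmult_1_l //; ring.
Qed.

Lemma Cexp_minus z w : Cexp (z - w) = (Cexp z / Cexp w)%C.
Proof. by rewrite /Cminus Cexp_plus Cexp_opp. Qed.

Lemma Cexp_RtoC x : Cexp (RtoC x) = RtoC (exp x).
Proof. by rewrite /Cexp /= cos_0 sin_0; apply: C_ext => /=; ring. Qed.

Lemma Cexp_INR n z : Cexp (n%:C * z) = (Cexp z ^ n)%C.
Proof.
elim: n => [|n IH]; first by rewrite /= (_ : (0 * z)%C = 0) ?Cexp_0 //; ring.
rewrite S_INR RtoC_plus (_ : ((INR n + 1) * z)%C = (z + INR n * z)%C); last ring.
by rewrite Cexp_plus IH.
Qed.

(** Derivatives along a real parameter are enough, since the estimates are made on segments t w with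
    0 <= t <= 1. *)
Definition Dc (f : R -> C) (t : R) (l : C) :=
  is_derive (fun s => Re (f s)) t (Re l) /\ is_derive (fun s => Im (f s)) t (Im l).

Lemma Dc_eq f t l l' : Dc f t l -> l = l' -> Dc f t l'.
Proof. by move=> H <-. Qed.

Lemma Dc_ext f g t l : (forall s, f s = g s) -> Dc f t l -> Dc g t l.
Proof. by move=> H [h1 h2]; split; [apply: is_derive_ext h1|apply: is_derive_ext h2] => s; rewrite H. Qed.

Lemma Dc_RtoC g t l : is_derive g t l -> Dc (fun s => RtoC (g s)) t (RtoC l).
Proof. by move=> H; split=> //=; apply: is_derive_const. Qed.

Lemma Dc_const c t : Dc (fun _ => c) t 0.
Proof. by split; apply: is_derive_const. Qed.

Lemma Dc_plus f g t l m : Dc f t l -> Dc g t m -> Dc (fun s => f s + g s)%C t (l + m)%C.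
Proof. by move=> [h1 h2] [h3 h4]; split; apply: is_derive_plus. Qed.

Lemma derive_eq (f : R -> R) t (l l' : R) : is_derive f t l -> l = l' -> is_derive f t l'.
Proof. by move=> H <-. Qed.

Lemma derive_mult (f g : R -> R) t (a b : R) : is_derive f t a -> is_derive g t b ->
  is_derive (fun s => f s * g s) t (a * g t + f t * b).
Proof. by move=> Hf Hg; apply: (is_derive_mult f g) => // ? ?; apply: Rmult_comm. Qed.

Lemma Dc_mult f g t l m : Dc f t l -> Dc g t m ->
  Dc (fun s => f s * g s)%C t (l * g t + f t * m)%C.
Proof.
move=> [h1 h2] [h3 h4]; split.
  apply: derive_eq (is_derive_minus _ _ _ _ _ (derive_mult h1 h3) (derive_mult h2 h4)) _.
  by rewrite /minus /plus /opp /= /Re /Im; ring.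
apply: derive_eq (is_derive_plus _ _ _ _ _ (derive_mult h1 h4) (derive_mult h2 h3)) _.
by rewrite /plus /= /Re /Im; ring.
Qed.

Lemma Dc_scal c f t l : Dc f t l -> Dc (fun s => c * f s)%C t (c * l)%C.
Proof. by move=> H; apply: Dc_eq (Dc_mult (Dc_const c t) H) _; ring. Qed.

Lemma Dc_pow m w t : Dc (fun s => (RtoC s * w) ^ m.+1)%C t (m.+1%:C * w * (RtoC t * w) ^ m)%C.
Proof.
apply: Dc_ext (_ : Dc (fun s => w ^ m.+1 * RtoC (s ^ m.+1))%C t _) => [s|].
  by rewrite Cpow_mult_l RtoC_pow Cmult_comm.
apply: Dc_eq (Dc_scal _ (Dc_RtoC (is_derive_pow _ m.+1 t _ (is_derive_id t)))) _.
rewrite (_ : Nat.pred m.+1 = m) // !RtoC_mult RtoC_pow (_ : RtoC Hierarchy.one = 1) //.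
by rewrite Cpow_mult_l Cpow_S; ring.
Qed.

Lemma Dc_exp f t l : Dc f t l -> Dc (fun s => Cexp (f s)) t (l * Cexp (f t))%C.
Proof.
move=> [h1 h2].
have he := is_derive_comp exp _ _ _ _ (is_derive_exp _) h1.
have hc := is_derive_comp cos _ _ _ _ (is_derive_cos _) h2.
have hs := is_derive_comp sin _ _ _ _ (is_derive_sin _) h2.
split.
  by apply: derive_eq (derive_mult he hc) _; rewrite /scal /= /mult /= /Re /Im; ring.
by apply: derive_eq (derive_mult he hs) _; rewrite /scal /= /mult /= /Re /Im; ring.
Qed.

Definition exp_poly (i : nat) (w : C) : C :=
  csum (fun j => w ^ j / (fact j)%:C)%C i.

Lemma fact_neq0 n : (fact n)%:C <> 0.
Proof. by move=> H; apply: (INR_fact_neq_0 n); move: H; rewrite /RtoC => -[]. Qed.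

Lemma Dc_exp_poly i w t : Dc (fun s => exp_poly i.+1 (RtoC s * w)) t (w * exp_poly i (RtoC t * w))%C.
Proof.
elim: i => [|i IH].
  rewrite /exp_poly csum0 Cmult_0_r.
  apply: Dc_ext (Dc_const 1 t) => s.
  by rewrite csumS csum0 /=; field; apply: C1_nz.
have hf := @fact_neq0 i.+1; have hi := @fact_neq0 i; have hn := @CINR_neq0 i.
apply: Dc_ext (_ : Dc (fun s => exp_poly i.+1 (RtoC s * w)
  + / (fact i.+1)%:C * (RtoC s * w) ^ i.+1)%C t _) => [s|].
  by rewrite /exp_poly [in RHS]csumS; congr Cplus; field.
apply: Dc_eq (Dc_plus IH (Dc_scal _ (Dc_pow i w t))) _.
rewrite /exp_poly csumS Cmult_plus_distr_l; congr Cplus.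
rewrite (_ : fact i.+1 = Nat.mul i.+1 (fact i)) // mult_INR RtoC_mult.
by field.
Qed.

(** The function g - u is nondecreasing for u = Re f, - Re f, Im f and - Im f; bounding the modulus
    by the sum of both parts costs the factor 2. *)
Lemma Dc_MVT_mono f df g dg : (forall t, 0 <= t <= 1 -> Dc f t (df t)) ->
  (forall t, 0 <= t <= 1 -> is_derive g t (dg t)) ->
  (forall t, 0 <= t <= 1 -> Cmod (df t) <= dg t) -> Cmod (f 1 - f 0)%C <= 2 * (g 1 - g 0).
Proof.
move=> Hd Hg HM.
have h (u du : R -> R) : (forall t, 0 <= t <= 1 -> is_derive u t (du t)) ->
    (forall t, 0 <= t <= 1 -> Rabs (du t) <= Cmod (df t)) -> u 1 - u 0 <= g 1 - g 0.
  move=> Hu Hb.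
  have Hv t : 0 <= t <= 1 -> is_derive (fun s => g s - u s) t (dg t - du t).
    by move=> Ht; apply: is_derive_minus; [apply: Hg | apply: Hu].
  have [|x|c []] := @MVT_gen (fun s => g s - u s) 0 1 (fun t => dg t - du t).
  - by rewrite Rmin_left ?Rmax_right; try lra; move=> x Hx; apply: Hv; lra.
  - rewrite Rmin_left ?Rmax_right; try lra; move=> Hx; apply: derivable_continuous_pt.
    by exists (dg x - du x); apply/is_derive_Reals; apply: Hv.
  - rewrite Rmin_left ?Rmax_right; try lra; move=> hc.
    by have := Hb c hc; have := HM c hc; have := Rle_abs (du c); lra.
have h2 (u du : R -> R) : (forall t, 0 <= t <= 1 -> is_derive u t (du t)) ->
    (forall t, 0 <= t <= 1 -> Rabs (du t) <= Cmod (df t)) -> Rabs (u 1 - u 0) <= g 1 - g 0.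
  move=> Hu Hb; have h1 := h _ _ Hu Hb.
  have := h (fun t => - u t) (fun t => - du t) => h3; apply: Rabs_le; split; last by [].
  suff : - u 1 - - u 0 <= g 1 - g 0 by lra.
  by apply: h3 => t Ht; [apply: is_derive_opp; apply: Hu | rewrite Rabs_Ropp; apply: Hb].
have hR := h2 _ _ (fun t Ht => proj1 (Hd t Ht)) (fun t _ => re_le_Cmod (df t)).
have hI := h2 _ _ (fun t Ht => proj2 (Hd t Ht)) (fun t _ => Im_le_Cmod (df t)).
by apply: Rle_trans (Cmod_le_ReIm _) _; rewrite Re_minus Im_minus; lra.
Qed.

Lemma Dc_MVT f df M : (forall t, 0 <= t <= 1 -> Dc f t (df t)) ->
  (forall t, 0 <= t <= 1 -> Cmod (df t) <= M) -> Cmod (f 1 - f 0)%C <= 2 * M.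
Proof.
move=> Hd HM; have := @Dc_MVT_mono f df (fun t => M * t) (fun _ => M) Hd _ HM.
rewrite Rmult_1_r Rmult_0_r Rminus_0_r; apply=> t _.
by have := is_derive_scal id t M 1 (is_derive_id t); rewrite Rmult_1_r.
Qed.

(** Along t w the remainder of order i+1 has derivative w times the remainder of order i, so the
    previous bound is integrated; each use of [Dc_MVT_mono] contributes one factor 2. *)
Lemma Cexp_taylor_fact i w :
  Cmod (Cexp w - exp_poly i w) <= 2 ^ i * exp (Cmod w) * (Cmod w ^ i / INR (fact i)).
Proof.
elim: i w => [|i IH] w.
  rewrite /exp_poly csum0 /= (_ : (Cexp w - 0)%C = Cexp w); last ring.
  rewrite Cmod_Cexp; have h : Re w <= Cmod w by apply: Rle_trans (Rle_abs _) (re_le_Cmod w).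
  by have [/exp_increasing|->] := h; lra.
pose f s := (Cexp (RtoC s * w) + (-(1)) * exp_poly i.+1 (RtoC s * w))%C.
have hD t : Dc f t (w * (Cexp (RtoC t * w) - exp_poly i (RtoC t * w)))%C.
  apply: Dc_eq.
    apply: Dc_plus (Dc_scal _ (Dc_exp_poly _ _ _)); apply: Dc_exp.
    exact: Dc_mult (Dc_RtoC (is_derive_id t)) (Dc_const w t).
  by rewrite (_ : RtoC Hierarchy.one = 1) //; ring.
pose g s := 2 ^ i * exp (Cmod w) * (Cmod w ^ i.+1 / INR (fact i.+1)) * s ^ i.+1.
have hi := INR_fact_lt_0 i; have hi1 : 0 < INR i.+1 by apply: lt_0_INR; lia.
have hg t : is_derive g t (2 ^ i * exp (Cmod w) * (Cmod w ^ i.+1 / INR (fact i)) * t ^ i).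
  apply: derive_eq (is_derive_scal _ _ _ _ (is_derive_pow _ i.+1 t _ (is_derive_id t))) _.
  rewrite (_ : fact i.+1 = Nat.mul i.+1 (fact i)) // mult_INR.
  rewrite (_ : Nat.pred i.+1 = i) // [Hierarchy.one](_ : _ = 1) //.
  by move: hi1; set p := INR i.+1 => hi1; rewrite /scal /= /mult /=; field; lra.
have := @Dc_MVT_mono f _ g _ (fun t _ => hD t) (fun t _ => hg t).
have -> : (f 1 - f 0)%C = (Cexp w - exp_poly i.+1 w)%C.
  rewrite /f !Cmult_1_l !Cmult_0_l Cexp_0 /exp_poly csumS.
  have -> : csum (fun j => 0 ^ j / (fact j)%:C)%C i.+1 = 1.
    elim: i {IH hD f g hg hi hi1} => [|m IHm]; first by rewrite csumS csum0 /=; field; apply: C1_nz.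
    by rewrite csumS IHm Cpow_S; have := @fact_neq0 m.+1 => h; field.
  by ring.
have -> : 2 * (g 1 - g 0) = 2 ^ i.+1 * exp (Cmod w) * (Cmod w ^ i.+1 / INR (fact i.+1)).
  by rewrite /g pow1 pow_i; [rewrite (_ : 2 ^ i.+1 = 2 * 2 ^ i) //; ring | lia].
apply=> t Ht; rewrite Cmod_mult.
have h0 := Cmod_ge_0 w; have h1 : Cmod (t * w) = t * Cmod w.
  by rewrite Cmod_mult Cmod_R Rabs_pos_eq; lra.
have h2 : exp (Cmod (t * w)) <= exp (Cmod w).
  by have [/exp_increasing|->] : Cmod (t * w) <= Cmod w by [nra]; lra.
have h3 := IH (RtoC t * w)%C; rewrite {2}h1 Rpow_mult_distr in h3.
apply: Rle_trans (Rmult_le_compat_l _ _ _ h0 h3) _.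
have p2 : 0 <= 2 ^ i by apply: pow_le; lra.
have pt : 0 <= t ^ i by apply: pow_le; lra.
have pw : 0 <= Cmod w ^ i by apply: pow_le.
have pi : 0 < / INR (fact i) by apply: Rinv_0_lt_compat.
rewrite (_ : Cmod w ^ i.+1 = Cmod w * Cmod w ^ i) // /Rdiv.
set a := t ^ i in pt *; set b := Cmod w ^ i in pw *; set e := / _ in pi *.
rewrite (_ : Cmod w * (2 ^ i * exp (Cmod (t * w)) * (a * b * e)) = exp (Cmod (t * w)) * (Cmod w * 2 ^ i * a * b * e)); last ring.
rewrite (_ : 2 ^ i * exp (Cmod w) * (Cmod w * b * e) * a = exp (Cmod w) * (Cmod w * 2 ^ i * a * b * e)); last ring.
apply: Rmult_le_compat_r h2; do !apply: Rmult_le_pos => //; lra.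
Qed.

Lemma Cexp_taylor i w :
  Cmod (Cexp w - exp_poly i w) <= 2 ^ i * exp (Cmod w) * Cmod w ^ i.
Proof.
apply: Rle_trans (Cexp_taylor_fact i w) _; apply: Rmult_le_compat_l.
  by apply: Rmult_le_pos (Rlt_le _ _ (exp_pos _)); apply: pow_le; lra.
apply/Rle_div_l; first exact: INR_fact_lt_0.
have h : 1 <= INR (fact i) by apply: (le_INR 1); apply: Factorial.lt_O_fact.
by have := pow_le _ i (Cmod_ge_0 w); nra.
Qed.

Lemma Cexp_lip w : Cmod w <= 1 -> Cmod (Cexp w - 1) <= 6 * Cmod w.
Proof.
move=> H; have := Cexp_taylor 1 w; rewrite /exp_poly csumS csum0 /=.
rewrite (_ : (Cexp w - _)%C = (Cexp w - 1)%C); last by field; apply: C1_nz.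
have := Cmod_ge_0 w; have h := exp_le_3.
have h1 : exp (Cmod w) <= 3.
  by have [/exp_increasing|->] := H; lra.
nra.
Qed.

(** * Asymptotic expansions along a filter *)

Section Expansions.
Variables (T : Type) (F : (T -> Prop) -> Prop).

(* [expands v J f]: along the filter [F], [f] is a polynomial in [v] of degree
   less than [J] up to an error O(v^J).  The recursive form makes every closure
   property an induction on [J]. *)
Fixpoint expands (v : T -> C) (J : nat) (f : T -> C) : Prop :=
  match J with
  | 0%N => exists M, F (fun x => Cmod (f x) <= M)
  | J'.+1 => exists (c : C) (g : T -> C), F (fun x => f x = (c + v x * g x)%C) /\ expands v J' g
  end.

Hypothesis FF : Filter F.
Variable v : T -> C.
Hypothesis v_lim0 : forall eps : R, 0 < eps -> F (fun x => Cmod (v x) < eps).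
Notation X := (expands v).

Lemma expands_ext J f g : F (fun x => f x = g x) -> X J f -> X J g.
Proof.
case: J => [|J] H.
  by move=> [M HM]; exists M; apply: filter_imp (filter_and _ _ H HM) => x [<-].
move=> [c [h [H1 H2]]]; exists c, h; split=> //.
by apply: filter_imp (filter_and _ _ H H1) => x [<-].
Qed.

Lemma expands_ext' J f g : (forall x, f x = g x) -> X J f -> X J g.
Proof. by move=> H; apply: expands_ext; apply: filter_forall. Qed.

Lemma expands_bdd J f : X J f -> X 0 f.
Proof.
elim: J f => [//|J IH] f [c [g [H1 /IH [M HM]]]].
exists (Cmod c + M); have v1 := v_lim0 Rlt_0_1.
apply: filter_imp (filter_and _ _ H1 (filter_and _ _ HM v1)) => x [-> [h1 h2]].
apply: Rle_trans (Cmod_triangle _ _) _; rewrite Cmod_mult.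
by have := Cmod_ge_0 (g x); have := Cmod_ge_0 (v x); nra.
Qed.

Lemma expands_weak J f : X J.+1 f -> X J f.
Proof.
elim: J f => [|J IH] f; first exact: expands_bdd.
by move=> [c [g [H1 /IH H2]]]; exists c, g.
Qed.

Lemma expands_le J K f : (J <= K)%N -> X K f -> X J f.
Proof. by move=> /subnK <-; elim: (K - J)%N => [//|n IH]; rewrite addSn => /expands_weak. Qed.

Lemma expands_const J c : X J (fun _ => c).
Proof.
elim: J c => [|J IH] c; first by exists (Cmod c); apply: filter_forall => x; lra.
exists c, (fun _ => 0); split; last exact: IH.
by apply: filter_forall => x; ring.
Qed.

Lemma expands_mulv J g : X J g -> X J.+1 (fun x => v x * g x)%C.
Proof. by move=> H; exists 0, g; split=> //; apply: filter_forall => x; ring. Qed.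

Lemma expands_v J : X J v.
Proof. by apply/expands_weak/(expands_ext' _ (expands_mulv (expands_const _ 1))) => x; ring. Qed.

Lemma expands_plus J f g : X J f -> X J g -> X J (fun x => f x + g x)%C.
Proof.
elim: J f g => [|J IH] f g.
  move=> [M HM] [N HN]; exists (M + N).
  apply: filter_imp (filter_and _ _ HM HN) => x [h1 h2].
  by apply: Rle_trans (Cmod_triangle _ _) _; lra.
move=> [c [f' [Hf Xf]]] [d [g' [Hg Xg]]]; exists (c + d)%C, (fun x => f' x + g' x)%C.
split; last exact: IH.
by apply: filter_imp (filter_and _ _ Hf Hg) => x [-> ->]; ring.
Qed.

Lemma expands_scal J c f : X J f -> X J (fun x => c * f x)%C.
Proof.
elim: J f => [|J IH] f.
  move=> [M HM]; exists (Cmod c * M); apply: filter_imp HM => x h.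
  by rewrite Cmod_mult; apply: Rmult_le_compat_l => //; apply: Cmod_ge_0.
move=> [d [f' [Hf Xf]]]; exists (c * d)%C, (fun x => c * f' x)%C.
by split; [apply: filter_imp Hf => x ->; ring | apply: IH].
Qed.

Lemma expands_opp J f : X J f -> X J (fun x => - f x)%C.
Proof. by move=> /(expands_scal (-(1))); apply: expands_ext' => x; ring. Qed.

Lemma expands_minus J f g : X J f -> X J g -> X J (fun x => f x - g x)%C.
Proof. by move=> Hf /expands_opp; apply: expands_plus. Qed.

Lemma expands_mult J f g : X J f -> X J g -> X J (fun x => f x * g x)%C.
Proof.
elim: J f g => [|J IH] f g.
  move=> [M HM] [N HN]; exists (M * N).
  apply: filter_imp (filter_and _ _ HM HN) => x [h1 h2].
  by rewrite Cmod_mult; apply: Rmult_le_compat => //; apply: Cmod_ge_0.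
move=> [c [f' [Hf Xf]]] [d [g' [Hg Xg]]].
exists (c * d)%C, (fun x => c * g' x + d * f' x + v x * (f' x * g' x))%C; split.
  by apply: filter_imp (filter_and _ _ Hf Hg) => x [-> ->]; ring.
apply: expands_plus; first by apply: expands_plus; apply: expands_scal.
by apply/expands_weak/expands_mulv; apply: IH.
Qed.

Lemma expands_pow J f n : X J f -> X J (fun x => f x ^ n)%C.
Proof.
move=> H; elim: n => [|n IH]; first exact: expands_const.
exact: expands_mult.
Qed.

Lemma expands_csum J (f : nat -> T -> C) n : (forall i, (i < n)%N -> X J (f i)) ->
  X J (fun x => csum (fun i => f i x) n).
Proof.
elim: n => [|n IH] H.
  by apply: (expands_ext' _ (expands_const J 0)) => x; rewrite csum0.
apply: (expands_ext' (f := fun x => (csum (fun i => f i x) n + f n x)%C)) => [x|]; first by rewrite csumS.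
by apply: expands_plus (H n _) => //; apply: IH => i Hi; apply: H; apply: ltnW.
Qed.

(** If the constant term c is 0, then f tends to 0 and contradicts the bound [d] along [F].
    Otherwise 1/f = 1/c - v g / (c f), where the 1/f on the right is needed to one order less. *)
Lemma expands_inv J f d : 0 < d -> F (fun x => d <= Cmod (f x)) -> X J f -> X J (fun x => / f x)%C.
Proof.
move=> d0; elim: J f => [|J IH] f Hd.
  move=> _; exists (/ d); apply: filter_imp Hd => x h.
  rewrite Cmod_inv; last by apply/Cmod_gt_0; lra.
  exact: Rinv_le_contravar.
move=> Hf; have Xf := expands_weak Hf; move: Hf => [c [g [Hf Xg]]].
have [Mg HM] := expands_bdd Xg.
have [c0|cn] := Ceq_dec c 0.
  have e0 : 0 < d / (Rabs Mg + 1) by apply: Rdiv_lt_0_compat => //; have := Rabs_pos Mg; lra.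
  apply: (expands_ext _ (expands_const _ 0)).
  apply: filter_imp (filter_and _ _ (filter_and _ _ Hd Hf) (filter_and _ _ HM (v_lim0 e0))).
  move=> x [[h1 h2] [h3 h4]]; exfalso.
  move: h1; rewrite h2 c0 Cplus_0_l Cmod_mult.
  have h5 := Rle_abs Mg; have h6 := Cmod_ge_0 (g x); have h7 := Cmod_ge_0 (v x).
  have h8 : Cmod (v x) * (Rabs Mg + 1) < d.
    apply: Rlt_le_trans (_ : d / (Rabs Mg + 1) * (Rabs Mg + 1) <= _).
      by apply: Rmult_lt_compat_r => //; have := Rabs_pos Mg; lra.
    by right; field; have := Rabs_pos Mg; lra.
  nra.
exists (/ c)%C, (fun x => - (/ c) * (g x * / f x))%C; split; last first.
  by apply: expands_scal; apply: expands_mult => //; apply: IH.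
apply: filter_imp (filter_and _ _ Hd Hf) => x [h1 h2].
have f0 : f x <> 0 by apply/Cmod_gt_0; lra.
have e : (v x * g x = f x - c)%C by rewrite h2; ring.
rewrite (_ : (v x * (- / c * (g x * / f x)) = - / c * ((v x * g x) * / f x))%C); last ring.
by rewrite e; field.
Qed.

Lemma expands_small J f M : F (fun x => v x <> 0) ->
  F (fun x => Cmod (f x) <= M * Cmod (v x) ^ J) -> X J f.
Proof.
move=> Hv; elim: J f => [|J IH] f Hf.
  by exists M; apply: filter_imp Hf => x; rewrite /= Rmult_1_r.
exists 0, (fun x => f x / v x)%C; split.
  by apply: filter_imp Hv => x h; field.
apply: IH; apply: filter_imp (filter_and _ _ Hv Hf) => x [h1 h2].
rewrite Cmod_div //; apply/Rle_div_l; first by apply/Cmod_gt_0.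
by move: h2 => /=; lra.
Qed.

(** The Taylor remainder divided by w^i, with its limit 1/i! at w = 0, so that [exp_rem_step] holds
    for every w. *)
Definition exp_rem (i : nat) (w : C) : C :=
  if Ceq_dec w 0 then (1 / (fact i)%:C)%C
  else ((Cexp w - exp_poly i w) / w ^ i)%C.

Lemma exp_rem_step i w :
  exp_rem i w = (1 / (fact i)%:C + w * exp_rem i.+1 w)%C.
Proof.
rewrite /exp_rem; case: (Ceq_dec w 0) => [e|w0].
  by move=> /=; rewrite e Cmult_0_l Cplus_0_r.
rewrite /is_left /exp_poly csumS Cpow_S; have h := @fact_neq0 i.
by have h1 : (w ^ i)%C <> 0 by [apply: Cpow_nz]; field.
Qed.

Lemma exp_rem_bound i w : Cmod (exp_rem i w) <= 2 ^ i * exp (Cmod w) + 1.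
Proof.
have h0 : 0 <= 2 ^ i * exp (Cmod w).
  by apply: Rmult_le_pos (Rlt_le _ _ (exp_pos _)); apply: pow_le; lra.
rewrite /exp_rem; case: (Ceq_dec w 0) => [w0|w0]; rewrite /is_left.
  rewrite Cmod_div; last exact: fact_neq0.
  rewrite Cmod_1 Cmod_R Rabs_pos_eq; last exact: pos_INR.
  suff : 1 / INR (fact i) <= 1 by lra.
  have h : 1 <= INR (fact i) by apply: (le_INR 1); apply: Factorial.lt_O_fact.
  by apply/Rle_div_l; lra.
have h1 : (w ^ i)%C <> 0 by apply: Cpow_nz.
rewrite Cmod_div // Cmod_pow.
have := Cexp_taylor i w => h2.
suff : Cmod (Cexp w - exp_poly i w) / Cmod w ^ i <= 2 ^ i * exp (Cmod w) by lra.
by apply/Rle_div_l => //; rewrite -Cmod_pow; apply/Cmod_gt_0.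
Qed.

Lemma expands_exp_rem J i g : X J g -> X J (fun x => exp_rem i (v x * g x)%C).
Proof.
elim: J i g => [|J IH] i g Hg.
  have [M HM] := expands_bdd (expands_weak (expands_mulv Hg)).
  exists (2 ^ i * exp M + 1); apply: filter_imp HM => x h.
  apply: Rle_trans (exp_rem_bound _ _) _; apply: Rplus_le_compat_r.
  apply: Rmult_le_compat_l; first by apply: pow_le; lra.
  by have [/exp_increasing|->] := h; lra.
apply: (expands_ext' (f := fun x => (1 / (fact i)%:C +
  v x * (g x * exp_rem i.+1 (v x * g x)))%C)) => [x|].
  by rewrite [in RHS]exp_rem_step; ring.
exists (1 / (fact i)%:C)%C, (fun x => g x * exp_rem i.+1 (v x * g x))%C.
split; first exact: filter_forall.
by apply: expands_mult; [apply: expands_weak | apply: IH; apply: expands_weak].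
Qed.

Lemma exp_rem0 w : exp_rem 0 w = Cexp w.
Proof.
rewrite /exp_rem; case: (Ceq_dec w 0) => [e|w0].
  by move=> /=; rewrite e Cexp_0; field; apply: C1_nz.
by rewrite /is_left /exp_poly csum0 /=; field; apply: C1_nz.
Qed.

Lemma expands_exp J f : X J f -> X J (fun x => Cexp (f x)).
Proof.
case: J => [|J].
  move=> [M HM]; exists (exp M); apply: filter_imp HM => x h.
  rewrite Cmod_Cexp; have h' := Rle_trans _ _ _ (Rle_abs _) (re_le_Cmod (f x)).
  by have [/exp_increasing|->] := Rle_trans _ _ _ h' h; lra.
move=> [c [g [Hf Xg]]].
apply: (expands_ext (f := fun x => (Cexp c * (1 + v x * (g x * exp_rem 1 (v x * g x))))%C)).
  apply: filter_imp Hf => x ->; rewrite Cexp_plus -[Cexp (v x * g x)]exp_rem0 [exp_rem 0 _]exp_rem_step.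
  rewrite (_ : (fact 0)%:C = 1) //; congr Cmult; congr Cplus; last by ring.
  by field; apply: C1_nz.
apply: expands_scal; apply: expands_plus; first exact: expands_const.
by apply: expands_mulv; apply: expands_mult => //; apply: expands_exp_rem.
Qed.

End Expansions.

(** Serves to pass from powers of z to powers of 1 - e^(-z) = 1 - q, which act on coefficients as
    differences. *)
Lemma expands_base_change T (F : (T -> Prop) -> Prop) (FF : Filter F) (v u : T -> C) J f :
  (forall eps, 0 < eps -> F (fun x => Cmod (u x) < eps)) -> F (fun x => u x <> 0) ->
  (forall K, expands F v K (fun x => v x / u x)%C) -> expands F v J f -> expands F u J f.
Proof.
move=> ul u0 Hvu; elim: J f => [//|J IH] f [c [g [Hf /IH Xg]]]; have Xq := IH _ (Hvu J).
exists c, (fun x => (v x / u x) * g x)%C; split.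
  by apply: filter_imp (filter_and _ _ u0 Hf) => x [h ->]; field.
by apply: expands_mult.
Qed.

Lemma expands_poly T (F : (T -> Prop) -> Prop) (FF : Filter F) (v : T -> C) J f :
  expands F v J f -> exists d : nat -> C, exists M,
    F (fun x => Cmod (f x - csum (fun i => d i * v x ^ i)%C J) <= M * Cmod (v x) ^ J).
Proof.
elim: J f => [|J IH] f.
  move=> [M HM]; exists (fun _ => 0), M; apply: filter_imp HM => x.
  by rewrite csum0 /= Rmult_1_r (_ : (f x - 0)%C = f x) //; ring.
move=> [c [g [Hf /IH [d [M H]]]]].
exists (fun i => if i is i'.+1 then d i' else c), M.
apply: filter_imp (filter_and _ _ Hf H) => x [-> h].
rewrite csum_recl (_ : (c + v x * g x - _)%C = (v x * (g x - csum (fun i => d i * v x ^ i) J))%C).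
  rewrite Cmod_mult [_ ^ J.+1](_ : _ = Cmod (v x) * Cmod (v x) ^ J) //.
  by have := Cmod_ge_0 (v x); nra.
rewrite (_ : csum _ J = (v x * csum (fun i => d i * v x ^ i) J)%C); last first.
  by rewrite -csum_scal; apply: csum_ext => i _; rewrite Cpow_S; ring.
by rewrite (_ : (v x ^ 0)%C = 1) //; ring.
Qed.

Lemma Cminus_eq0 (a b : C) : (a - b)%C = 0 -> a = b.
Proof.
move=> h; have -> : a = (a - b + b)%C by ring.
by rewrite h Cplus_0_l.
Qed.

(** * Roots of unity *)

Lemma ex_series_inv_sq : ex_series (fun n => / (INR n.+1 * INR n.+1)).
Proof.
apply: (@ex_series_bounded _ 2) => [i|n].
  by apply/Rlt_le/Rinv_0_lt_compat; have := INR_S_pos i; nra.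
suff : rsum (fun n => / (INR n.+1 * INR n.+1)) n <= 2 - 2 / INR n.+1.
  by have := INR_S_pos n => h; have : 0 < 2 / INR n.+1 by [apply: Rdiv_lt_0_compat; lra]; lra.
elim: n => [|n IH]; first by rewrite rsum0 /=; lra.
rewrite rsumS; apply: Rle_trans (Rplus_le_compat_r _ _ _ IH) _.
rewrite [INR n.+2]S_INR; have h := INR_S_pos n; set t := INR n.+1 in h *.
have ht : 1 <= t by apply: (le_INR 1); lia.
suff : 0 <= 2 / t - 2 / (t + 1) - / (t * t) by lra.
rewrite (_ : _ - _ = (t - 1) / (t * t * (t + 1))); last by field; lra.
by apply: Rdiv_le_0_compat; [lra | apply: Rmult_lt_0_compat; nra].
Qed.

Lemma geom_csum (x : C) n : (csum (fun i => x ^ i) n * (x - 1))%C = (x ^ n - 1)%C.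
Proof.
elim: n => [|n IH]; first by rewrite csum0 /=; ring.
by rewrite csumS Cmult_plus_distr_r IH Cpow_S; ring.
Qed.

Lemma csum_rev f n : csum f n = csum (fun i => f (n - i.+1)%N) n.
Proof. by rewrite /csum (reindex_inj rev_ord_inj). Qed.

Definition cis (t : R) : C := (cos t, sin t).

Lemma cis_exp t : cis t = Cexp (Ci * t).
Proof. by rewrite /Cexp /= !Rmult_0_l !Rmult_1_l Rminus_0_l Ropp_0 Rplus_0_l exp_0 !Rmult_1_l. Qed.

Lemma Cmod_cis t : Cmod (cis t) = 1.
Proof. by rewrite cis_exp Cmod_Cexp /= !Rmult_0_l Rmult_0_r Rminus_0_r exp_0. Qed.

Lemma cis_plus s t : cis (s + t) = (cis s * cis t)%C.
Proof. by rewrite !cis_exp -Cexp_plus RtoC_plus; congr Cexp; ring. Qed.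

Lemma cis_pow t n : (cis t ^ n)%C = cis (INR n * t).
Proof. by rewrite !cis_exp -Cexp_INR RtoC_mult; congr Cexp; ring. Qed.

Lemma cis_opp t : cis (- t) = Cconj (cis t).
Proof. by rewrite /cis cos_neg sin_neg. Qed.

Lemma cis_conj_mul t : (cis t * Cconj (cis t))%C = 1.
Proof.
by rewrite -cis_opp -cis_plus Rplus_opp_r /cis cos_0 sin_0.
Qed.

Lemma cis_2PI : cis (2 * PI) = 1.
Proof. by rewrite /cis cos_2PI sin_2PI. Qed.

Lemma sin_ge_third t : 0 <= t <= 2 -> t / 3 <= sin t.
Proof.
move=> Ht; have h3 := PI2_3_2; have h1 := PI_4.
have [|h _] := SIN t (proj1 Ht); first by rewrite /PI2 in h3; lra.
apply: Rle_trans h.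
rewrite /sin_lb /sin_approx /sum_f_R0 /sin_term /=.
set u := t * (t * (t * 1)).
have hu : u = t * (t * t) by rewrite /u; ring.
have t0 := proj1 Ht; have h4 : 0 <= 4 - t * t by nra.
have e3 : 0 <= t * (4 - t * t) by apply: Rmult_le_pos.
have e5 : 0 <= t * (t * (t * (t * t))) by do !apply: Rmult_le_pos => //.
have e7 : 0 <= t * (t * (t * (t * t))) * (4 - t * t) by apply: Rmult_le_pos.
rewrite /u; nra.
Qed.

(** For t >= 0 the chord |e^(it) - 1| equals 2 sin (t / 2), and sin s >= s / 3 on [0, 2]. *)
Lemma Cmod_cis_sub1 t : Rabs t <= PI -> Rabs t / 3 <= Cmod (cis t - 1).
Proof.
move=> Ht; have h1 := PI_4.
wlog t0 : t Ht / 0 <= t.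
  move=> H; case: (Rle_lt_dec 0 t) => [/H|t0]; first exact.
  have := H (- t); rewrite Rabs_Ropp cis_opp => /(_ Ht) h.
  rewrite (_ : (cis t - 1)%C = Cconj (Cconj (cis t) - 1)%C).
    by rewrite Cmod_conj; apply: h; lra.
  by apply: C_ext => /=; ring.
rewrite (Rabs_pos_eq _ t0) in Ht *.
have hs := @sin_ge_third (t / 2) ltac:(lra).
have e : Cmod (cis t - 1) ^ 2 = (2 * sin (t / 2)) ^ 2.
  have := erefl (t / 2); move: {2 3}(t / 2) => s es; have -> : t = 2 * s by lra.
  rewrite Cmod2_alt !ReIm /Re /Im [_.1]/= [_.2]/= cos_2a_sin sin_2a /=.
  have := sin2_cos2 s; rewrite /Rsqr => h; nra.
have h0 := Cmod_ge_0 (cis t - 1).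
have : t / 3 <= 2 * sin (t / 2) by lra.
move: e h0; set m := Cmod _; set s := 2 * sin _ => e h0 h.
nra.
Qed.

Lemma cis_neq1 t : 0 < t < 2 * PI -> cis t <> 1.
Proof.
move=> Ht e; have e1 : cos t = 1 by have := f_equal Re e.
have hs : 0 < sin (t / 2) by apply: sin_gt_0; lra.
move: e1; rewrite {1}(_ : t = 2 * (t / 2)) ?cos_2a_sin; last field.
nra.
Qed.

Lemma roots_orth N l : (0 < l < N)%N -> csum (fun j => cis (2 * PI * INR l / INR N) ^ j)%C N = 0.
Proof.
move=> /andP [l0 lN]; have hN : 0 < INR N by apply: lt_0_INR; lia.
have hp := PI_RGT_0.
have h0 : 0 < INR l by apply: lt_0_INR; lia.
have h1 : INR l < INR N by apply: lt_INR; lia.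
set t := 2 * PI * INR l / INR N.
have ht : 0 < t < 2 * PI.
  split; first by apply: Rdiv_lt_0_compat => //; nra.
  by apply/Rlt_div_l => //; nra.
have hne : (cis t - 1)%C <> 0.
  by move=> e; apply: (cis_neq1 ht); apply: Cminus_eq0.
have hz : (csum (fun j => cis t ^ j) N * (cis t - 1))%C = 0.
  rewrite geom_csum cis_pow (_ : INR N * t = INR l * (2 * PI)); last by rewrite /t; field; lra.
  by rewrite -cis_pow cis_2PI Cpow_1_l; ring.
rewrite (_ : csum _ N = (csum (fun j => cis t ^ j) N * (cis t - 1) / (cis t - 1))%C); last by field.
by rewrite hz /Cdiv Cmult_0_l.
Qed.

Lemma roots_coth_sum N (X : C) : (0 < N)%N -> 1 < Cmod X ->
  csum (fun j => (X * cis (2 * PI / INR N) ^ j + 1) / (X * cis (2 * PI / INR N) ^ j - 1))%C N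
  = (N%:C * ((X ^ N + 1) / (X ^ N - 1)))%C.
Proof.
move=> N0 HX; set e := cis _.
have hN : 0 < INR N by apply: lt_0_INR; lia.
have XN n : (0 < n)%N -> 1 < Cmod X ^ n.
  by move=> n0; apply: Rlt_pow_R1 => //; apply/ltP.
have sub1 (y : C) : 1 < Cmod y -> (y - 1)%C <> 0.
  by move=> hy /Cminus_eq0 e1; move: hy; rewrite e1 Cmod_1; lra.
have hXN : (X ^ N - 1)%C <> 0 by apply: sub1; rewrite Cmod_pow; apply: XN.
have hj j : (X * e ^ j - 1)%C <> 0.
  by apply: sub1; rewrite Cmod_mult Cmod_pow Cmod_cis pow1 Rmult_1_r.
have eN : (e ^ N)%C = 1.
  by rewrite cis_pow (_ : INR N * (2 * PI / INR N) = 2 * PI) ?cis_2PI //; field; lra.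
have pmul (a : C) n m : ((a ^ n) ^ m = (a ^ m) ^ n)%C by rewrite -!Cpow_muln mulnC.
transitivity (csum (fun j => 1 + 2 / (X ^ N - 1) * csum (fun i => X ^ i * (e ^ i) ^ j) N)%C N).
  apply: csum_ext => j _.
  have g := geom_csum (X * e ^ j) N; rewrite [((X * e ^ j) ^ N)%C]Cpow_mult_l pmul eN Cpow_1_l Cmult_1_r in g.
  rewrite -(csum_ext (f := fun i => ((X * e ^ j) ^ i)%C)); last by move=> i _; rewrite Cpow_mult_l pmul.
  have gi : csum (fun i => ((X * e ^ j) ^ i)%C) N = ((X ^ N - 1) / (X * e ^ j - 1))%C.
    by rewrite -g; field.
  by rewrite gi; field.
rewrite csum_plus csum_scal csum_swap csum_const Cmult_1_r.
rewrite -(prednK N0) csum_recl (prednK N0).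
rewrite [csum _ N.-1](csum_ext (g := fun _ => RtoC 0)) => [|i Hi]; last first.
  transitivity (X ^ i.+1 * csum (fun j => (e ^ i.+1) ^ j) N)%C; first exact: csum_scal.
  rewrite (csum_ext (g := fun j => (cis (2 * PI * INR i.+1 / INR N) ^ j)%C)).
    by rewrite roots_orth; [ring | lia].
  by move=> j _; congr Cpow; rewrite cis_pow; congr cis; field; lra.
rewrite csum_zero (csum_ext (g := fun _ => RtoC 1)) => [|j _]; last first.
  by rewrite (_ : (e ^ 0)%C = 1) // Cpow_1_l /=; ring.
by rewrite csum_const; field.
Qed.

(** Pairs j with N - j for odd N = 2P + 1, that is, a root of unity with its conjugate. *)
Lemma csum_pair g P : csum g (2 * P).+1 = (g 0%N + csum (fun j => g j.+1 + g (2 * P - j)%N) P)%C.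
Proof.
rewrite csum_recl mul2n -addnn csum_add csum_plus; congr (_ + (_ + _))%C.
rewrite csum_rev; apply: csum_ext => i Hi; congr g; lia.
Qed.

Lemma lim_inv_S : is_lim_seq (fun n => / INR n.+1) 0.
Proof.
have := is_lim_seq_inv _ _ (proj1 (is_lim_seq_incr_1 _ _) is_lim_seq_INR) => /(_ ltac:(by [])).
exact.
Qed.

Lemma exp_diff_lim c : Clim (fun P => (2 * P).+1%:C * (Cexp (c / (2 * P).+1%:C) - 1))%C c.
Proof.
apply: (@Clim_squeeze _ _ (fun P => 4 * exp (Cmod c) * Cmod c ^ 2 * / INR P.+1)).
  exists 0%N => P _; have hN := INR_S_pos (2 * P); have cN := @CINR_neq0 (2 * P).
  set N := INR (2 * P).+1 in hN cN *.
  have hP : INR P.+1 <= N by apply: le_INR; lia.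
  have h1 : 1 <= N by apply: (le_INR 1); lia.
  have := Cexp_taylor 2 (c / N); rewrite Cmod_div // Cmod_R (Rabs_pos_eq N); last lra.
  rewrite /exp_poly !csumS csum0 => h.
  rewrite (_ : (N * (Cexp (c / N) - 1) - c)%C =
     (N * (Cexp (c / N) - (0 + (c / N) ^ 0 / INR (fact 0) + (c / N) ^ 1 / INR (fact 1))))%C); last first.
    by rewrite /=; field.
  rewrite Cmod_mult Cmod_R (Rabs_pos_eq N); last lra.
  apply: Rle_trans (Rmult_le_compat_l _ _ _ (Rlt_le _ _ hN) h) _.
  rewrite (_ : N * (2 ^ 2 * exp (Cmod c / N) * (Cmod c / N) ^ 2) = 4 * exp (Cmod c / N) * Cmod c ^ 2 * / N); last by field; lra.
  have c0 := Cmod_ge_0 c.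
  have e1 : exp (Cmod c / N) <= exp (Cmod c).
    have [/exp_increasing|->] : Cmod c / N <= Cmod c; try lra.
    by apply/Rle_div_l => //; nra.
  apply: Rmult_le_compat.
  - by apply: Rmult_le_pos; [have := exp_pos (Cmod c / N); lra | apply: pow_le].
  - by apply/Rlt_le/Rinv_0_lt_compat.
  - by apply: Rmult_le_compat_r; [apply: pow_le | lra].
  - by apply: Rinv_le_contravar => //; apply: INR_S_pos.
by apply: lim0_scal; apply: lim_inv_S.
Qed.

Lemma exp_diff_bound (c : C) P :
  INR (2 * P).+1 * Cmod (Cexp (c / (2 * P).+1%:C) - 1)%C <= 2 * exp (Cmod c) * Cmod c.
Proof.
have hN := INR_S_pos (2 * P); have cN := @CINR_neq0 (2 * P).
set N := INR (2 * P).+1 in hN cN *.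
have h1 : 1 <= N by apply: (le_INR 1); lia.
have := Cexp_taylor 1 (c / N); rewrite Cmod_div // Cmod_R (Rabs_pos_eq N); last lra.
rewrite /exp_poly !csumS csum0 => h.
rewrite -(_ : (Cexp (c / N) - (0 + (c / N) ^ 0 / INR (fact 0)))%C = (Cexp (c / N) - 1)%C); last first.
  by rewrite /=; field; apply: C1_nz.
apply: Rle_trans (Rmult_le_compat_l _ _ _ (Rlt_le _ _ hN) h) _.
rewrite (_ : N * (2 ^ 1 * exp (Cmod c / N) * (Cmod c / N) ^ 1) = 2 * exp (Cmod c / N) * Cmod c); last by field; lra.
have c0 := Cmod_ge_0 c.
have e1 : exp (Cmod c / N) <= exp (Cmod c).
  have [/exp_increasing|->] : Cmod c / N <= Cmod c; try lra.
  by apply/Rle_div_l => //; nra.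
by apply: Rmult_le_compat_r => //; lra.
Qed.

(** * Partial fractions of the cotangent *)

(** Equals coth (w / 2) / 2 - 1 / w; it tends to 1/2 as Re w grows. *)
Definition tau (w : C) : C := (1 / (Cexp w - 1) - 1 / w + 1 / 2)%C.

Lemma C2_neq0 : RtoC 2 <> 0.
Proof. by apply: RtoC_neq0; lra. Qed.

Lemma Re_pos_neq0 (w : C) : 0 < Re w -> w <> 0.
Proof. by move=> h e; move: h; rewrite e /=; lra. Qed.

Lemma Cexp_sub1_neq0 (w : C) : 0 < Re w -> (Cexp w - 1)%C <> 0.
Proof.
move=> h /Cminus_eq0 e; have := Cmod_Cexp w; rewrite e Cmod_1.
have := exp_increasing _ _ h; rewrite exp_0; lra.
Qed.

Lemma Clim_csum_eventually (f : nat -> C) n l : (forall i, (n <= i)%N -> f i = 0) -> csum f n = l -> Clim (csum f) l.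
Proof.
move=> H <-; apply: (@Clim_ext_loc (fun _ => csum f n)); last exact: Clim_const.
exists n => m /leP /subnKC <-; rewrite csum_add.
suff -> : csum (fun i => f (n + i)%N) (m - n) = 0 by ring.
elim: (m - n)%N => [|k IH]; first by rewrite csum0.
by rewrite csumS IH H ?leq_addr //; ring.
Qed.

Lemma inv_sub_pole (w : C) (c : R) : 0 < Re w -> (w - Ci * c)%C <> 0.
Proof. by move=> h; apply: Re_pos_neq0; rewrite !ReIm /=; lra. Qed.

Section CothPartialFractions.
Variable w : C.
Hypothesis w_pos : 0 < Re w.

Let N P := INR (2 * P).+1.
Let X P := Cexp (w / N P).
Let e P j := Cexp (Ci * RtoC (2 * PI * INR j.+1) / N P).
Let e' P j := Cexp (- (Ci * RtoC (2 * PI * INR j.+1)) / N P).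
(** The terms j+1 and N - (j+1) of [roots_coth_sum] at X = e^(w/N), added and divided by N; the
    zeros for j >= P make the finite sum a series, as [Tannery_sum] expects. *)
Let a P j := if (j < P)%N then
  (2 * (N P * (Cexp (2 * w / N P) - 1)) /
    ((N P * (X P - e P j)) * (N P * (X P - e' P j))))%C else RtoC 0.
Let s P := ((Cexp w + 1) / (Cexp w - 1) - (X P + 1) / (N P * (X P - 1)))%C.

Let N_pos P : 0 < N P. Proof. exact: INR_S_pos. Qed.
Let N_neq0 P : RtoC (N P) <> 0. Proof. exact: CINR_neq0. Qed.
Let X_pos P : 0 < Re (w / N P).
Proof.
have h := N_pos P; rewrite (_ : (w / N P)%C = (RtoC (/ N P) * w)%C).
  by rewrite Re_scal; apply: Rmult_lt_0_compat => //; apply: Rinv_0_lt_compat.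
by rewrite RtoC_inv; [rewrite Cmult_comm | lra].
Qed.
Let X_gt1 P : 1 < Cmod (X P).
Proof. by rewrite Cmod_Cexp -exp_0; apply: exp_increasing. Qed.
Let e_cis P j : e P j = cis (2 * PI * INR j.+1 / N P).
Proof.
rewrite cis_exp; congr Cexp; rewrite RtoC_div; last by have := N_pos P; lra.
by rewrite /Cdiv Cmult_assoc.
Qed.
Let e'_inv P j : e' P j = (/ e P j)%C.
Proof. by rewrite -Cexp_opp; congr Cexp; field. Qed.
Let e'_conj P j : e' P j = Cconj (e P j).
Proof.
rewrite e'_inv e_cis; have h := cis_conj_mul (2 * PI * INR j.+1 / N P).
have h0 : cis (2 * PI * INR j.+1 / N P) <> 0 by rewrite -e_cis; apply: Cexp_neq0.
rewrite (_ : Cconj _ = (/ cis (2 * PI * INR j.+1 / N P) * (cis (2 * PI * INR j.+1 / N P) * Cconj (cis (2 * PI * INR j.+1 / N P))))%C).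
  by rewrite h Cmult_1_r.
by field.
Qed.
Let Cmod_e P j : Cmod (e P j) = 1. Proof. by rewrite e_cis Cmod_cis. Qed.
Let Cmod_e' P j : Cmod (e' P j) = 1. Proof. by rewrite e'_conj Cmod_conj Cmod_e. Qed.
Let X_e P (c : C) : Cmod c = 1 -> (X P - c)%C <> 0.
Proof. by move=> h /Cminus_eq0 h'; have := X_gt1 P; rewrite h' h; lra. Qed.

Let sum_a P : csum (a P) P = s P.
Proof.
have h := roots_coth_sum (N := (2 * P).+1) (ltn0Sn _) (X_gt1 P).
have XN : (X P ^ (2 * P).+1)%C = Cexp w.
  by rewrite -Cexp_INR; congr Cexp; rewrite -/(N P); field.
rewrite XN csum_pair -/(N P) in h.
have X1 : (X P - 1)%C <> 0 by apply: X_e; rewrite Cmod_1.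
have w1 := Cexp_sub1_neq0 w_pos.
have -> : s P = (1 / N P * (N P * ((Cexp w + 1) / (Cexp w - 1)) - (X P + 1) / (X P - 1)))%C.
  by rewrite /s; field.
rewrite -h.
rewrite (_ : (X P * cis (2 * PI / N P) ^ 0)%C = X P); last by rewrite /=; ring.
rewrite (_ : forall u v : C, (u + v - u)%C = v); last by move=> u v; ring.
rewrite -csum_scal; apply: csum_ext => j Hj; rewrite /a Hj.
have -> : (cis (2 * PI / N P) ^ j.+1)%C = e P j.
  by rewrite e_cis cis_pow; congr cis; field; have := N_pos P; lra.
have -> : (cis (2 * PI / N P) ^ (2 * P - j))%C = e' P j.
  rewrite e'_conj e_cis -cis_opp cis_pow.
  rewrite (_ : INR (2 * P - j) * (2 * PI / N P) = 2 * PI + - (2 * PI * INR j.+1 / N P)).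
    by rewrite cis_plus cis_2PI Cmult_1_l.
  have -> : INR (2 * P - j) = N P - INR j.+1.
    by rewrite /N -minus_INR; [congr INR; lia | lia].
  by field; have := N_pos P; lra.
rewrite e'_inv.
have e0 : e P j <> 0 by apply: Cexp_neq0.
have h1 := @X_e P _ (Cmod_e P j); have := @X_e P _ (Cmod_e' P j); rewrite e'_inv => h2.
have -> : Cexp (2 * w / N P) = (X P * X P)%C.
  by rewrite -Cexp_plus; congr Cexp; field.
have h3 : (X P * e P j - 1)%C <> 0.
  move=> h3; apply: h2; rewrite (_ : (X P - / e P j)%C = ((X P * e P j - 1) * / e P j)%C).
    by rewrite h3 Cmult_0_l.
  by field.
by field.
Qed.

Let c j := (Ci * RtoC (2 * PI * INR j.+1))%C.
Let b j := (2 * (2 * w) / ((w - c j) * (w + c j)))%C.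
Let wc j : (w - c j)%C <> 0. Proof. exact: inv_sub_pole. Qed.
Let wc' j : (w + c j)%C <> 0.
Proof. by apply: Re_pos_neq0; rewrite !ReIm /=; lra. Qed.

Let lim_a j : Clim (fun P => a P j) (b j).
Proof.
apply: (@Clim_ext_loc (fun P => 2 * (N P * (Cexp (2 * w / N P) - 1)) *
  / ((N P * (X P - 1) - N P * (e P j - 1)) * (N P * (X P - 1) - N P * (e' P j - 1))))%C).
  exists j.+1 => P /leP Hj; rewrite /a Hj /Cdiv; congr (_ * / (_ * _))%C; ring.
apply: Clim_mult; first by apply: Clim_scal; apply: exp_diff_lim.
apply: Clim_inv; first by apply: Cmult_neq_0.
rewrite (_ : (w + c j)%C = (w - - c j)%C); last ring.
by apply: Clim_mult; apply: Clim_minus; apply: exp_diff_lim.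
Qed.

Let lim_s : Clim s (2 * tau w).
Proof.
have w0 := Re_pos_neq0 w_pos; have w1 := Cexp_sub1_neq0 w_pos.
rewrite (_ : (2 * tau w)%C = ((Cexp w + 1) / (Cexp w - 1) - (0 + 2 * / w))%C); last first.
  rewrite /tau; field; do ?split=> //; exact: C2_neq0.
apply: (@Clim_ext (fun P => (Cexp w + 1) / (Cexp w - 1) - (RtoC (/ N P) + 2 * / (N P * (X P - 1))))%C).
  move=> P; have X1 : (X P - 1)%C <> 0 by apply: X_e; rewrite Cmod_1.
  rewrite /s RtoC_inv; last by have := N_pos P; lra.
  by field.
apply: Clim_minus (Clim_const _) _; apply: Clim_plus.
  apply: Clim_RtoC; apply: is_lim_seq_le_le (is_lim_seq_const 0) lim_inv_S => P; split.
    by apply/Rlt_le/Rinv_0_lt_compat.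
  by apply: Rinv_le_contravar; [apply: INR_S_pos | apply: le_INR; lia].
by apply: Clim_scal; apply: Clim_inv => //; apply: exp_diff_lim.
Qed.

Let D := 2 * exp (Cmod w) * Cmod w.
Let D2 := 2 * exp (Cmod (2 * w)) * Cmod (2 * w).

(** As the angle 2 pi (j+1) / N is at most pi, the chord bound gives N |e_j - 1| >= 2 pi (j+1) / 3
    >= 2 (j+1); replacing 1 by X costs at most D. *)
Let den_bound P j : (j < P)%N -> 2 * INR j.+1 - D <= N P * Cmod (X P - e P j) /\
  2 * INR j.+1 - D <= N P * Cmod (X P - e' P j).
Proof.
move=> Hj; have h1 := exp_diff_bound w P; rewrite -/(N P) -/D in h1.
have hN := N_pos P; have hj := INR_S_pos j; have hp := PI2_3_2; rewrite /PI2 in hp.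
have hjP : 2 * INR j.+1 <= N P.
  by rewrite (_ : 2 = INR 2) // -mult_INR; apply: le_INR; lia.
have ht : 0 <= 2 * PI * INR j.+1 / N P <= PI.
  split; first by apply: Rdiv_le_0_compat => //; nra.
  by apply/Rle_div_l => //; nra.
have he : 2 * INR j.+1 <= N P * Cmod (e P j - 1).
  have := @Cmod_cis_sub1 (2 * PI * INR j.+1 / N P); rewrite -e_cis Rabs_pos_eq; last lra.
  move=> /(_ (proj2 ht)) => h.
  apply: Rle_trans (Rmult_le_compat_l _ _ _ (Rlt_le _ _ hN) h).
  rewrite (_ : N P * (2 * PI * INR j.+1 / N P / 3) = 2 * PI * INR j.+1 / 3); last by field; lra.
  nra.
have tri (u : C) : N P * Cmod (u - 1) - D <= N P * Cmod (X P - u).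
  have := Cmod_triang_inv (u - 1) (X P - 1).
  rewrite (_ : (u - 1 - (X P - 1))%C = (u - X P)%C) ?(Cmod_minus_sym u); last ring.
  by rewrite /X in h1 *; nra.
split; first by have := tri (e P j); lra.
have := tri (e' P j); rewrite {1}e'_conj.
rewrite (_ : (Cconj (e P j) - 1)%C = Cconj (e P j - 1)%C) ?Cmod_conj; first lra.
by apply: C_ext => /=; ring.
Qed.

(** At X = e^(w/N), [roots_coth_sum] writes coth (w / 2) for every odd N as a finite sum over
    conjugate pairs, whose terms tend to the partial fractions as N grows. *)
Lemma coth_partial_fractions :
  Clim (csum (fun j => 2 * w / (w * w + RtoC (2 * PI * INR j.+1 * (2 * PI * INR j.+1))))%C) (tau w).
Proof.
have D2_pos : 0 <= D2.
  by rewrite /D2; have := Cmod_ge_0 (2 * w); have := exp_pos (Cmod (2 * w)); nra.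
(* For j >= n0 the bound 2 (j+1) - D of [den_bound] is at least j+1. *)
have [n0 hn0] := INR_unbounded D.
have H : Clim (csum b) (2 * tau w).
  apply: (@Tannery_sum a b s (fun j => 2 * D2 * / (INR j.+1 * INR j.+1)) n0) => //.
  - move=> P. apply: (Clim_csum_eventually (n := P)); last exact: sum_a.
    by move=> i hi; rewrite /a ltnNge hi.
  - move=> P j hj; have hj0 := INR_S_pos j.
    have hD : D <= INR j.+1.
      by apply: Rle_trans (Rlt_le _ _ hn0) _; apply: le_INR; lia.
    rewrite /a; case: ifP => [hjP|_]; last first.
      rewrite Cmod_0; apply: Rmult_le_pos; first lra.
      by apply/Rlt_le/Rinv_0_lt_compat; nra.
    have [h1 h2] := den_bound hjP; have hN := N_pos P.
    rewrite Cmod_div ?Cmod_mult ?Cmod_R; last first.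
      by apply: Cmult_neq_0; apply: Cmult_neq_0 => //; apply: X_e.
    rewrite (Rabs_pos_eq 2) ?(Rabs_pos_eq (N P)); try lra.
    apply: Rmult_le_compat.
    + by have := Cmod_ge_0 (Cexp (2 * w / N P) - 1); nra.
    + by apply/Rlt_le/Rinv_0_lt_compat; nra.
    + by have := exp_diff_bound (2 * w) P; rewrite -/(N P) -/D2; lra.
    + by apply: Rinv_le_contravar; nra.
  - move=> j; have hj0 := INR_S_pos j; apply: Rmult_le_pos; first lra.
    by apply/Rlt_le/Rinv_0_lt_compat; nra.
  - have := ex_series_scal (2 * D2) _ ex_series_inv_sq.
    exact.
have := Clim_scal (/ 2) H; rewrite (_ : (/ 2 * (2 * tau w))%C = tau w); last first.
  by field; apply: C2_neq0.
apply: Clim_ext => n; rewrite -csum_scal; apply: csum_ext => j _.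
have -> : (w * w + RtoC (2 * PI * INR j.+1 * (2 * PI * INR j.+1)))%C = ((w - c j) * (w + c j))%C.
  rewrite /c; set t := (2 * PI * INR j.+1); rewrite (RtoC_mult t t).
  rewrite (_ : ((w - Ci * t) * (w + Ci * t))%C = (w * w - (Ci * Ci) * (t * t))%C); last ring.
  by rewrite (_ : (Ci * Ci = - (1))%C); [ring | apply: C_ext => /=; ring].
rewrite /b; field; do ?split => //; exact: C2_neq0.
Qed.
End CothPartialFractions.

(** * The generating function near q = 1 *)

Lemma exp_sub1_ge K X : 0 < X -> X ^ K.+1 / INR (fact K.+1) <= exp X - 1.
Proof.
move=> hX; have := exp_ge_taylor X K.+1 (Rlt_le _ _ hX).
have h : 1 <= sum_f_R0 (fun k => X ^ k / INR (fact k)) K.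
  elim: K => [|K IH]; first by rewrite /= Rdiv_1_r; lra.
  rewrite tech5; suff : 0 <= X ^ K.+1 / INR (fact K.+1) by lra.
  by apply: Rdiv_le_0_compat; [apply: pow_le; lra | apply: INR_fact_lt_0].
by rewrite tech5; lra.
Qed.

(** A single term of the exponential series gives decay beyond any chosen power of Re w; this is the
    origin of the error smaller than every power. *)
Lemma Cmod_inv_exp_sub1 K (w : C) : 0 < Re w ->
  Cmod (1 / (Cexp w - 1)) <= INR (fact K.+1) / Re w ^ K.+1.
Proof.
move=> hw; have h0 := Cexp_sub1_neq0 hw.
rewrite Cmod_div // Cmod_1.
have h1 := exp_sub1_ge K hw.
have h2 := Cmod_triang_inv (Cexp w) 1; rewrite Cmod_Cexp Cmod_1 in h2.
have h3 : 0 < Re w ^ K.+1 by apply: pow_lt.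
have h4 := INR_fact_lt_0 K.+1.
rewrite (_ : INR (fact K.+1) / Re w ^ K.+1 = / (Re w ^ K.+1 / INR (fact K.+1))); last first.
  by field; split; apply: Rgt_not_eq.
rewrite /Rdiv Rmult_1_l; apply: Rinv_le_contravar; last exact: Rle_trans h1 h2.
exact: Rdiv_lt_0_compat.
Qed.

Lemma Re_inv (z : C) : z <> 0 -> Re (/ z) = Re z / Cmod z ^ 2.
Proof. by move=> z0; rewrite Cmod2_alt. Qed.

Lemma csum_blocks f k P :
  csum f (k * P) = csum (fun i => csum (fun r => f (k * i + r)%N) k) P.
Proof.
elim: P => [|P IH]; first by rewrite muln0 !csum0.
by rewrite mulnS addnC csum_add IH csumS.
Qed.

(** With S = x^2 + N^2, x / S^2 <= x / ((S - x) (S + x)), which is half of 1 / (S - x) - 1 / (S +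
    x); and S + x at x equals S - x at x + 1. *)
Lemma telescoping_bound N P : 0 < N ->
  rsum (fun i => INR i.+1 / ((INR i.+1 * INR i.+1 + N * N) * (INR i.+1 * INR i.+1 + N * N))) P
  <= / (N * N) - / (N * N + INR P.+1 * INR P.+1 - INR P.+1) / 2.
Proof.
move=> hN; elim: P => [|P IH].
  rewrite rsum0 /= (_ : _ + _ - _ = N * N); last ring.
  by have : 0 < / (N * N) by [apply: Rinv_0_lt_compat; nra]; lra.
rewrite rsumS; apply: Rle_trans (Rplus_le_compat_r _ _ _ IH) _.
have hs := INR_S_pos P; rewrite [INR P.+2]S_INR; set x := INR P.+1 in hs *.
have h1 : 1 <= x by apply: (le_INR 1); lia.
have h2 : 0 < N * N by nra.
set a := N * N + x * x - x; set b := N * N + (x + 1) * (x + 1) - (x + 1).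
have ha : 0 < a by rewrite /a; nra.
have hb : 0 < b by rewrite /b; nra.
have hc : 0 < x * x + N * N by nra.
suff : x / ((x * x + N * N) * (x * x + N * N)) <= / a / 2 - / b / 2 by lra.
have e : x = (b - a) / 2 by rewrite /a /b; field.
rewrite (_ : / a / 2 - / b / 2 = (b - a) / 2 / (a * b)); last by field; lra.
rewrite -e.
apply: Rmult_le_compat_l; first lra.
by apply: Rinv_le_contravar; [apply: Rmult_lt_0_compat | rewrite /a /b; nra].
Qed.

(** * Exchange of summations over the pole pairs *)

Section NearArc.
Variable k : nat.
Hypothesis k_gt0 : (0 < k)%N.

Definition phi (w : C) : C := (1 / (Cexp w - 1) - 1 / (Cexp (k%:C * w) - 1))%C.

Let kR : 1 <= INR k. Proof. by apply: (le_INR 1); lia. Qed.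
Let kC : k%:C <> 0. Proof. by apply: RtoC_neq0; lra. Qed.

(* Symmetric under exchanging m and n together with z -> 4 pi^2 / z, so that
   summing over n gives tau (m z) / m and summing over m gives tau (4 pi^2 n / z) / n. *)
Definition pole_pair (z : C) (m n : nat) : C :=
  (2 * z / (m.+1%:C * z * (m.+1%:C * z) +
     RtoC (2 * PI * INR n.+1 * (2 * PI * INR n.+1))))%C.

(** The cut-offs kP and P match: the pair of index m for k z is k times the pair of index k m for z,
    so the difference regroups into blocks of k small terms. *)
Definition pole_pair_sum (z : C) P n := (csum (fun m => pole_pair z m n) (k * P) - csum (fun m => pole_pair (k%:C * z) m n) P)%C.

Definition tau_sum (z : C) P := (csum (fun m => tau (m.+1%:C * z) / m.+1%:C) (k * P) -
  csum (fun m => tau (m.+1%:C * (k%:C * z)) / m.+1%:C) P)%C.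

Section FixedPoint.
Variable z : C.
Hypothesis z_pos : 0 < Re z.

Let z0 : z <> 0. Proof. exact: Re_pos_neq0. Qed.
Let zm_pos m : 0 < Re (m.+1%:C * z).
Proof. by rewrite Re_scal; apply: Rmult_lt_0_compat => //; apply: INR_S_pos. Qed.

Definition dual_arg (z : C) (n : nat) : C := (RtoC (2 * PI * (2 * PI) * INR n.+1) * / z)%C.

Lemma dual_arg_pos n : 0 < Re (dual_arg z n).
Proof.
rewrite Re_scal Re_inv //; have h := PI_RGT_0; have hn := INR_S_pos n.
have hz : 0 < Cmod z by apply/Cmod_gt_0.
apply: Rmult_lt_0_compat; first by do !apply: Rmult_lt_0_compat => //; lra.
by apply: Rdiv_lt_0_compat => //; apply: pow_lt.
Qed.

Lemma den_fact (m n : nat) : (m.+1%:C * z * (m.+1%:C * z) +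
     RtoC (2 * PI * INR n.+1 * (2 * PI * INR n.+1)) =
  (m.+1%:C * z - Ci * RtoC (2 * PI * INR n.+1)) *
  (m.+1%:C * z + Ci * RtoC (2 * PI * INR n.+1)))%C.
Proof.
set t := 2 * PI * INR n.+1; set y := (RtoC _ * z)%C; rewrite (RtoC_mult t t).
rewrite (_ : ((y - Ci * t) * (y + Ci * t))%C = (y * y - (Ci * Ci) * (t * t))%C); last ring.
by rewrite (_ : (Ci * Ci = - (1))%C); [ring | apply: C_ext => /=; ring].
Qed.

(** For y = m z + 2 pi i n or m z - 2 pi i n, the bounds m Re z <= |y| and 2 pi n - m |z| <= |y|
    give m + n <= |y| + m (|z| + 1) <= |y| (1 + (|z| + 1) / Re z). *)
Let c1 := / (1 + (Cmod z + 1) / Re z).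
Let c1_pos : 0 < c1.
Proof.
apply: Rinv_0_lt_compat; suff : 0 <= (Cmod z + 1) / Re z by lra.
by apply: Rdiv_le_0_compat => //; have := Cmod_ge_0 z; lra.
Qed.

Let lin_bound m n (u : C) : u = (Ci * RtoC (2 * PI * INR n.+1))%C \/ u = (- (Ci * RtoC (2 * PI * INR n.+1)))%C ->
  c1 * (INR m.+1 + INR n.+1) <= Cmod (m.+1%:C * z + u).
Proof.
move=> hu; have hm := INR_S_pos m; have hn := INR_S_pos n; have hp := PI2_3_2; rewrite /PI2 in hp.
have hr : Re u = 0 by case: hu => ->; rewrite /=; ring.
have hM : Cmod u = 2 * PI * INR n.+1.
  have e : Cmod (Ci * RtoC (2 * PI * INR n.+1)) = 2 * PI * INR n.+1.
    by rewrite Cmod_mult Cmod_Ci Cmod_R Rabs_pos_eq ?Rmult_1_l //; nra.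
  by case: hu => ->; rewrite ?Cmod_opp.
set y := (_ + u)%C.
have h1 : INR m.+1 * Re z <= Cmod y.
  apply: Rle_trans (Rle_trans _ _ _ (Rle_abs _) (re_le_Cmod y)).
  by rewrite /y Re_plus Re_scal hr; lra.
have h2 : 2 * PI * INR n.+1 - INR m.+1 * Cmod z <= Cmod y.
  have := Cmod_triang_inv u (- (m.+1%:C * z)); rewrite Cmod_opp Cmod_mult Cmod_R hM.
  rewrite (Rabs_pos_eq (INR m.+1)); last lra.
  by rewrite (_ : (u - - (INR m.+1 * z))%C = y) // /y; ring.
have h3 : INR m.+1 * (Cmod z + 1) <= Cmod y * ((Cmod z + 1) / Re z).
  rewrite (_ : INR m.+1 * (Cmod z + 1) = (INR m.+1 * Re z) * ((Cmod z + 1) / Re z)); last by field; lra.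
  apply: Rmult_le_compat_r => //; apply: Rdiv_le_0_compat => //; have := Cmod_ge_0 z; lra.
rewrite /c1 Rmult_comm; apply/Rle_div_l; first by apply: Rlt_gt; rewrite -(Rinv_inv (1 + _)); apply: Rinv_0_lt_compat.
nra.
Qed.

Let Q_bound m n : c1 * c1 * (INR m.+1 * INR m.+1 + INR n.+1 * INR n.+1) <=
  Cmod (m.+1%:C * z * (m.+1%:C * z) + RtoC (2 * PI * INR n.+1 * (2 * PI * INR n.+1))).
Proof.
rewrite den_fact Cmod_mult.
have h1 := @lin_bound m n _ (or_introl erefl); have h2 := @lin_bound m n _ (or_intror erefl).
have hm := INR_S_pos m; have hn := INR_S_pos n.
apply: Rle_trans (_ : (c1 * (INR m.+1 + INR n.+1)) * (c1 * (INR m.+1 + INR n.+1)) <= _).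
  rewrite (_ : _ * _ * (_ * _) = c1 * c1 * ((INR m.+1 + INR n.+1) * (INR m.+1 + INR n.+1))); last ring.
  by apply: Rmult_le_compat_l; nra.
have h0 : 0 <= c1 * (INR m.+1 + INR n.+1) by nra.
exact: Rmult_le_compat.
Qed.

Let Q_neq0 m n : (m.+1%:C * z * (m.+1%:C * z) + RtoC (2 * PI * INR n.+1 * (2 * PI * INR n.+1)))%C <> 0.
Proof.
apply/Cmod_gt_0; apply: Rlt_le_trans (Q_bound m n).
by have hm := INR_S_pos m; have hn := INR_S_pos n; apply: Rmult_lt_0_compat; nra.
Qed.

Lemma sum_pole_pair_n m : Clim (csum (pole_pair z m)) (tau (m.+1%:C * z) / m.+1%:C)%C.
Proof.
have hm := @CINR_neq0 m.
have := Clim_scal (/ m.+1%:C) (coth_partial_fractions (zm_pos m)).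
rewrite [(/ _ * tau _)%C]Cmult_comm; apply: Clim_ext => n.
rewrite -csum_scal; apply: csum_ext => j _; rewrite /pole_pair; have h := @Q_neq0 m j; field.
by split.
Qed.

Lemma sum_pole_pair_m n : Clim (csum (fun m => pole_pair z m n)) (tau (dual_arg z n) / n.+1%:C)%C.
Proof.
have hn := @CINR_neq0 n.
have := Clim_scal (/ n.+1%:C) (coth_partial_fractions (dual_arg_pos n)).
rewrite [(/ _ * tau _)%C]Cmult_comm; apply: Clim_ext => m.
rewrite -csum_scal; apply: csum_ext => j _; rewrite /pole_pair /dual_arg.
move: (@Q_neq0 j n) PI_RGT_0; move: PI => p; rewrite !RtoC_mult => h p0.
have hp : RtoC p <> 0 by apply: RtoC_neq0; lra.
have h2 := C2_neq0.
have e : ((2 * p * (2 * p) * INR n.+1 * / z) * (2 * p * (2 * p) * INR n.+1 * / z) + 2 * p * INR j.+1 * (2 * p * INR j.+1)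
  = (2 * p * (2 * p)) * (INR j.+1 * z * (INR j.+1 * z) + 2 * p * INR n.+1 * (2 * p * INR n.+1)) / (z * z))%C.
  by field.
rewrite e; field; by do ?split.
Qed.

Let pole_pair_scal m n : pole_pair (k%:C * z) m n = csum (fun _ => pole_pair z (k * m + k.-1) n) k.
Proof.
rewrite csum_const /pole_pair.
have -> : INR (k * m + k.-1).+1 = INR k * INR m.+1.
  by rewrite -mult_INR; congr INR; lia.
rewrite (RtoC_mult (INR k)) /Cdiv [RHS]Cmult_assoc; congr (_ * / (_ + _))%C; ring.
Qed.

Let pole_pair_sum_blocks P n : pole_pair_sum z P n = csum (fun i => csum (fun r => pole_pair z (k * i + r) n - pole_pair z (k * i + k.-1) n)%C k) P.
Proof.
rewrite /pole_pair_sum csum_blocks -csum_minus; apply: csum_ext => i _.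
by rewrite pole_pair_scal csum_minus.
Qed.

Let C0 := 4 * Cmod z ^ 3 * (INR k * INR k) / (c1 * c1 * (c1 * c1)).
Let C0_ge0 : 0 <= C0.
Proof.
apply: Rdiv_le_0_compat; last by do !apply: Rmult_lt_0_compat => //.
by apply: Rmult_le_pos; [have := pow_le _ 3 (Cmod_ge_0 z); lra | nra].
Qed.

(** Within a block the squared indices differ by at most k times their sum, so the difference decays
    like an inverse cube of the size of (i, n), a single pair only like an inverse square. *)
Let pole_pair_diff i r n : (r < k)%N -> Cmod (pole_pair z (k * i + r) n - pole_pair z (k * i + k.-1) n) <=
  C0 * (INR i.+1 / ((INR i.+1 * INR i.+1 + INR n.+1 * INR n.+1) * (INR i.+1 * INR i.+1 + INR n.+1 * INR n.+1))).
Proof.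
move=> hr; set a := (k * i + r)%N; set b := (k * i + k.-1)%N.
rewrite /pole_pair; have ha := @Q_neq0 a n; have hb := @Q_neq0 b n.
have Ba := @Q_bound a n; have Bb := @Q_bound b n.
set t := RtoC (_ * _) in ha hb Ba Bb *.
set Qa := (_ + t)%C in ha Ba; set Qb := (_ + t)%C in hb Bb.
have e : (2 * z / Qa - 2 * z / Qb = 2 * z * (z * z) * RtoC ((INR b.+1 - INR a.+1) * (INR b.+1 + INR a.+1)) / (Qa * Qb))%C.
  rewrite RtoC_mult RtoC_minus RtoC_plus.
  rewrite (_ : (2 * z / Qa - 2 * z / Qb = 2 * z * (Qb - Qa) / (Qa * Qb))%C); last by field.
  by rewrite {1}/Qa {1}/Qb; congr Cdiv; ring.
rewrite e.
have hi := INR_S_pos i; have hn := INR_S_pos n.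
have h1 : INR i.+1 <= INR a.+1 by apply: le_INR; rewrite /a; nia.
have h2 : INR a.+1 <= INR b.+1 by apply: le_INR; rewrite /a /b; lia.
have h3 : INR b.+1 <= INR k * INR i.+1 by rewrite -mult_INR; apply: le_INR; rewrite /b; nia.
have h4 : INR b.+1 - INR a.+1 <= INR k by rewrite -minus_INR; [apply: le_INR; rewrite /a /b; lia|rewrite /a /b; lia].
rewrite Cmod_div; last exact: Cmult_neq_0.
rewrite !Cmod_mult !Cmod_R (Rabs_pos_eq 2); last lra.
rewrite Rabs_pos_eq; last by apply: Rmult_le_pos; lra.
set S := INR i.+1 * INR i.+1 + INR n.+1 * INR n.+1.
have hS : 0 < S by rewrite /S; nra.
have hcc : 0 < c1 * c1 by apply: Rmult_lt_0_compat.
have Sa : c1 * c1 * S <= Cmod Qa.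
  by apply: Rle_trans Ba; apply: Rmult_le_compat_l; [lra | rewrite /S; nra].
have Sb : c1 * c1 * S <= Cmod Qb.
  by apply: Rle_trans Bb; apply: Rmult_le_compat_l; [lra | rewrite /S; nra].
have hp : 0 < c1 * c1 * S by apply: Rmult_lt_0_compat.
rewrite (_ : C0 * (INR i.+1 / (S * S)) = (4 * Cmod z ^ 3 * (INR k * INR k * INR i.+1)) / (c1 * c1 * S * (c1 * c1 * S))); last first.
  by rewrite /C0; field; lra.
have hz := Cmod_ge_0 z; have hz3 : 0 <= Cmod z ^ 3 by apply: pow_le.
apply: Rmult_le_compat.
- by apply: Rmult_le_pos; [nra | apply: Rmult_le_pos; lra].
- by apply/Rlt_le/Rinv_0_lt_compat; nra.
- have : (INR b.+1 - INR a.+1) * (INR b.+1 + INR a.+1) <= INR k * (2 * (INR k * INR i.+1)).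
    by apply: Rmult_le_compat; lra.
  rewrite (_ : 2 * Cmod z * (Cmod z * Cmod z) = 2 * Cmod z ^ 3); last by rewrite /=; ring.
  set q := (_ - _) * _; move=> hq.
  have : 2 * Cmod z ^ 3 * q <= 2 * Cmod z ^ 3 * (INR k * (2 * (INR k * INR i.+1))).
    by apply: Rmult_le_compat_l; lra.
  by lra.
- by apply: Rinv_le_contravar; [nra | apply: Rmult_le_compat; lra].
Qed.

(** Uniformity in P is the point: the bound dominates the sum over n while P tends to infinity. *)
Lemma pole_pair_sum_bound : exists C1, 0 <= C1 /\ forall P n, Cmod (pole_pair_sum z P n) <= C1 * / (INR n.+1 * INR n.+1).
Proof.
exists (INR k * C0); split=> [|P n]; first by apply: Rmult_le_pos; lra.
rewrite pole_pair_sum_blocks; apply: Rle_trans (Cmod_csum _ _) _.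
have hn := INR_S_pos n.
apply: Rle_trans (_ : INR k * C0 * rsum (fun i => INR i.+1 / ((INR i.+1 * INR i.+1 + INR n.+1 * INR n.+1) * (INR i.+1 * INR i.+1 + INR n.+1 * INR n.+1))) P <= _).
  rewrite -rsum_scal; apply: rsum_le => i _.
  apply: Rle_trans (Cmod_csum _ _) _; apply: Rle_trans (rsum_le (fun r hr => pole_pair_diff i n hr)) _.
  by rewrite Rmult_assoc rsum_const; lra.
apply: Rmult_le_compat_l; first by apply: Rmult_le_pos; lra.
apply: Rle_trans (telescoping_bound P hn) _.
have hp := INR_S_pos P.
have : 1 <= INR P.+1 by apply: (le_INR 1); lia.
move=> h1; suff : 0 <= / (INR n.+1 * INR n.+1 + INR P.+1 * INR P.+1 - INR P.+1) by lra.
by apply/Rlt_le/Rinv_0_lt_compat; nra.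
Qed.

End FixedPoint.

Section Limit.
Variable z : C.
Hypothesis z_pos : 0 < Re z.
Let kz_pos : 0 < Re (k%:C * z).
Proof. by rewrite Re_scal; apply: Rmult_lt_0_compat => //; lra. Qed.

(** For fixed P the sum over n of [pole_pair_sum] is [tau_sum]; for fixed n its limit in P is the
    dual term. [Tannery_lim] exchanges the two limits. *)
Lemma tau_sum_lim l :
  Clim (csum (fun n => tau (dual_arg z n) / n.+1%:C - tau (dual_arg (k%:C * z) n) / n.+1%:C)%C) l ->
  Clim (tau_sum z) l.
Proof.
move=> H.
have [C1 [C1p HC1]] := pole_pair_sum_bound z_pos.
apply: (Tannery_lim (a := pole_pair_sum z) (g := fun n => C1 * / (INR n.+1 * INR n.+1)) (n0 := 0)) H.
- move=> P; rewrite /pole_pair_sum /tau_sum.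
  apply: (@Clim_ext (fun N => csum (fun m => csum (pole_pair z m) N) (k * P) - csum (fun m => csum (pole_pair (k%:C * z) m) N) P)%C).
    by move=> N; rewrite csum_minus csum_swap (csum_swap _ P).
  by apply: Clim_minus; apply: Clim_csum_inner => i _; [apply: sum_pole_pair_n | apply: sum_pole_pair_n].
- move=> n; apply: Clim_minus; last exact: sum_pole_pair_m.
  apply: (@Clim_subseq _ _ (fun P => (k * P)%N)); last exact: sum_pole_pair_m.
  by move=> P; nia.
- by move=> P n _; apply: HC1.
- move=> n; apply: Rmult_le_pos; first lra.
  by apply/Rlt_le/Rinv_0_lt_compat; have := INR_S_pos n; nra.
- exact: (ex_series_scal C1 _ ex_series_inv_sq).
Qed.
End Limit.
End NearArc.

(** * Expansion of the sum of phi (m z) / m at z = 0 *)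

Section NearArcExpansion.
Variable k : nat.
Hypothesis k_gt0 : (0 < k)%N.
Let kR : 1 <= INR k. Proof. by apply: (le_INR 1); lia. Qed.
Let kC : k%:C <> 0. Proof. by apply: RtoC_neq0; lra. Qed.

Definition inv_sq (n : nat) : R := / (INR n.+1 * INR n.+1).
Definition zeta2 := Series inv_sq.
(** In tau (4 pi^2 n / z) - tau (4 pi^2 n / (k z)) the constants 1/2 cancel and the terms - 1 / w
    leave (k - 1) z / (4 pi^2 n); dividing by n and summing gives this coefficient of z. *)
Definition lin_coef := (INR k - 1) * zeta2 / (2 * PI * (2 * PI)).

Lemma zeta2_lim : is_lim_seq (rsum inv_sq) zeta2.
Proof. exact: (proj1 (is_series_rsum _ _) (Series_correct _ ex_series_inv_sq)). Qed.

Lemma zeta2_pos : 0 < zeta2.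
Proof.
have pos i : 0 <= / (INR i.+1 * INR i.+1).
  by apply/Rlt_le/Rinv_0_lt_compat; have := INR_S_pos i; nra.
have := rsum_le_Series 1 pos ex_series_inv_sq.
by rewrite rsumS rsum0 (_ : INR 1 = 1) // Rmult_1_l Rinv_1 -/zeta2; lra.
Qed.

Section FixedPoint.
Variable z : C.
Hypothesis z_pos : 0 < Re z.
Let z0 : z <> 0. Proof. exact: Re_pos_neq0. Qed.
Let kz_pos : 0 < Re (k%:C * z).
Proof. by rewrite Re_scal; apply: Rmult_lt_0_compat => //; lra. Qed.
Let zm_pos m : 0 < Re (m.+1%:C * z).
Proof. by rewrite Re_scal; apply: Rmult_lt_0_compat => //; apply: INR_S_pos. Qed.

Let t n := ((1 / (Cexp (dual_arg z n) - 1) - 1 / (Cexp (dual_arg (k%:C * z) n) - 1)) / n.+1%:C)%C.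
(** The reciprocal of Re (1 / z), which governs the decay of the dual terms. *)
Let D := Cmod z ^ 2 / Re z.

Let t_bound K n : Cmod (t n) <=
  2 * INR (fact K.+1) * INR k ^ K.+1 * D ^ K.+1 * / (INR n.+1 * INR n.+1).
Proof.
have hn := INR_S_pos n; have hn1 : 1 <= INR n.+1 by apply: (le_INR 1); lia.
have hz : 0 < Cmod z by apply/Cmod_gt_0.
have hD : 0 < D by apply: Rdiv_lt_0_compat => //; apply: pow_lt.
have hp := PI2_3_2; rewrite /PI2 in hp.
have hpp : 1 <= 2 * PI * (2 * PI) by nra.
have hf := INR_fact_lt_0 K.+1.
have gen (w : C) : 0 < Re w -> INR n.+1 / (INR k * D) <= Re w ->
  Cmod (1 / (Cexp w - 1)) <= INR (fact K.+1) * (INR k ^ K.+1 * D ^ K.+1 * / INR n.+1).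
  move=> hw hw2; apply: Rle_trans (Cmod_inv_exp_sub1 K hw) _.
  apply: Rmult_le_compat_l; first lra.
  rewrite -Rpow_mult_distr.
  have h1 : 0 < (INR k * D) ^ K.+1 by apply: pow_lt; apply: Rmult_lt_0_compat; lra.
  rewrite (_ : _ * / INR n.+1 = / (INR n.+1 / (INR k * D) ^ K.+1)); last by field; split; apply: Rgt_not_eq.
  apply: Rinv_le_contravar; first exact: Rdiv_lt_0_compat.
  apply: Rle_trans (_ : (INR n.+1 / (INR k * D)) ^ K.+1 <= _).
    rewrite /Rdiv (Rpow_mult_distr (INR n.+1)) pow_inv; apply: Rmult_le_compat_r.
      by apply/Rlt_le/Rinv_0_lt_compat.
    by rewrite -{1}(pow_1 (INR n.+1)); apply: Rle_pow => //; lia.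
  apply: pow_incr; split=> //; apply: Rdiv_le_0_compat; first lra.
  by apply: Rmult_lt_0_compat; lra.
have Rw : Re (dual_arg z n) = 2 * PI * (2 * PI) * INR n.+1 / D.
  by rewrite Re_scal Re_inv // /D; field; split; apply: Rgt_not_eq.
have Rw2 : Re (dual_arg (k%:C * z) n) = 2 * PI * (2 * PI) * INR n.+1 / (INR k * D).
  rewrite Re_scal Re_inv; last exact: Cmult_neq_0.
  rewrite Cmod_mult Cmod_R Rabs_pos_eq ?Re_scal /D; last lra.
  by field; do ?split; apply: Rgt_not_eq; lra.
have b1 : Cmod (1 / (Cexp (dual_arg z n) - 1)) <= INR (fact K.+1) * (INR k ^ K.+1 * D ^ K.+1 * / INR n.+1).
  apply: gen; first exact: dual_arg_pos.
  rewrite Rw; apply: Rmult_le_compat; [lra | | nra | ].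
    by apply/Rlt_le/Rinv_0_lt_compat; nra.
  by apply: Rinv_le_contravar => //; nra.
have b2 : Cmod (1 / (Cexp (dual_arg (k%:C * z) n) - 1)) <= INR (fact K.+1) * (INR k ^ K.+1 * D ^ K.+1 * / INR n.+1).
  apply: gen; first exact: dual_arg_pos.
  rewrite Rw2; apply: Rmult_le_compat_r; last nra.
  by apply/Rlt_le/Rinv_0_lt_compat; nra.
rewrite /t Cmod_div; last exact: CINR_neq0.
rewrite Cmod_R (Rabs_pos_eq (INR _)); last lra.
rewrite (_ : _ * / (INR n.+1 * INR n.+1) = (2 * (INR (fact K.+1) * (INR k ^ K.+1 * D ^ K.+1 * / INR n.+1))) * / INR n.+1); last first.
  by field; apply: Rgt_not_eq.
apply: Rmult_le_compat_r; first by apply/Rlt_le/Rinv_0_lt_compat.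
apply: Rle_trans (Cmod_triangle _ _) _; rewrite Cmod_opp; lra.
Qed.

(** Besides the linear part, the dual series has only terms 1 / (e^w - 1) with Re w of size at least
    n / (k D), each below every power of D. *)
Lemma dual_sum : exists l, Clim (tau_sum k z) l /\ forall K, Cmod (l - RtoC lin_coef * z) <=
  2 * INR (fact K.+1) * INR k ^ K.+1 * zeta2 * D ^ K.+1.
Proof.
have ex K : ex_series (fun n => 2 * INR (fact K.+1) * INR k ^ K.+1 * D ^ K.+1 * / (INR n.+1 * INR n.+1)).
  exact: (ex_series_scal (2 * INR (fact K.+1) * INR k ^ K.+1 * D ^ K.+1) _ ex_series_inv_sq).
have [l Hl] : exists l, Clim (csum t) l.
  apply: csum_abs_cv; apply: ex_series_dom (ex 0%N) => n.
  by split; [apply: Cmod_ge_0 | apply: t_bound].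
exists (RtoC lin_coef * z + l)%C; split; last first.
  move=> K; rewrite (_ : (lin_coef * z + l - lin_coef * z)%C = l); last ring.
  apply: Rle_trans (Cmod_csum_lim (t_bound K) (ex K) Hl) _.
  by rewrite Series_scal_l -/zeta2; lra.
apply: tau_sum_lim => //.
have Hs : Clim (fun P => RtoC (rsum inv_sq P) * (RtoC ((INR k - 1) / (2 * PI * (2 * PI))) * z))%C (lin_coef * z)%C.
  rewrite (_ : (lin_coef * z)%C = (RtoC zeta2 * (RtoC ((INR k - 1) / (2 * PI * (2 * PI))) * z))%C); last first.
    by rewrite Cmult_assoc -RtoC_mult; congr (RtoC _ * _)%C; rewrite /lin_coef /Rdiv; ring.
  by apply: Clim_mult (Clim_const _); apply: Clim_RtoC; apply: zeta2_lim.
apply: Clim_ext (Clim_plus Hs Hl) => P.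
rewrite -csum_RtoC Cmult_comm -csum_scal -csum_plus; apply: csum_ext => n _; rewrite /inv_sq.
have hp := PI_RGT_0; have hn := INR_S_pos n.
rewrite RtoC_inv; last nra.
rewrite RtoC_div; last nra.
rewrite RtoC_minus (RtoC_mult (INR n.+1)) /t /tau.
have cn := @CINR_neq0 n.
have w1 := Cexp_sub1_neq0 (dual_arg_pos z_pos n); have w2 := Cexp_sub1_neq0 (dual_arg_pos kz_pos n).
set e1 := (Cexp (dual_arg z n) - 1)%C in w1 *; set e2 := (Cexp (dual_arg (INR k * z) n) - 1)%C in w2 *.
rewrite /dual_arg (RtoC_mult _ (INR n.+1)).
have c0 : RtoC (2 * PI * (2 * PI)) <> 0 by apply: RtoC_neq0; nra.
by field; do ?split=> //; apply: C2_neq0.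
Qed.

Lemma phi_tau w : 0 < Re w ->
  phi k w = (tau w - tau (k%:C * w) + RtoC (1 - / INR k) / w)%C.
Proof.
move=> hw; have w0 := Re_pos_neq0 hw; have w1 := Cexp_sub1_neq0 hw.
have w2 : (Cexp (k%:C * w) - 1)%C <> 0.
  by apply: Cexp_sub1_neq0; rewrite Re_scal; apply: Rmult_lt_0_compat => //; lra.
rewrite /phi /tau RtoC_minus RtoC_inv; last lra.
by field; do ?split=> //; apply: C2_neq0.
Qed.

Definition phi_sum (z : C) P := csum (fun m => phi k (m.+1%:C * z) / m.+1%:C)%C P.
(* The tail of the sum of tau (m z) / m is independent of z in the limit, since
   tau tends to 1/2; hence the constant c0 below does not depend on z. *)
Definition harm P := rsum (fun i => / INR (P + i).+1 / 2) (k.-1 * P).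

Lemma phi_term_bound n : Cmod (phi k (n.+1%:C * z) / n.+1%:C) <= 4 / Re z ^ 2 * inv_sq n.
Proof.
rewrite /inv_sq; have hn := INR_S_pos n; have hn1 : 1 <= INR n.+1 by apply: (le_INR 1); lia.
rewrite Cmod_div; last exact: CINR_neq0.
rewrite Cmod_R (Rabs_pos_eq (INR _)); last lra.
have x2 : 0 < Re z ^ 2 by apply: pow_lt.
have gen (w : C) : INR n.+1 * Re z <= Re w -> Cmod (1 / (Cexp w - 1)) <= 2 / Re z ^ 2 / (INR n.+1 * INR n.+1).
  move=> hw; have hw0 : 0 < Re w by have := zm_pos n; rewrite Re_scal; lra.
  apply: Rle_trans (Cmod_inv_exp_sub1 1 hw0) _.
  rewrite (_ : 2 / Re z ^ 2 / (INR n.+1 * INR n.+1) = 2 / (INR n.+1 * Re z) ^ 2); last first.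
    by field; split; lra.
  rewrite (_ : INR (fact 2) = 2) //; apply: Rmult_le_compat_l; first lra.
  have h0 : 0 < INR n.+1 * Re z by apply: Rmult_lt_0_compat.
  by apply: Rinv_le_contravar; [apply: pow_lt | apply: pow_incr; lra].
have b1 := gen (n.+1%:C * z)%C; have b2 := gen (k%:C * (n.+1%:C * z))%C.
rewrite !Re_scal in b1 b2; have hz := zm_pos n; rewrite Re_scal in hz.
have {}b1 := b1 (Rle_refl _); have {}b2 := b2 ltac:(nra).
have hd : 0 < 4 / Re z ^ 2 / (INR n.+1 * INR n.+1) by apply: Rdiv_lt_0_compat; [apply: Rdiv_lt_0_compat; lra| nra].
have b3 : Cmod (phi k (INR n.+1 * z)) <= 4 / Re z ^ 2 / (INR n.+1 * INR n.+1).
  by apply: Rle_trans (Cmod_triangle _ _) _; rewrite Cmod_opp; lra.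
apply/Rle_div_l => //; apply: Rle_trans b3 _.
rewrite -[X in X <= _]Rmult_1_r; apply: Rmult_le_compat_l; [exact: Rlt_le | lra].
Qed.

Lemma phi_cv : exists l, Clim (phi_sum z) l.
Proof.
have ex : ex_series (fun n => 4 / Re z ^ 2 * inv_sq n).
  exact: (ex_series_scal (4 / Re z ^ 2) _ ex_series_inv_sq).
apply: csum_abs_cv; apply: ex_series_dom ex => n; split; first exact: Cmod_ge_0.
exact: phi_term_bound.
Qed.

(** The first sum in [tau_sum] runs to kP, the sum of phi only to P; the surplus P < m <= kP is
    subtracted. *)
Lemma phi_sum_split P : phi_sum z P =
  (RtoC (1 - / INR k) / z * RtoC (rsum inv_sq P) + tau_sum k z P
   - csum (fun i => tau ((P + i).+1%:C * z) / (P + i).+1%:C)%C (k.-1 * P))%C.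
Proof.
rewrite /tau_sum (_ : (k * P)%N = (P + k.-1 * P)%N); last by nia.
rewrite csum_add -csum_RtoC -csum_scal.
rewrite (_ : forall a b c d : C, (a + (b + c - d) - c = a + (b - d))%C); last by move=> *; ring.
rewrite -csum_minus -csum_plus; apply: csum_ext => m _; rewrite /inv_sq.
have hm := @CINR_neq0 m; have hn := INR_S_pos m.
rewrite phi_tau // RtoC_inv; last nra.
rewrite (RtoC_mult (INR m.+1)) (_ : (INR k * (INR m.+1 * z))%C = (INR m.+1 * (INR k * z))%C); last ring.
by field.
Qed.

(** There tau differs from 1/2 by O(1 / m), so about kP terms of size O(1 / P^2) are left. *)
Lemma tau_tail_lim : Clim (fun P => csum (fun i => tau ((P + i).+1%:C * z) / (P + i).+1%:C)%C (k.-1 * P)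
   - RtoC (harm P))%C 0.
Proof.
apply: (@Clim_squeeze _ _ (fun P => 2 * INR k / Re z * / INR P.+1)); last first.
  by apply: lim0_scal; apply: lim_inv_S.
exists 0%N => P _; have hP := INR_S_pos P.
rewrite /harm -csum_RtoC -csum_minus (_ : forall a : C, (a - 0)%C = a); last by move=> a; ring.
apply: Rle_trans (Cmod_csum _ _) _.
apply: Rle_trans (_ : rsum (fun _ => 2 / Re z * / (INR P.+1 * INR P.+1)) (k.-1 * P) <= _); last first.
  rewrite rsum_const.
  have h : INR (k.-1 * P) <= INR k * INR P.+1 by rewrite -mult_INR; apply: le_INR; nia.
  apply: Rle_trans (Rmult_le_compat_r _ _ _ _ h) _; last by right; field; lra.
  apply: Rmult_le_pos; first by apply: Rdiv_le_0_compat; lra.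
  by apply/Rlt_le/Rinv_0_lt_compat; nra.
apply: rsum_le => i _; have hm := INR_S_pos (P + i); have cm := @CINR_neq0 (P + i).
have hPm : INR P.+1 <= INR (P + i).+1 by apply: le_INR; lia.
set M := INR (P + i).+1 in hm cm hPm *.
have mz : 0 < Re (RtoC M * z) by apply: zm_pos.
have w1 := Cexp_sub1_neq0 mz.
rewrite (_ : (tau (M * z) / M - RtoC (/ M / 2))%C = ((1 / (Cexp (M * z) - 1) - 1 / (M * z)) / M)%C); last first.
  rewrite RtoC_div ?RtoC_inv /tau; try lra.
  by field; do ?split=> //; apply: C2_neq0.
rewrite Cmod_div // Cmod_R (Rabs_pos_eq M); last lra.
have b1 := Cmod_inv_exp_sub1 0 mz; rewrite Re_scal pow_1 (_ : INR (fact 1) = 1) // in b1.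
have b2 : Cmod (1 / (M * z)) <= 1 / (M * Re z).
  rewrite Cmod_div ?Cmod_1; last exact: Cmult_neq_0.
  apply: Rmult_le_compat_l; first lra.
  rewrite Cmod_mult Cmod_R (Rabs_pos_eq M); last lra.
  apply: Rinv_le_contravar; first exact: Rmult_lt_0_compat.
  apply: Rmult_le_compat_l; first lra.
  exact: Rle_trans (Rle_abs _) (re_le_Cmod z).
apply: Rle_trans (_ : 2 / Re z * / (M * M) <= _).
  apply/Rle_div_l => //; apply: Rle_trans (Cmod_triangle _ _) _; rewrite Cmod_opp.
  rewrite (_ : _ * M = 2 * (1 / (M * Re z))); [lra | by field; lra].
apply: Rmult_le_compat_l; first by apply: Rdiv_le_0_compat; lra.
by apply: Rinv_le_contravar; nra.
Qed.

Lemma harm_lim Sz : Clim (phi_sum z) Sz -> exists l, Clim (fun P => RtoC (harm P)) (RtoC (1 - / INR k) / z * RtoC zeta2 + l - Sz)%C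
  /\ forall K, Cmod (l - RtoC lin_coef * z) <=
  2 * INR (fact K.+1) * INR k ^ K.+1 * zeta2 * D ^ K.+1.
Proof.
move=> HS; have [l [Hl Hb]] := dual_sum; exists l; split=> //.
have H := Clim_minus (Clim_minus (Clim_plus (Clim_mult (Clim_const (RtoC (1 - / INR k) / z)) (Clim_RtoC zeta2_lim)) Hl) HS) tau_tail_lim.
rewrite (_ : forall a : C, a - 0 = a)%C in H; last by move=> a; ring.
by apply: Clim_ext H => P; rewrite phi_sum_split; ring.
Qed.
End FixedPoint.

(** By [harm_lim] the limit of [harm], which is free of z, has an expression in z; equating it with
    the expression at z = 1 isolates the constant, real because [harm] is. *)
Lemma near_arc : exists c0 : R, forall (z Sz : C), 0 < Re z -> Clim (phi_sum z) Sz ->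
  forall K, Cmod (Sz - (RtoC ((1 - / INR k) * zeta2) / z + RtoC c0 + RtoC lin_coef * z)) <=
  2 * INR (fact K.+1) * INR k ^ K.+1 * zeta2 * (Cmod z ^ 2 / Re z) ^ K.+1.
Proof.
have p1 : 0 < Re 1 by rewrite /=; lra.
have [S1 H1] := phi_cv p1; have [l1 [h1 _]] := harm_lim p1 H1.
set L := (_ - S1)%C in h1; exists (- Re L) => z Sz z_pos HS K.
have [l [h /(_ K) hb]] := harm_lim z_pos HS.
have e := Clim_uniq h h1.
have eL : L = RtoC (Re L).
  exact: (Clim_uniq h1 (Clim_RtoC (Clim_Re h1))).
rewrite (_ : (Sz - _)%C = (l - RtoC lin_coef * z)%C) // RtoC_opp -eL -e RtoC_mult.
by have := Re_pos_neq0 z_pos => z0; field.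
Qed.
End NearArcExpansion.

(** * The generating function on the whole circle *)

Lemma Cexp_neg_lt1 (z : C) : 0 < Re z -> Cmod (Cexp (- z)) < 1.
Proof. by move=> h; rewrite Cmod_Cexp -exp_0; apply: exp_increasing; rewrite Re_opp; lra. Qed.

Lemma one_minus_neq0 (q : C) : Cmod q < 1 -> (1 - q)%C <> 0.
Proof. by move=> h /Cminus_eq0 e; move: h; rewrite -e Cmod_1; lra. Qed.

Lemma pow_lt1 r n : 0 <= r < 1 -> (0 < n)%N -> r ^ n < 1.
Proof.
move=> hr; case: n => [//|n] _ /=.
have : 0 <= r ^ n <= 1 by split; [apply: pow_le; lra | rewrite -(pow1 n); apply: pow_incr; lra].
nra.
Qed.

Lemma Cmod_pow_lt1 (q : C) n : Cmod q < 1 -> (0 < n)%N -> Cmod (q ^ n) < 1.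
Proof. by move=> h hn; rewrite Cmod_pow; apply: pow_lt1 => //; split=> //; apply: Cmod_ge_0. Qed.

Lemma inv_exp_sub1 (w : C) : 0 < Re w -> (1 / (Cexp w - 1) = Cexp (- w) / (1 - Cexp (- w)))%C.
Proof.
move=> hw; have h0 := Cexp_sub1_neq0 hw; have h1 := @Cexp_neq0 w.
rewrite Cexp_opp; field; split=> //; split => //.
Qed.

Lemma phi_geom k (w : C) : (0 < k)%N -> 0 < Re w ->
  phi k w = (csum (fun i => Cexp (- w) ^ i.+1) k.-1 / (1 - Cexp (- w) ^ k))%C.
Proof.
move=> k0 hw; have kR : 0 < INR k by apply: lt_0_INR; lia.
have hkw : 0 < Re (k%:C * w) by rewrite Re_scal; apply: Rmult_lt_0_compat.
rewrite /phi !inv_exp_sub1 //.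
have -> : Cexp (- (INR k * w)) = (Cexp (- w) ^ k)%C.
  by rewrite -Cexp_INR; congr Cexp; ring.
have hq := Cexp_neg_lt1 hw; set q := Cexp (- w) in hq *.
have h1 := one_minus_neq0 hq; have h2 := one_minus_neq0 (Cmod_pow_lt1 hq k0).
have g : csum (fun i => q ^ i.+1)%C k.-1 = ((q - q ^ k) / (1 - q))%C.
  rewrite (csum_ext (g := fun i => (q * q ^ i)%C)) // csum_scal.
  set S := csum _ k.-1; have e : (S * (q - 1) = q ^ k.-1 - 1)%C := geom_csum q k.-1.
  rewrite (_ : (q ^ k = q * q ^ k.-1)%C); last by rewrite -{1}(prednK k0).
  rewrite (_ : (q - q * q ^ k.-1 = - (q * (q ^ k.-1 - 1)))%C); last ring.
  by rewrite -e; field.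
by rewrite g; field.
Qed.

(** By [phi_geom], phi is a power series in e^(-w) with nonnegative coefficients. *)
Lemma Cmod_phi_le k (w : C) : (0 < k)%N -> 0 < Re w ->
  Cmod (phi k w) <= Re (phi k (RtoC (Re w))).
Proof.
move=> k0 hw; rewrite !phi_geom //; set q := Cexp (- w).
have e : Cexp (- RtoC (Re w)) = RtoC (Cmod q).
  by rewrite -RtoC_opp Cexp_RtoC Cmod_Cexp Re_opp.
have hq : Cmod q < 1 by apply: Cexp_neg_lt1.
have h1 := Cmod_pow_lt1 hq k0; rewrite Cmod_pow in h1.
have h2 := one_minus_neq0 (Cmod_pow_lt1 hq k0).
rewrite e -RtoC_pow -RtoC_minus.
rewrite (csum_ext (f := fun i => (RtoC (Cmod q) ^ i.+1)%C) (g := fun i => RtoC (Cmod q ^ i.+1))); last by move=> i _; rewrite RtoC_pow.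
rewrite csum_RtoC -RtoC_div; last lra.
rewrite Cmod_div // [Re _]/=; apply: Rmult_le_compat.
- exact: Cmod_ge_0.
- by apply/Rlt_le/Rinv_0_lt_compat/Cmod_gt_0.
- by apply: Rle_trans (Cmod_csum _ _) _; apply: rsum_le => i _; rewrite Cmod_pow; apply: Rle_refl.
- apply: Rinv_le_contravar; first lra.
  by have := Cmod_triang_inv 1 (q ^ k); rewrite Cmod_1 Cmod_pow.
Qed.

Lemma phi_real k x : (0 < k)%N -> 0 < x -> phi k (RtoC x) = RtoC (Re (phi k (RtoC x))).
Proof.
move=> k0 x0; rewrite phi_geom // -RtoC_opp Cexp_RtoC -RtoC_pow -RtoC_minus.
rewrite (csum_ext (g := fun i => RtoC (exp (- x) ^ i.+1))); last by move=> i _; rewrite RtoC_pow.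
rewrite csum_RtoC -RtoC_div //.
suff : exp (- x) ^ k < 1 by lra.
have := exp_pos (- x); have : exp (- x) < 1 by rewrite -exp_0; apply: exp_increasing; lra.
by move=> *; apply: pow_lt1 => //; lra.
Qed.

Lemma exp_neg_small K b x : 0 < b -> 0 < x ->
  exp (- (b / x)) <= INR (fact K.+1) / b ^ K.+1 * x ^ K.+1.
Proof.
move=> b0 x0; have hX : 0 < b / x by apply: Rdiv_lt_0_compat.
have h := exp_sub1_ge K hX; have hf := INR_fact_lt_0 K.+1.
have h1 : 0 < (b / x) ^ K.+1 / INR (fact K.+1) by apply: Rdiv_lt_0_compat => //; apply: pow_lt.
rewrite exp_Ropp; apply: Rle_trans (Rinv_le_contravar _ _ h1 _) _; first lra.
have hb : 0 < b ^ K.+1 by apply: pow_lt.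
have hx : 0 < x ^ K.+1 by apply: pow_lt.
right; rewrite /Rdiv Rpow_mult_distr pow_inv; field.
by do ?split; apply: Rgt_not_eq.
Qed.

Lemma csum_pow_le (d : nat -> C) K u : Cmod u <= 2 ->
  Cmod (csum (fun i => d i * u ^ i)%C K) <= rsum (fun i => Cmod (d i) * 2 ^ i) K.
Proof.
move=> hu; apply: Rle_trans (Cmod_csum _ _) _; apply: rsum_le => i _.
rewrite Cmod_mult Cmod_pow; apply: Rmult_le_compat_l; first exact: Cmod_ge_0.
by apply: pow_incr; split=> //; apply: Cmod_ge_0.
Qed.

(* Outside the sector |uvar z| >= |Im z| / 6 > 8 Re z, which makes
   A / |uvar z| smaller than A / (8 Re z). *)
Definition sector_near0 (P : C -> Prop) := exists x0, 0 < x0 /\ forall z, 0 < Re z < x0 -> Rabs (Im z) <= 48 * Re z -> P z.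

#[global] Instance sector_filter : Filter sector_near0.
Proof.
split.
- by exists 1; split; [lra|].
- move=> P Q [x [x0 Hx]] [y [y0 Hy]]; exists (Rmin x y); split; first exact: Rmin_pos.
  move=> z [h1 h2] h3; split; [apply: Hx | apply: Hy] => //; split=> //.
    by apply: Rlt_le_trans h2 (Rmin_l _ _).
  by apply: Rlt_le_trans h2 (Rmin_r _ _).
- by move=> P Q PQ [x [x0 Hx]]; exists x; split=> // z h1 h2; apply: PQ; apply: Hx.
Qed.

(** * Comparison inside and outside the sector *)

Section Arcs.
Variables (k : nat) (c : nat -> R) (T : C -> C) (A c0 s : R).
Hypothesis k2 : (1 < k)%N.
Hypothesis c_ge0 : forall m, 0 <= c m.
Hypothesis c1 : 1 <= c 0%N.
Hypothesis T_lim : forall z, 0 < Re z ->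
  Clim (csum (fun m => RtoC (c m) * (phi k (m.+1%:C * z) / m.+1%:C))%C) (T z).
Hypothesis A_pos : 0 < A.
Hypothesis T_near : forall K, exists C0, forall z, 0 < Re z ->
  Cmod (T z - (RtoC A / z + RtoC c0 + RtoC s * z)) <= C0 * (Cmod z ^ 2 / Re z) ^ K.+1.

Let k0 : (0 < k)%N. Proof. exact: ltnW. Qed.

Definition uvar (z : C) : C := (1 - Cexp (- z))%C.

Lemma uvar_le2 z : 0 < Re z -> Cmod (uvar z) <= 2.
Proof.
move=> h; have := Cmod_triangle 1 (- Cexp (- z)); rewrite Cmod_opp Cmod_1.
by have := Cexp_neg_lt1 h; rewrite /uvar /Cminus; lra.
Qed.

Let u_neq0 z : 0 < Re z -> uvar z <> 0.
Proof. by move=> h; apply: one_minus_neq0; apply: Cexp_neg_lt1. Qed.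

Let T_real x : 0 < x -> T (RtoC x) = RtoC (Re (T (RtoC x))).
Proof.
move=> x0; have H := @T_lim (RtoC x) x0.
apply: (Clim_uniq H); apply: Clim_ext (Clim_RtoC (Clim_Re H)) => n.
rewrite Re_csum -csum_RtoC; apply: csum_ext => m _.
rewrite -RtoC_mult (phi_real k0); last by apply: Rmult_lt_0_compat => //; apply: INR_S_pos.
have hm : INR m.+1 <> 0 by have := INR_S_pos m; lra.
by rewrite -RtoC_div // -RtoC_mult.
Qed.

(** Each term has real part at most its value at Re z; the gain is kept for the first term alone,
    whose weight is at least 1. *)
Lemma T_away z : 0 < Re z -> Re (T z) <= Re (T (RtoC (Re z))) - (Re (phi k (RtoC (Re z))) - Re (phi k z)).
Proof.
move=> hz.
have H1 := Clim_Re (T_lim hz); have H2 := Clim_Re (@T_lim (RtoC (Re z)) hz).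
have H3 := is_lim_seq_minus' _ _ _ _ H2 (is_lim_seq_const (Re (phi k (RtoC (Re z))) - Re (phi k z))).
apply: (is_lim_seq_le_loc _ _ (Re (T z)) (_ - _) _ H1 H3).
exists 1%N => n /leP hn; rewrite !Re_csum.
have term w m : Re (RtoC (c m) * (phi k (m.+1%:C * w) / m.+1%:C))%C = c m / INR m.+1 * Re (phi k (m.+1%:C * w)).
  have hm := INR_S_pos m; rewrite -Re_scal; congr Re.
  by rewrite RtoC_div; [field; apply: CINR_neq0 | lra].
have le m : Re (phi k (m.+1%:C * z)) <= Re (phi k (m.+1%:C * RtoC (Re z))).
  apply: Rle_trans (Rle_trans _ _ _ (Rle_abs _) (re_le_Cmod _)) _.
  rewrite -RtoC_mult -Re_scal; apply: Cmod_phi_le => //; rewrite Re_scal.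
  by apply: Rmult_lt_0_compat => //; apply: INR_S_pos.
rewrite !(rsum_ext (fun m _ => term _ m)) -(subnKC hn) !rsum_add !rsumS !rsum0.
have : rsum (fun m => c (1 + m)%N / INR (1 + m).+1 * Re (phi k ((1 + m).+1%:C * z))) (n - 1) <=
       rsum (fun m => c (1 + m)%N / INR (1 + m).+1 * Re (phi k ((1 + m).+1%:C * RtoC (Re z)))) (n - 1).
  apply: rsum_le => m _; apply: Rmult_le_compat_l => //.
  by apply: Rdiv_le_0_compat => //; apply: INR_S_pos.
have := le 0%N; rewrite (_ : INR 1 = 1) // !Cmult_1_l Rdiv_1_r.
move: (Re (phi k z)) (Re (phi k (RtoC (Re z)))) => a b hab; have : 0 <= (c 0%N - 1) * (b - a) by apply: Rmult_le_pos; lra.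
lra.
Qed.

(** The map v -> 1 / (v - 1) sends |v| >= 1 into the half-plane Re >= - 1/2, which bounds the
    subtracted term; the other one is at most 1 / |1 - q| in modulus. *)
Lemma Re_phi_le z : 0 < Re z -> Re (phi k z) <= / Cmod (uvar z) + 1 / 2.
Proof.
move=> hz; have kR : 0 < INR k by apply: lt_0_INR; lia.
have hkz : 0 < Re (k%:C * z) by rewrite Re_scal; apply: Rmult_lt_0_compat.
rewrite /phi Re_minus.
have h1 : Re (1 / (Cexp z - 1)) <= / Cmod (uvar z).
  rewrite inv_exp_sub1 //; apply: Rle_trans (Rle_trans _ _ _ (Rle_abs _) (re_le_Cmod _)) _.
  rewrite Cmod_div; last exact: u_neq0.
  rewrite -[X in _ <= X]Rmult_1_l; apply: Rmult_le_compat_r.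
    by apply/Rlt_le/Rinv_0_lt_compat/Cmod_gt_0/u_neq0.
  exact/Rlt_le/Cexp_neg_lt1.
have h2 : - (1 / 2) <= Re (1 / (Cexp (k%:C * z) - 1)).
  have v0 := Cexp_sub1_neq0 hkz; set v := Cexp _ in v0 *.
  have hv : 1 <= Cmod v ^ 2.
    rewrite -(pow1 2); apply: pow_incr; split; first lra.
    by rewrite Cmod_Cexp -exp_0; apply: exp_le_compat; lra.
  rewrite (_ : (1 / (v - 1))%C = (/ (v - 1))%C); last by field.
  rewrite Re_inv //; have hp : 0 < Cmod (v - 1) ^ 2 by apply: pow_lt; apply/Cmod_gt_0.
  apply/Rle_div_r => //; move: hv; rewrite !Cmod2_alt !ReIm (_ : Re 1 = 1) // (_ : Im 1 = 0) //.
  by move: (Re v) (Im v) => a b; nra.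
lra.
Qed.

(** From 1 / (e^x - 1) >= 1 / x - 1 at most 1 / (k x) <= 1 / (2 x) is subtracted; here k >= 2
    enters. *)
Lemma phi_real_ge x : 0 < x < 1 -> / (2 * x) - 1 <= Re (phi k (RtoC x)).
Proof.
move=> hx; have kR : 2 <= INR k by apply: (le_INR 2); lia.
have ex1 : 0 < exp x - 1 by have := exp_ineq1 x ltac:(lra); lra.
have ekx1 : INR k * x <= exp (INR k * x) - 1 by have := exp_ineq1 (INR k * x) ltac:(nra); lra.
rewrite /phi -RtoC_mult !Cexp_RtoC -!RtoC_minus -!RtoC_div; try nra.
rewrite -RtoC_minus [Re _]/=.
have h1 : / x - 1 <= 1 / (exp x - 1).
  have h := exp_ineq1 (- x) ltac:(lra); rewrite exp_Ropp in h.
  have ep := exp_pos x.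
  have h' : (1 - x) * exp x <= 1.
    have : (1 - x) * exp x <= / exp x * exp x by apply: Rmult_le_compat_r; lra.
    by rewrite Rinv_l; lra.
  apply/Rle_div_r => //; rewrite (_ : (/ x - 1) * (exp x - 1) = ((1 - x) * exp x - (1 - x)) / x); last by field; lra.
  by apply/Rle_div_l; lra.
have h2 : 1 / (exp (INR k * x) - 1) <= / (2 * x).
  by rewrite /Rdiv Rmult_1_l; apply: Rinv_le_contravar; nra.
rewrite (_ : / (2 * x) = / x / 2) in h2 *; last by field; lra.
lra.
Qed.

(** The chord |e^(-iy) - 1| >= |y| / 3 is at most |u| + (1 - e^(-x)), and 1 - e^(-x) <= |u|. *)
Lemma u_ge x y : 0 < x -> Rabs y <= PI -> Rabs y / 6 <= Cmod (uvar (x, y)).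
Proof.
move=> x0 hy.
have e : Cexp (- (x, y)) = (RtoC (exp (- x)) * cis (- y))%C.
  by rewrite cis_exp -Cexp_RtoC -Cexp_plus; congr Cexp; apply: C_ext => /=; ring.
have h := @Cmod_cis_sub1 (- y); rewrite Rabs_Ropp in h; have {}h := h hy.
have r1 : exp (- x) < 1 by rewrite -exp_0; apply: exp_increasing; lra.
have r0 := exp_pos (- x); set r := exp (- x) in e r1 r0.
have h1 : 1 - r <= Cmod (uvar (x, y)).
  rewrite /uvar e; have := Cmod_triang_inv 1 (RtoC r * cis (- y)).
  by rewrite Cmod_1 Cmod_mult Cmod_cis Cmod_R Rabs_pos_eq; lra.
have h2 : Cmod (cis (- y) - 1) <= Cmod (uvar (x, y)) + (1 - r).
  rewrite (_ : (cis (- y) - 1)%C = (- (uvar (x, y)) + RtoC (1 - r) * cis (- y))%C).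
    apply: Rle_trans (Cmod_triangle _ _) _.
    by rewrite Cmod_opp Cmod_mult Cmod_cis Cmod_R Rabs_pos_eq; lra.
  by rewrite /uvar e RtoC_minus; ring.
lra.
Qed.

Lemma u_ge_x x y : 0 < x -> / Cmod (uvar (x, y)) <= / x + 1.
Proof.
move=> x0; have r0 := exp_pos (- x).
have h1 : 1 - exp (- x) <= Cmod (uvar (x, y)).
  have := Cmod_triang_inv 1 (Cexp (- (x, y))).
  by rewrite Cmod_1 Cmod_Cexp Re_opp /uvar.
have h2 : x / (1 + x) <= 1 - exp (- x).
  have h := exp_ineq1 x ltac:(lra); rewrite exp_Ropp.
  have : / exp x <= / (1 + x) by apply: Rinv_le_contravar; lra.
  by rewrite (_ : x / (1 + x) = 1 - / (1 + x)); [lra | field; lra].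
have h3 : 0 < x / (1 + x) by apply: Rdiv_lt_0_compat; lra.
rewrite (_ : / x + 1 = / (x / (1 + x))); last by field; lra.
by apply: Rinv_le_contravar; lra.
Qed.

Notation F := sector_near0.
Notation FF := sector_filter.

Let sector z : 0 < Re z -> Rabs (Im z) <= 48 * Re z -> Cmod z <= 49 * Re z.
Proof.
move=> h1 h2; apply: Rle_trans (Cmod_le_ReIm z) _.
by rewrite (Rabs_pos_eq (Re z)); lra.
Qed.

Let z_small eps : 0 < eps -> F (fun z => Cmod z < eps).
Proof.
move=> h; exists (eps / 49); split; first lra.
by move=> z h1 h2; have := sector (proj1 h1) h2; lra.
Qed.

Let z_pos : F (fun z => 0 < Re z).
Proof. by exists 1; split; [lra | move=> z []]. Qed.

Let u_lip z : Cmod z <= 1 -> Cmod (uvar z) <= 6 * Cmod z.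
Proof.
by rewrite -(Cmod_opp z) => /Cexp_lip; rewrite /uvar Cmod_minus_sym Cmod_opp.
Qed.

Let u_small eps : 0 < eps -> F (fun z => Cmod (uvar z) < eps).
Proof.
move=> h; have h1 : 0 < Rmin 1 (eps / 6) by apply: Rmin_pos; lra.
apply: filter_imp (z_small h1) => z h2.
have h3 := Rmin_l 1 (eps / 6); have h4 := Rmin_r 1 (eps / 6).
by have := @u_lip z; lra.
Qed.

Let u_nz : F (fun z => uvar z <> 0).
Proof. by apply: filter_imp z_pos => z; apply: u_neq0. Qed.

Let Xrem i J : expands F id J (fun z => exp_rem i (- z)).
Proof.
apply: (expands_ext' FF (f := fun z => exp_rem i (z * - (1))%C)) => [z|].
  by congr exp_rem; ring.
exact: (expands_exp_rem FF z_small i (expands_const FF id J (- (1))%C)).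
Qed.

Let u_rem z : (uvar z = z * exp_rem 1 (- z))%C.
Proof.
rewrite /uvar -exp_rem0 exp_rem_step (_ : INR (fact 0) = 1) //; field.
Qed.

Let X_zu J : expands F id J (fun z => z / uvar z)%C.
Proof.
have H : F (fun z => 1 / 2 <= Cmod (exp_rem 1 (- z))).
  have h : 0 < 1 / 26 by lra.
  apply: filter_imp (z_small h) => z hz.
  rewrite exp_rem_step (_ : INR (fact 1) = 1) //.
  have := Cmod_triang_inv (1 / 1) (- (- z * exp_rem 2 (- z))).
  rewrite Cmod_opp Cmod_mult Cmod_opp (_ : (1 / 1 - - (- z * exp_rem 2 (- z)))%C = (1 / 1 + - z * exp_rem 2 (- z))%C); last ring.
  rewrite (_ : (1 / 1)%C = 1) ?Cmod_1; last by field; apply: C1_nz.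
  have := exp_rem_bound 2 (- z); rewrite Cmod_opp.
  have : exp (Cmod z) <= 3 by apply: Rle_trans exp_le_3; apply: exp_le_compat; lra.
  have := Cmod_ge_0 z; have := Cmod_ge_0 (exp_rem 2 (- z)).
  move: (Cmod z) (Cmod (exp_rem 2 (- z))) (exp (Cmod z)) hz => a b e ha hb h0 he h2.
  have : a * b <= 1 / 26 * 13 by apply: Rmult_le_compat; lra.
  lra.
have h2 : 0 < 1 / 2 by lra.
apply: (expands_ext FF _ (expands_inv FF z_small h2 H (Xrem 1 J))).
apply: filter_imp z_pos => z hz; have hu := u_neq0 hz; have z0 := Re_pos_neq0 hz.
have h3 : exp_rem 1 (- z) <> 0 by move=> h3; apply: hu; rewrite u_rem h3; ring.
by rewrite u_rem; field.
Qed.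

(** Replacing A / z by A / u changes the exponent by A (u - z) / (u z), which is regular since u - z
    = O(z^2). *)
Let X_log J : expands F id J (fun z => T z - RtoC A / uvar z)%C.
Proof.
suff Hgen J' : expands F id J'.+1 (fun z => T z - RtoC A / uvar z)%C.
  by case: J => [|J]; [apply: (expands_weak FF z_small) (Hgen 0%N) | apply: Hgen].
have [C0 HC0] := T_near J'.
have Xt : expands F id J'.+1 (fun z => T z - (RtoC A / z + RtoC c0 + RtoC s * z))%C.
  apply: (expands_small (M := Rabs C0 * 49 ^ J'.+1) FF).
    by apply: filter_imp z_pos => z; apply: Re_pos_neq0.
  exists 1; split; first lra.
  move=> z [h1 _] h2; apply: Rle_trans (HC0 z h1) _.
  have hz := sector h1 h2; have hz0 := Cmod_ge_0 z.
  have h0 : 0 <= Cmod z ^ 2 / Re z by apply: Rdiv_le_0_compat => //; apply: pow_le.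
  apply: Rle_trans (_ : Rabs C0 * (Cmod z ^ 2 / Re z) ^ J'.+1 <= _).
    by apply: Rmult_le_compat_r (Rle_abs _); apply: pow_le.
  rewrite Rmult_assoc -Rpow_mult_distr; apply: Rmult_le_compat_l; first exact: Rabs_pos.
  apply: pow_incr; split=> //; apply/Rle_div_l => //=.
  by rewrite Rmult_1_r; nra.
have Xm : expands F id J'.+1 (fun z => RtoC A * (- (exp_rem 2 (- z) * (z / uvar z))) + RtoC c0 + RtoC s * z)%C.
  apply: (expands_plus FF); last by apply: (expands_scal FF); apply: (expands_v FF z_small).
  apply: (expands_plus FF) (expands_const FF _ _ _).
  by apply: (expands_scal FF); apply: (expands_opp FF); apply: (expands_mult FF z_small).
apply: (expands_ext FF _ (expands_plus FF Xt Xm)).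
apply: filter_imp z_pos => z hz; have hu := u_neq0 hz; have z0 := Re_pos_neq0 hz.
have e : (uvar z - z = - (z * z) * exp_rem 2 (- z))%C.
  rewrite u_rem exp_rem_step (_ : INR (fact 1) = 1) //; field; exact: C1_nz.
have -> : exp_rem 2 (- z) = (- (uvar z - z) / (z * z))%C by rewrite e; field.
by field.
Qed.

Lemma near_poly K : exists (d : nat -> C) (C0 x0 : R), 0 < x0 /\
  forall z, 0 < Re z < x0 -> Rabs (Im z) <= 48 * Re z ->
  Cmod (Cexp (T z - RtoC A / uvar z) - csum (fun i => d i * uvar z ^ i)%C K) <= C0 * Cmod (uvar z) ^ K.
Proof.
have X1 := expands_exp FF z_small (X_log K).
have X2 := expands_base_change FF u_small u_nz X_zu X1.
by have [d [C0 [x0 [h1 h2]]]] := expands_poly FF X2; exists d, C0, x0; split.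
Qed.

Let T_real_bound : exists B, 0 <= B /\ forall x, 0 < x <= 1 ->
  Cmod (T (RtoC x) - RtoC A / RtoC x) <= B.
Proof.
have [C0 HC0] := T_near 0.
exists (Rabs c0 + Rabs s + Rabs C0); split=> [|x [x0 x1]].
  by have := Rabs_pos c0; have := Rabs_pos s; have := Rabs_pos C0; lra.
have h := HC0 (RtoC x) x0; rewrite Cmod_R (_ : Re (RtoC x) = x) // Rabs_pos_eq in h; last lra.
rewrite (_ : (x ^ 2 / x) ^ 1 = x) in h; last by field; lra.
rewrite (_ : (T x - A / x)%C = ((T x - (RtoC A / RtoC x + RtoC c0 + RtoC s * RtoC x)) + (RtoC c0 + RtoC s * RtoC x))%C); last ring.
apply: Rle_trans (Cmod_triangle _ _) _.
have h2 := Cmod_triangle (RtoC c0) (RtoC s * RtoC x).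
rewrite Cmod_mult !Cmod_R (Rabs_pos_eq x) in h2; last lra.
have := Rle_abs C0; have := Rabs_pos C0; have := Rabs_pos s; nra.
Qed.

(** The d_i come from an existence statement, so the sign is read off on the positive axis: there
    exp (T - A / u) is real and at least e^(-(A + B)), and it differs from Re d_0 by O(x). *)
Let lead_coef_pos K d C0 x0 : (0 < K)%N -> 0 < x0 ->
  (forall z, 0 < Re z < x0 -> Rabs (Im z) <= 48 * Re z ->
  Cmod (Cexp (T z - RtoC A / uvar z) - csum (fun i => d i * uvar z ^ i)%C K) <= C0 * Cmod (uvar z) ^ K) ->
  0 < Re (d 0%N).
Proof.
move=> K0 x0p H; have [B [B0 HB]] := T_real_bound.
set D := rsum (fun i => Cmod (d i.+1) * 2 ^ i) K.-1.
have D0 : 0 <= D by apply: rsum_ge0 => i; apply: Rmult_le_pos (Cmod_ge_0 _) (pow_le _ _ _); lra.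
set E := 6 * (Rabs C0 + D) + 1.
have E0 : 0 < E by rewrite /E; have := Rabs_pos C0; lra.
have e0 := exp_pos (- (A + B)).
(* This x lies in the range of validity, makes |u| <= 6 x <= 1, and keeps the error 6 x (|C0| + D)
   below half of e^(-(A + B)). *)
set x := Rmin (Rmin (x0 / 2) (1 / 6)) (exp (- (A + B)) / (2 * E)).
have xp : 0 < x.
  apply: Rmin_pos; first by apply: Rmin_pos; lra.
  by apply: Rdiv_lt_0_compat; lra.
have x1 : x <= 1 / 6 by apply: Rle_trans (Rmin_l _ _) (Rmin_r _ _).
have x2 : x <= x0 / 2 by apply: Rle_trans (Rmin_l _ _) (Rmin_l _ _).
have x3 : x * (2 * E) <= exp (- (A + B)).
  by apply/Rle_div_r; [lra | apply: Rmin_r].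
have := H (RtoC x); rewrite (_ : Re (RtoC x) = x) // (_ : Im (RtoC x) = 0) // Rabs_R0.
move=> /(_ ltac:(lra) ltac:(lra)).
have hu := @u_lip (RtoC x); rewrite Cmod_R Rabs_pos_eq in hu; last lra.
have {}hu := hu ltac:(lra).
have ur : uvar (RtoC x) = RtoC (1 - exp (- x)) by rewrite /uvar -RtoC_opp Cexp_RtoC RtoC_minus.
have r1 : exp (- x) < 1 by rewrite -exp_0; apply: exp_increasing; lra.
have hu1 : / (1 - exp (- x)) <= / x + 1.
  have := u_ge_x 0 xp; rewrite -[(x, 0)]/(RtoC x) ur Cmod_R Rabs_pos_eq; lra.
have wr : (T x - RtoC A / uvar x)%C = RtoC (Re (T x) - A / (1 - exp (- x))).
  by rewrite ur {1}T_real // -RtoC_div -?RtoC_minus //; lra.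
have hr : - (A + B) <= Re (T x) - A / (1 - exp (- x)).
  have := HB x ltac:(lra); rewrite {1}T_real // -RtoC_div; last lra.
  rewrite -RtoC_minus Cmod_R => /Rabs_le_between [h _].
  rewrite /Rdiv in h *; nra.
rewrite wr Cexp_RtoC; have hexp := exp_le_compat hr.
set r := exp (Re _ - _) in hexp *; set u := uvar x in hu *.
rewrite -(prednK K0) csum_recl (prednK K0).
rewrite (_ : (d 0%N * u ^ 0)%C = d 0%N); last by rewrite /=; ring.
rewrite (csum_ext (f := fun i => (d i.+1 * u ^ i.+1)%C) (g := fun i => (u * (d i.+1 * u ^ i))%C)); last first.
  by move=> i _; rewrite Cpow_S; ring.
rewrite csum_scal; have := @csum_pow_le (fun i => d i.+1) K.-1 u.
set S := csum _ _ => /(_ ltac:(lra)) hS h.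
have h2 := Rle_trans _ _ _ (re_le_Cmod _) h.
have hu0 := Cmod_ge_0 u.
have hK : Cmod u ^ K <= Cmod u.
  rewrite -(prednK K0) /=; rewrite -[X in _ <= X]Rmult_1_r; apply: Rmult_le_compat_l => //.
  by rewrite -(pow1 K.-1); apply: pow_incr; lra.
have h3 : C0 * Cmod u ^ K <= Rabs C0 * Cmod u.
  apply: Rle_trans (_ : Rabs C0 * Cmod u ^ K <= _).
    by apply: Rmult_le_compat_r (Rle_abs _); apply: pow_le.
  by apply: Rmult_le_compat_l => //; apply: Rabs_pos.
have h4 : Rabs (Re (u * S)) <= Cmod u * D.
  apply: Rle_trans (re_le_Cmod _) _; rewrite Cmod_mult; exact: Rmult_le_compat_l.
have h5 := Rle_trans _ _ _ h2 h3; move/Rabs_le_between: h5 => [_ h5].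
rewrite Re_minus Re_plus (_ : Re (RtoC r) = r) // in h5.
move/Rabs_le_between: h4 => [h4 h6].
have h7 : Cmod u * (Rabs C0 + D) <= 6 * x * (Rabs C0 + D).
  by apply: Rmult_le_compat_r => //; have := Rabs_pos C0; lra.
have := Rabs_pos C0; rewrite /E in x3; nra.
Qed.

Lemma arcs_bound K : (0 < K)%N -> exists (d : nat -> C) (C0 x0 : R), [/\ 0 < x0, 0 < Re (d 0%N) &
  forall x y, 0 < x < x0 -> Rabs y <= PI ->
  Cmod (Cexp (T (x, y)) - Cexp (RtoC A / uvar (x, y)) * csum (fun i => d i * uvar (x, y) ^ i) K)%C
    <= C0 * x ^ K * exp (A / x)].
Proof.
case: K => [//|K] _; have [d [C0 [x0 [x0p H]]]] := near_poly K.+1.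
have d0 := lead_coef_pos (ltn0Sn K) x0p H.
have [B [B0 HB]] := T_real_bound.
set S := rsum (fun i => Cmod (d i) * 2 ^ i) K.+1.
have S0 : 0 <= S by apply: rsum_ge0 => i; apply: Rmult_le_pos (Cmod_ge_0 _) (pow_le _ _ _); lra.
(* Outside the sector T loses 1 / (2x) - 1 / (8x) = 3 / (8x), and A / |u| <= A / (8x) lies 7 A /
   (8x) below A / x; [exp_neg_small] turns both savings into powers of x. In [E1], 294 is 6 times
   49: in the sector |z| <= 49 x < 1 and |u| <= 6 |z|. *)
set L1 := INR (fact K.+1) / (3 / 8) ^ K.+1.
set L2 := INR (fact K.+1) / (7 / 8 * A) ^ K.+1.
set E1 := Rabs C0 * exp A * 294 ^ K.+1.
set E2 := exp (B + 3 / 2) * L1 + S * L2.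
exists d, (E1 + E2), (Rmin x0 (1 / 49)); split=> //; first by apply: Rmin_pos; lra.
have hf := INR_fact_lt_0 K.+1.
have L10 : 0 < L1 by apply: Rdiv_lt_0_compat => //; apply: pow_lt; lra.
have L20 : 0 < L2 by apply: Rdiv_lt_0_compat => //; apply: pow_lt; lra.
have E10 : 0 <= E1.
  by apply: Rmult_le_pos; [apply: Rmult_le_pos; [apply: Rabs_pos | apply/Rlt_le/exp_pos] | apply: pow_le; lra].
have E20 : 0 <= E2.
  by apply: Rplus_le_le_0_compat; apply: Rmult_le_pos => //; try lra; apply/Rlt_le/exp_pos.
move=> x y [xp xm] hy.
have x1 : x < x0 by apply: Rlt_le_trans xm (Rmin_l _ _).
have x2 : x < 1 / 49 by apply: Rlt_le_trans xm (Rmin_r _ _).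
have xK : 0 < x ^ K.+1 by apply: pow_lt.
have eA := exp_pos (A / x).
set z := (x, y); have rz : Re z = x by [].
have zp : 0 < Re z by rewrite rz.
have u0 := u_neq0 zp; have up : 0 < Cmod (uvar z) by apply/Cmod_gt_0.
have ReA : Re (RtoC A / uvar z)%C <= A * / Cmod (uvar z).
  apply: Rle_trans (Rle_trans _ _ _ (Rle_abs _) (re_le_Cmod _)) _.
  by rewrite Cmod_div // Cmod_R Rabs_pos_eq; lra.
have iu0 : 0 < / Cmod (uvar z) by apply: Rinv_0_lt_compat.
suff : Cmod (Cexp (T z) - Cexp (RtoC A / uvar z) * csum (fun i => d i * uvar z ^ i) K.+1)%C <= E1 * (x ^ K.+1 * exp (A / x))
   \/ Cmod (Cexp (T z) - Cexp (RtoC A / uvar z) * csum (fun i => d i * uvar z ^ i) K.+1)%C <= E2 * (x ^ K.+1 * exp (A / x)).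
  have : 0 < x ^ K.+1 * exp (A / x) by apply: Rmult_lt_0_compat.
  by move=> hp [] h; nra.
have [near|away] := Rle_lt_dec (Rabs y) (48 * x).
  left; have h := H z ltac:(rewrite rz; lra) near.
  rewrite (_ : (Cexp (T z) - _)%C = (Cexp (RtoC A / uvar z) * (Cexp (T z - RtoC A / uvar z) - csum (fun i => d i * uvar z ^ i) K.+1))%C); last first.
    by rewrite Cexp_minus; field; apply: Cexp_neq0.
  rewrite Cmod_mult Cmod_Cexp.
  have h1 : exp (Re (RtoC A / uvar z)%C) <= exp A * exp (A / x).
    rewrite -exp_plus; apply: exp_le_compat; apply: Rle_trans ReA _.
    by have := u_ge_x y xp; rewrite -/z /Rdiv; nra.
  have hz := sector zp near; rewrite rz in hz.
  have h2 : Cmod (uvar z) <= 294 * x by have := @u_lip z; lra.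
  have h3 : Cmod (uvar z) ^ K.+1 <= 294 ^ K.+1 * x ^ K.+1.
    by rewrite -Rpow_mult_distr; apply: pow_incr; lra.
  have h4 : Cmod (Cexp (T z - RtoC A / uvar z) - csum (fun i => d i * uvar z ^ i)%C K.+1) <= Rabs C0 * (294 ^ K.+1 * x ^ K.+1).
    apply: Rle_trans h _; apply: Rle_trans (_ : Rabs C0 * Cmod (uvar z) ^ K.+1 <= _).
      by apply: Rmult_le_compat_r (Rle_abs _); apply: pow_le; lra.
    by apply: Rmult_le_compat_l h3; apply: Rabs_pos.
  apply: Rle_trans (Rmult_le_compat _ _ _ _ _ _ h1 h4) _.
  - exact/Rlt_le/exp_pos.
  - exact: Cmod_ge_0.
  - by right; rewrite /E1; ring.
right; have iu : / Cmod (uvar z) <= / (8 * x).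
  by apply: Rinv_le_contravar; [lra | have := u_ge xp hy; rewrite -/z; lra].
have i8 : / (8 * x) = / x / 8 by field; lra.
have ix : 0 < / x by apply: Rinv_0_lt_compat.
have hT : Cmod (Cexp (T z)) <= exp (B + 3 / 2) * L1 * (x ^ K.+1 * exp (A / x)).
  rewrite Cmod_Cexp.
  have h1 := T_away zp; rewrite rz in h1.
  have h2 := Re_phi_le zp; have h3 := @phi_real_ge x ltac:(lra).
  have h4 : Re (T (RtoC x)) <= A / x + B.
    have := HB x ltac:(lra); rewrite {1}T_real // -RtoC_div; last lra.
    by rewrite -RtoC_minus Cmod_R => /Rabs_le_between [_]; rewrite /Rdiv; lra.
  have i2 : / (2 * x) = / x / 2 by field; lra.
  apply: Rle_trans (_ : exp (B + 3 / 2) * (exp (A / x) * exp (- (3 / 8 / x))) <= _).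
    rewrite -!exp_plus; apply: exp_le_compat.
    by rewrite /Rdiv in h4 *; lra.
  have h5 := @exp_neg_small K (3 / 8) x ltac:(lra) xp; rewrite -/L1 in h5.
  rewrite (Rmult_assoc _ L1); apply: Rmult_le_compat_l; first exact/Rlt_le/exp_pos.
  rewrite (_ : L1 * (x ^ K.+1 * exp (A / x)) = exp (A / x) * (L1 * x ^ K.+1)); last by ring.
  by apply: Rmult_le_compat_l; lra.
have hG : Cmod (Cexp (RtoC A / uvar z) * csum (fun i => d i * uvar z ^ i) K.+1)%C <= S * L2 * (x ^ K.+1 * exp (A / x)).
  have u2 := uvar_le2 zp.
  rewrite Cmod_mult Cmod_Cexp; have h1 := @csum_pow_le d K.+1 _ u2; rewrite -/S in h1.
  have h2 : exp (Re (RtoC A / uvar z)%C) <= exp (A / x) * exp (- (7 / 8 * A / x)).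
    rewrite -exp_plus; apply: exp_le_compat; apply: Rle_trans ReA _.
    by rewrite /Rdiv; nra.
  have h5 := @exp_neg_small K (7 / 8 * A) x ltac:(lra) xp; rewrite -/L2 in h5.
  apply: Rle_trans (_ : (exp (A / x) * exp (- (7 / 8 * A / x))) * S <= _).
    by apply: Rmult_le_compat => //; [apply/Rlt_le/exp_pos | apply: Cmod_ge_0].
  apply: Rle_trans (_ : (exp (A / x) * (L2 * x ^ K.+1)) * S <= _); last by right; ring.
  by apply: Rmult_le_compat_r => //; apply: Rmult_le_compat_l; lra.
apply: Rle_trans (Cmod_triangle _ _) _; rewrite Cmod_opp /E2; lra.
Qed.

End Arcs.

(** * Power series on the unit disk *)

Definition disk_series (f : C -> C) (a : nat -> C) :=
  (forall r, 0 <= r < 1 -> ex_series (fun n => Cmod (a n) * r ^ n)) /\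
  (forall q, Cmod q < 1 -> Clim (csum (fun n => a n * q ^ n)%C) (f q)).

Lemma disk_series_ext f g a b : (forall q, Cmod q < 1 -> f q = g q) -> (forall n, a n = b n) ->
  disk_series f a -> disk_series g b.
Proof.
move=> Hf Ha [H1 H2]; split.
  by move=> r /H1; apply: ex_series_ext => n; rewrite Ha.
move=> q hq; rewrite -Hf //; apply: Clim_ext (H2 q hq) => n.
by apply: csum_ext => i _; rewrite Ha.
Qed.

Lemma disk_series_plus f g a b : disk_series f a -> disk_series g b ->
  disk_series (fun q => f q + g q)%C (fun n => a n + b n)%C.
Proof.
move=> [H1 H2] [H3 H4]; split.
  move=> r hr; apply: ex_series_dom (ex_series_plus _ _ (H1 r hr) (H3 r hr)) => n.
  have hp : 0 <= r ^ n by apply: pow_le; lra.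
  split; first by apply: Rmult_le_pos => //; apply: Cmod_ge_0.
  rewrite /plus /= -Rmult_plus_distr_r; apply: Rmult_le_compat_r => //.
  exact: Cmod_triangle.
move=> q hq; apply: Clim_ext (Clim_plus (H2 q hq) (H4 q hq)) => n.
by rewrite -csum_plus; apply: csum_ext => i _; ring.
Qed.

Lemma disk_series_scal c f a : disk_series f a -> disk_series (fun q => c * f q)%C (fun n => c * a n)%C.
Proof.
move=> [H1 H2]; split.
  move=> r hr; apply: ex_series_ext (ex_series_scal (Cmod c) _ (H1 r hr)) => n.
  by rewrite Cmod_mult /scal /= /mult /=; ring.
move=> q hq; apply: Clim_ext (Clim_scal c (H2 q hq)) => n.
by rewrite -csum_scal; apply: csum_ext => i _; ring.
Qed.

Definition delay (N : nat) (a : nat -> C) (n : nat) : C := if (N <= n)%N then a (n - N)%N else RtoC 0.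

Lemma csum_delay N a q L :
  csum (fun n => delay N a n * q ^ n)%C (N + L) = (q ^ N * csum (fun n => a n * q ^ n)%C L)%C.
Proof.
rewrite csum_add (csum_ext (g := fun _ => RtoC 0)); last first.
  by move=> i hi; rewrite /delay leqNgt hi Cmult_0_l.
rewrite csum_zero -csum_scal Cplus_0_l; apply: csum_ext => i _.
rewrite /delay leq_addr addKn.
by rewrite Cpow_addn; ring.
Qed.

Lemma rsum_delay N (a : nat -> C) r L : 0 <= r ->
  rsum (fun n => Cmod (delay N a n) * r ^ n) L <= r ^ N * rsum (fun n => Cmod (a n) * r ^ n) L.
Proof.
move=> hr.
have pos n : 0 <= Cmod (a n) * r ^ n by apply: Rmult_le_pos (Cmod_ge_0 _) (pow_le _ _ hr).
have z K : (K <= N)%N -> rsum (fun n => Cmod (delay N a n) * r ^ n) K = 0.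
  elim: K => [|K IH] hK; first by rewrite rsum0.
  by rewrite rsumS IH ?(ltnW hK) // /delay leqNgt hK Cmod_0; ring.
have rN : 0 <= r ^ N by apply: pow_le.
have [hL|hL] := leqP L N.
  by rewrite z //; apply: Rmult_le_pos => //; apply: rsum_ge0.
rewrite -(subnKC (ltnW hL)) rsum_add z // Rplus_0_l.
apply: Rle_trans (_ : r ^ N * rsum (fun n => Cmod (a n) * r ^ n) (L - N) <= _).
  rewrite -rsum_scal; apply: rsum_le => i _; rewrite /delay leq_addr addKn.
  by rewrite (_ : r ^ (N + i) = r ^ N * r ^ i); [right; ring | rewrite -pow_add].
by apply: Rmult_le_compat_l => //; apply: rsum_mono => //; lia.
Qed.

Lemma Clim_delay N a q l : Clim (csum (fun n => a n * q ^ n)%C) l ->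
  Clim (csum (fun n => delay N a n * q ^ n)%C) (q ^ N * l)%C.
Proof.
move=> H; apply: (proj2 (is_lim_seq_incr_n _ N _)).
have H2 := Clim_scal (q ^ N)%C H.
apply: is_lim_seq_ext H2 => n; congr (Cmod (_ - _)%C).
by rewrite -csum_delay; congr csum; lia.
Qed.

Lemma disk_series_delay N f a : disk_series f a -> disk_series (fun q => q ^ N * f q)%C (delay N a).
Proof.
move=> [H1 H2]; split; last by move=> q /H2; apply: Clim_delay.
move=> r hr; have pos n : 0 <= Cmod (a n) * r ^ n by apply: Rmult_le_pos (Cmod_ge_0 _) (pow_le _ _ _); lra.
apply: (@ex_series_bounded _ (r ^ N * Series (fun n => Cmod (a n) * r ^ n))).
  by move=> i; apply: Rmult_le_pos (Cmod_ge_0 _) (pow_le _ _ _); lra.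
move=> n; apply: Rle_trans (rsum_delay N a n (proj1 hr)) _.
by apply: Rmult_le_compat_l; [apply: pow_le; lra | apply: rsum_le_Series => //; apply: H1].
Qed.

(** The partial sums S of the moduli satisfy S <= S_a + r^N S, hence are bounded by S_a / (1 - r^N);
    the value then solves l = f + q^N l. *)
Lemma disk_series_div N f a b : (0 < N)%N -> disk_series f a ->
  (forall n, b n = (a n + delay N b n)%C) -> disk_series (fun q => f q / (1 - q ^ N))%C b.
Proof.
move=> N0 [H1 H2] Hb.
have ex r : 0 <= r < 1 -> ex_series (fun n => Cmod (b n) * r ^ n).
  move=> hr; have rN : r ^ N < 1.
    case: N N0 {Hb} => [//|N] _ /=.
    have : 0 <= r ^ N <= 1 by split; [apply: pow_le; lra | rewrite -(pow1 N); apply: pow_incr; lra].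
    by nra.
  have pos (c : nat -> C) n : 0 <= Cmod (c n) * r ^ n by apply: Rmult_le_pos (Cmod_ge_0 _) (pow_le _ _ _); lra.
  apply: (@ex_series_bounded _ (Series (fun n => Cmod (a n) * r ^ n) / (1 - r ^ N))) => // n.
  apply/Rle_div_r; first lra.
  have h1 := rsum_le_Series n (pos a) (H1 r hr).
  have h2 := rsum_delay N b n (proj1 hr).
  have h3 : rsum (fun n => Cmod (b n) * r ^ n) n <= rsum (fun n => Cmod (a n) * r ^ n) n + rsum (fun n => Cmod (delay N b n) * r ^ n) n.
    rewrite -rsum_plus; apply: rsum_le => i _; rewrite {1}Hb -Rmult_plus_distr_r.
    by apply: Rmult_le_compat_r; [apply: pow_le; lra | apply: Cmod_triangle].
  by nra.
split=> // q hq.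
have [l Hl] : exists l, Clim (csum (fun n => b n * q ^ n)%C) l.
  apply: csum_abs_cv; apply: ex_series_ext (ex (Cmod q) _) => [n|].
    by rewrite Cmod_mult Cmod_pow.
  by split=> //; apply: Cmod_ge_0.
have Hd := Clim_delay N Hl.
have e : l = (f q + q ^ N * l)%C.
  apply: (Clim_uniq Hl); apply: Clim_ext (Clim_plus (H2 q hq) Hd) => n.
  by rewrite -csum_plus; apply: csum_ext => i _; rewrite [in RHS]Hb; ring.
have h0 : (1 - q ^ N)%C <> 0.
  move=> /Cminus_eq0 h; have : Cmod (q ^ N) = 1 by rewrite -h Cmod_1.
  rewrite Cmod_pow; case: N N0 {Hb Hd e h} => [//|N] _ /=.
  have : 0 <= Cmod q ^ N <= 1.
    by split; [apply: pow_le; apply: Cmod_ge_0 | rewrite -(pow1 N); apply: pow_incr; split; [apply: Cmod_ge_0 | lra]].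
  by have := Cmod_ge_0 q; nra.
have -> : (f q / (1 - q ^ N))%C = l; last by [].
have -> : f q = (l * (1 - q ^ N))%C by rewrite {1}e -[f q](_ : (l - q ^ N * l)%C = _); [ring | rewrite {1}e; ring].
by field.
Qed.

(** Inversion of the discrete Fourier transform of length L; the exponent L - n stands for - n
    modulo L. *)
Lemma poly_coef_roots (a : nat -> C) L n r : (n < L)%N ->
  csum (fun j => csum (fun l => a l * (RtoC r * cis (2 * PI * INR j / INR L)) ^ l) L *
      cis (2 * PI * INR j * INR (L - n) / INR L))%C L
  = (L%:C * (a n * RtoC (r ^ n)))%C.
Proof.
move=> hn; have hL : 0 < INR L by apply: lt_0_INR; lia.
transitivity (csum (fun l => a l * RtoC (r ^ l) * csum (fun j => cis (2 * PI * INR (l + (L - n)) / INR L) ^ j)%C L)%C L).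
  transitivity (csum (fun l => csum (fun j => a l * RtoC (r ^ l) * cis (2 * PI * INR (l + (L - n)) / INR L) ^ j)%C L) L); last first.
    by apply: csum_ext => l _; rewrite csum_scal.
  rewrite [RHS]csum_swap; apply: csum_ext => j _.
  rewrite Cmult_comm -csum_scal; apply: csum_ext => l _.
  rewrite Cpow_mult_l !cis_pow RtoC_pow.
  rewrite (_ : INR j * (2 * PI * INR (l + (L - n)) / INR L) = INR l * (2 * PI * INR j / INR L) + 2 * PI * INR j * INR (L - n) / INR L).
    by rewrite cis_plus; ring.
  by rewrite plus_INR; field; lra.
have main l : (l < L)%N -> csum (fun j => cis (2 * PI * INR (l + (L - n)) / INR L) ^ j)%C L =
   if l == n then L%:C else RtoC 0.
  move=> hl; case: eqP => [->|/eqP hne].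
    rewrite subnKC ?(ltnW hn) // (_ : 2 * PI * INR L / INR L = 2 * PI); last by field; lra.
    rewrite cis_2PI (csum_ext (g := fun _ => RtoC 1)); last first.
      by move=> j _; rewrite Cpow_1_l.
    by rewrite csum_const Cmult_1_r.
  have [h|h] := ltnP (l + (L - n)) L; first by apply: roots_orth; lia.
  rewrite -(@roots_orth L (l + (L - n) - L)); last by lia.
  apply: csum_ext => j _; congr Cpow.
  rewrite -[LHS]Cmult_1_r -cis_2PI [in LHS](_ : INR (l + (L - n)) = INR (l + (L - n) - L) + INR L); last first.
    by rewrite -plus_INR; congr INR; lia.
  rewrite (_ : 2 * PI * (INR (l + (L - n) - L) + INR L) / INR L = 2 * PI * INR (l + (L - n) - L) / INR L + 2 * PI); last by field; lra.
  by rewrite cis_plus cis_2PI; ring.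
rewrite (csum_ext (g := fun l => if l == n then (INR L * (a n * RtoC (r ^ n)))%C else RtoC 0)); last first.
  by move=> l hl; rewrite main //; case: eqP => [->|_]; ring.
have gen m : csum (fun l => if l == n then (INR L * (a n * RtoC (r ^ n)))%C else RtoC 0) m
   = if (n < m)%N then (INR L * (a n * RtoC (r ^ n)))%C else RtoC 0.
  elim: m => [|m IH]; first by rewrite csum0.
  rewrite csumS IH ltnS [(n <= m)%N]leq_eqVlt eq_sym.
  by case: eqP => [->|_] /=; rewrite ?ltnn; [ring | case: ifP => _; ring].
by rewrite gen hn.
Qed.

(* Cauchy's estimate; the coefficient of a truncation of degree [< L] is a sum
   over the [L]-th roots of unity, so no contour integral is needed. *)
Lemma cauchy_estimate f a x B n : 0 < x -> disk_series f a ->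
  (forall y, Rabs y <= PI -> Cmod (f (Cexp (- (x, y)))) <= B) -> Cmod (a n) * exp (- x) ^ n <= B.
Proof.
move=> x0 [H1 H2] HB; set r := exp (- x).
have r0 : 0 < r by apply: exp_pos.
have r1 : r < 1 by rewrite /r -exp_0; apply: exp_increasing; lra.
apply: le_epsilon => eps e0.
have ex := H1 r ltac:(lra).
have pos m : 0 <= Cmod (a m) * r ^ m by apply: Rmult_le_pos (Cmod_ge_0 _) (pow_le _ _ _); lra.
have /is_series_rsum/is_lim_seq_spec/(_ (mkposreal _ e0)) [N HN] := Series_correct _ ex.
set L := (maxn N n).+1.
have hL : 0 < INR L by apply: lt_0_INR; lia.
have hNL := HN L ltac:(rewrite /L; lia).
have tl := rsum_le_Series L pos ex.
rewrite /= Rabs_minus_sym Rabs_pos_eq in hNL; last lra.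
have hp := PI_RGT_0.
have circ j : (j < L)%N -> Cmod (f (RtoC r * cis (2 * PI * INR j / INR L))%C) <= B.
  move=> hj; set th := 2 * PI * INR j / INR L.
  have hj2 : INR j <= INR L by apply: le_INR; lia.
  have hj0 := pos_INR j.
  have hth : 0 <= th <= 2 * PI.
    split; first by apply: Rdiv_le_0_compat => //; nra.
    by apply/Rle_div_l => //; nra.
  have gen y : Rabs y <= PI -> cis (- y) = cis th -> Cmod (f (RtoC r * cis th)%C) <= B.
    move=> hy <-; rewrite (_ : (r * cis (- y))%C = Cexp (- (x, y))); first exact: HB.
    by rewrite cis_exp /r -Cexp_RtoC -Cexp_plus; congr Cexp; apply: C_ext => /=; ring.
  have [h|h] := Rle_lt_dec th PI.
    by apply: (gen (- th)); [rewrite Rabs_Ropp Rabs_pos_eq; lra | rewrite Ropp_involutive].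
  apply: (gen (2 * PI - th)); first by rewrite Rabs_pos_eq; lra.
  rewrite (_ : - (2 * PI - th) = th + - (2 * PI)); last ring.
  rewrite cis_plus cis_opp cis_2PI (_ : Cconj 1 = 1); [ring | by apply: C_ext => /=; ring].
have pb j : (j < L)%N -> Cmod (csum (fun l => a l * (RtoC r * cis (2 * PI * INR j / INR L)) ^ l)%C L) <= B + eps.
  move=> hj; set q := (RtoC r * cis _)%C.
  have hq : Cmod q = r by rewrite Cmod_mult Cmod_cis Cmod_R Rabs_pos_eq; lra.
  have hl := H2 q ltac:(rewrite hq; lra).
  have t := csum_tail_le (n := L) (g := fun m => Cmod (a m) * r ^ m) _ pos ex hl.
  have {}t : Cmod (f q - csum (fun l => a l * q ^ l)%C L) <= Series (fun m => Cmod (a m) * r ^ m) - rsum (fun m => Cmod (a m) * r ^ m) L.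
    by apply: t => i _; rewrite Cmod_mult Cmod_pow hq; lra.
  have := circ j hj; rewrite -/q; have := Cmod_triang_inv (csum (fun l => a l * q ^ l)%C L) (f q).
  by rewrite Cmod_minus_sym; lra.
have e := @poly_coef_roots a L n r ltac:(rewrite /L; lia).
have : Cmod (L%:C * (a n * RtoC (r ^ n)))%C <= INR L * (B + eps).
  rewrite -e; apply: Rle_trans (Cmod_csum _ _) _.
  apply: Rle_trans (_ : rsum (fun _ => B + eps) L <= _).
    by apply: rsum_le => j hj; rewrite Cmod_mult Cmod_cis Rmult_1_r; apply: pb.
  by rewrite rsum_const; lra.
rewrite !Cmod_mult !Cmod_R (Rabs_pos_eq (INR L)) ?(Rabs_pos_eq (r ^ n)); try lra; last by apply: pow_le; lra.
by move/Rmult_le_reg_l; apply.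
Qed.

(** * The generating functions as exponentials *)

Lemma lim_pow0 r : 0 <= r < 1 -> is_lim_seq (fun n => r ^ n) 0.
Proof. by move=> hr; apply: is_lim_seq_geom; rewrite Rabs_pos_eq; lra. Qed.

Lemma Clim_Cexp u l : Clim u l -> Clim (fun n => Cexp (u n)) (Cexp l).
Proof.
move=> H; apply: Clim_squeeze (lim0_scal (6 * Cmod (Cexp l)) H).
move/Clim_spec: H => /(_ (mkposreal 1 Rlt_0_1)); apply: filter_imp => n /= h.
rewrite (_ : (Cexp (u n) - Cexp l)%C = (Cexp l * (Cexp (u n - l) - 1))%C).
  rewrite Cmod_mult; have := @Cexp_lip (u n - l) ltac:(lra); have := Cmod_ge_0 (Cexp l); nra.
by rewrite Cexp_minus; field; apply: Cexp_neq0.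
Qed.

Lemma ex_series_pow r : 0 <= r < 1 -> ex_series (fun n => r ^ n).
Proof. by move=> hr; exists (/ (1 - r)); apply: is_series_geom; rewrite Rabs_pos_eq; lra. Qed.

(* The partial sums f(t) of the logarithmic series at t w, up to exponent M, satisfy
   ((1 - t w) exp f(t))' = - w (t w)^M exp f(t), which tends to 0. *)
Lemma exp_log_series (w : C) : Cmod w < 1 ->
  exists L, Clim (csum (fun m => w ^ m.+1 / m.+1%:C)%C) L /\ (/ (1 - w))%C = Cexp L.
Proof.
move=> hw; have w0 := Cmod_ge_0 w; set r := Cmod w in hw w0.
have ex := ex_series_pow (conj w0 hw).
have term (v : C) m : Cmod v <= r -> Cmod (v ^ m.+1 / m.+1%:C) <= r ^ m.
  move=> hv; have hm := INR_S_pos m; have hm1 : 1 <= INR m.+1 by apply: (le_INR 1); lia.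
  rewrite Cmod_div; last exact: CINR_neq0.
  rewrite Cmod_pow Cmod_R (Rabs_pos_eq (INR _)); last lra.
  have p0 : 0 <= r ^ m by apply: pow_le.
  apply/Rle_div_l; first lra.
  have : Cmod v ^ m.+1 <= r ^ m.+1 by apply: pow_incr; split=> //; apply: Cmod_ge_0.
  by rewrite [r ^ m.+1]/=; nra.
have [L HL] : exists L, Clim (csum (fun m => w ^ m.+1 / m.+1%:C)%C) L.
  apply: csum_abs_cv; apply: ex_series_dom ex => m; split; first exact: Cmod_ge_0.
  by apply: term; rewrite /r; lra.
exists L; split=> //.
set S := Series (fun n => r ^ n) in ex *.
pose f M (t : R) := csum (fun m => (RtoC t * w) ^ m.+1 / m.+1%:C)%C M.
have Df M t : Dc (f M) t (w * csum (fun m => (RtoC t * w) ^ m) M)%C.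
  elim: M => [|M IH].
    rewrite csum0 Cmult_0_r; apply: Dc_ext (Dc_const 0 t) => s; by rewrite /f csum0.
  apply: Dc_ext (_ : Dc (fun s => f M s + / M.+1%:C * (RtoC s * w) ^ M.+1)%C t _) => [s|].
    by rewrite /f csumS; congr Cplus; field; apply: CINR_neq0.
  apply: Dc_eq (Dc_plus IH (Dc_scal _ (Dc_pow M w t))) _.
  by rewrite csumS; field; apply: CINR_neq0.
have fb M t : 0 <= t <= 1 -> Cmod (f M t) <= S.
  move=> ht; apply: Rle_trans (Cmod_csum _ _) _.
  apply: Rle_trans (rsum_le_Series M (fun i => pow_le _ i w0) ex).
  apply: rsum_le => i _; apply: term; rewrite Cmod_mult Cmod_R Rabs_pos_eq; rewrite -/r; nra.
have key M : Cmod ((1 - w) * Cexp (f M 1) - 1)%C <= 2 * (r * r ^ M * exp S).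
  pose y t := ((1 - RtoC t * w) * Cexp (f M t))%C.
  have -> : ((1 - w) * Cexp (f M 1) - 1)%C = (y 1 - y 0)%C.
    rewrite /y Cmult_1_l Cmult_0_l (_ : f M 0 = 0) ?Cexp_0; first ring.
    rewrite /f; elim: (M) => [|m IH]; rewrite ?csum0 // csumS IH Cpow_S.
    by field; apply: CINR_neq0.
  apply: (@Dc_MVT y (fun t => - w * (RtoC t * w) ^ M * Cexp (f M t))%C) => t ht.
    have H1 : Dc (fun s => 1 - RtoC s * w)%C t (- w)%C.
      apply: Dc_ext (_ : Dc (fun s => 1 + - w * RtoC s)%C t _) => [s|]; first ring.
      apply: Dc_eq (Dc_plus (Dc_const 1 t) (Dc_scal (- w)%C (Dc_RtoC (is_derive_id t)))) _.
      by rewrite (_ : RtoC Hierarchy.one = 1) //; ring.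
    apply: Dc_eq (Dc_mult H1 (Dc_exp (Df M t))) _.
    have g := geom_csum (RtoC t * w)%C M.
    rewrite (_ : (1 - t * w)%C = (- (t * w - 1))%C); last ring.
    set s := csum _ _ in g *; rewrite (_ : (- (t * w - 1) * (w * s * Cexp (f M t)) = - (s * (t * w - 1)) * w * Cexp (f M t))%C); last ring.
    by rewrite g; ring.
  rewrite !Cmod_mult Cmod_opp Cmod_pow -/r Cmod_Cexp.
  have h1 : Cmod (t * w) <= r by rewrite Cmod_mult Cmod_R Rabs_pos_eq -/r; nra.
  have h2 : Cmod (t * w) ^ M <= r ^ M by apply: pow_incr; split=> //; apply: Cmod_ge_0.
  apply: Rmult_le_compat.
  - by apply: Rmult_le_pos => //; apply: pow_le; apply: Cmod_ge_0.
  - exact/Rlt_le/exp_pos.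
  - exact: Rmult_le_compat_l.
  - apply: exp_le_compat; apply: Rle_trans (fb M t ht).
    exact: Rle_trans (Rle_abs _) (re_le_Cmod _).
have H1 : Clim (fun M => (1 - w) * Cexp (f M 1))%C 1.
  apply: (@Clim_squeeze _ _ (fun M => 2 * r * exp S * r ^ M)).
    by exists 0%N => M _; apply: Rle_trans (key M) _; right; ring.
  by apply: lim0_scal; apply: lim_pow0.
have H2 : Clim (fun M => (1 - w) * Cexp (f M 1))%C ((1 - w) * Cexp L)%C.
  apply: Clim_scal; apply: Clim_Cexp; apply: Clim_ext HL => M.
  by rewrite /f; apply: csum_ext => m _; rewrite Cmult_1_l.
have e := Clim_uniq H1 H2; have h := one_minus_neq0 hw.
rewrite (_ : Cexp L = / (1 - w) * ((1 - w) * Cexp L))%C; last by field.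
by rewrite -e Cmult_1_r.
Qed.

(** E is one factor of the product, at w = q^j; its logarithm carries the weights that define T. *)
Definition exp_factor (c : nat -> R) (E : C -> C) := forall w : C, Cmod w < 1 ->
  exists L, Clim (csum (fun m => RtoC (c m) * (w ^ m.+1 / m.+1%:C))%C) L /\ E w = Cexp L.

Lemma exp_factor_part : exp_factor (fun _ => 1) (fun w => 1 / (1 - w))%C.
Proof.
move=> w hw; have [L [HL e]] := exp_log_series hw; exists L; split.
  by apply: Clim_ext HL => n; apply: csum_ext => m _; rewrite Cmult_1_l.
by rewrite -e; field; apply: one_minus_neq0.
Qed.

(* Indices are shifted: [c m] is the weight of w^(m+1) / (m+1) in [exp_factor c E]. *)
Definition odd_weight (m : nat) : R := if odd m then 0 else 2.

Lemma csum_odd_weight (g : nat -> C) P :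
  csum (fun m => RtoC (odd_weight m) * g m)%C (2 * P) =
  (2 * csum g (2 * P) - csum (fun i => 2 * g (2 * i).+1) P)%C.
Proof.
elim: P => [|P IH]; first by rewrite muln0 !csum0; ring.
have -> : (2 * P.+1 = (2 * P).+2)%N by lia.
rewrite !csumS IH /odd_weight /= mul2n odd_double /=.
by ring.
Qed.

(** As (1 + w) / (1 - w) = (1 - w^2) / (1 - w)^2, the logarithm is 2 L(w) - L(w^2) with L(w) = - log
    (1 - w), and the even exponents cancel. *)
Lemma exp_factor_over : exp_factor odd_weight (fun w => (1 + w) / (1 - w))%C.
Proof.
move=> w hw; have [L [HL e]] := exp_log_series hw.
have hw2 : Cmod (w * w) < 1 by rewrite Cmod_mult; have := Cmod_ge_0 w; nra.
have [L2 [HL2 e2]] := exp_log_series hw2.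
have [L' HL'] : exists L', Clim (csum (fun m => RtoC (odd_weight m) * (w ^ m.+1 / m.+1%:C))%C) L'.
  have w0 := Cmod_ge_0 w.
  apply: csum_abs_cv; apply: ex_series_dom (ex_series_scal 2 _ (ex_series_pow (conj w0 hw))) => m.
  split; first exact: Cmod_ge_0.
  have hm := INR_S_pos m; have hm1 : 1 <= INR m.+1 by apply: (le_INR 1); lia.
  rewrite Cmod_mult Cmod_div ?Cmod_pow ?Cmod_R ?(Rabs_pos_eq (INR _)); try lra; last exact: CINR_neq0.
  rewrite [scal _ _](_ : _ = 2 * Cmod w ^ m) // [Cmod w ^ m.+1](_ : _ = Cmod w * Cmod w ^ m) //.
  have p0 : 0 <= Cmod w ^ m by apply: pow_le.
  have h : Cmod w * Cmod w ^ m / INR m.+1 <= Cmod w ^ m by apply/Rle_div_l; nra.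
  have h0 : 0 <= Cmod w * Cmod w ^ m / INR m.+1 by apply: Rdiv_le_0_compat => //; nra.
  have : 0 <= Rabs (odd_weight m) <= 2 by rewrite /odd_weight; case: odd; rewrite Rabs_pos_eq; lra.
  by move=> *; apply: Rmult_le_compat; lra.
exists L'; split=> //.
have e' : L' = (2 * L - L2)%C.
  have d n : (n <= 2 * n)%N by lia.
  apply: (Clim_uniq (Clim_subseq d HL')).
  apply: Clim_ext (Clim_minus (Clim_scal 2 (Clim_subseq d HL)) HL2) => n.
  rewrite csum_odd_weight; congr Cminus; apply: csum_ext => i _.
  have -> : (2 * i).+2 = (2 * i.+1)%N by lia.
  rewrite mult_INR RtoC_mult (_ : INR 2 = 2) //.
  rewrite Cpow_muln (_ : (w ^ 2)%C = (w * w)%C); last by rewrite /=; ring.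
  by field; apply: CINR_neq0.
rewrite e' Cexp_minus -e2.
rewrite (_ : (2 * L)%C = (L + L)%C); last ring.
rewrite Cexp_plus -e.
have h1 := one_minus_neq0 hw; have h2 := one_minus_neq0 hw2.
field; split=> //.
Qed.

Section Products.
Variables (k : nat) (c : nat -> R) (E : C -> C).
Hypothesis k2 : (1 < k)%N.
Hypothesis c_bound : forall m, 0 <= c m <= 2.
Hypothesis HE : exp_factor c E.
Let k0 : (0 < k)%N. Proof. exact: ltnW. Qed.

Fixpoint reg_prod (n : nat) (q : C) : C :=
  match n with
  | 0%N => 1
  | n'.+1 => if (k %| n'.+1)%N then reg_prod n' q else (reg_prod n' q * E (q ^ n'.+1))%C
  end.

Lemma reg_prodS n q : reg_prod n.+1 q =
  if (k %| n.+1)%N then reg_prod n q else (reg_prod n q * E (q ^ n.+1))%C.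
Proof. by []. Qed.

Definition log_gen (z : C) : C :=
  CLim (csum (fun m => RtoC (c m) * (phi k (m.+1%:C * z) / m.+1%:C))%C).

Lemma reg_prod_exp n q : Cmod q < 1 -> exists L,
  Clim (csum (fun m => RtoC (c m) *
     (csum (fun j => if (k %| j.+1)%N then RtoC 0 else ((q ^ m.+1) ^ j.+1)%C) n / m.+1%:C))%C) L
  /\ reg_prod n q = Cexp L.
Proof.
move=> hq; elim: n => [|n [L [HL e]]].
  exists 0; split; last by rewrite Cexp_0.
  apply: Clim_ext (Clim_const 0) => n; rewrite -[LHS](csum_zero n).
  by apply: csum_ext => m _; rewrite csum0 /Cdiv; ring.
rewrite reg_prodS; case: ifP => hk.
  exists L; split=> //; apply: Clim_ext HL => N; apply: csum_ext => m _.
  by rewrite csumS hk Cplus_0_r.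
have [L2 [HL2 e2]] := HE (Cmod_pow_lt1 hq (ltn0Sn n)).
exists (L + L2)%C; split; last by rewrite e e2 Cexp_plus.
apply: Clim_ext (Clim_plus HL HL2) => N; rewrite -csum_plus; apply: csum_ext => m _.
rewrite csumS hk.
have -> : ((q ^ m.+1) ^ n.+1 = (q ^ n.+1) ^ m.+1)%C by rewrite -!Cpow_muln mulnC.
by field; apply: CINR_neq0.
Qed.

(** Among k consecutive exponents only the last is dropped, and the blocks form a geometric
    progression in Q^k; the truncation shows only in the factor 1 - Q^(kN). *)
Lemma csum_not_dvd (Q : C) N : Cmod Q < 1 ->
  csum (fun j => if (k %| j.+1)%N then RtoC 0 else (Q ^ j.+1)%C) (k * N) =
  (csum (fun r => Q ^ r.+1) k.-1 / (1 - Q ^ k) * (1 - (Q ^ k) ^ N))%C.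
Proof.
move=> hQ; have h := one_minus_neq0 (Cmod_pow_lt1 hQ k0).
rewrite csum_blocks.
rewrite (csum_ext (g := fun i => (csum (fun r => Q ^ r.+1) k.-1 * (Q ^ k) ^ i)%C)); last first.
  move=> i _; rewrite (_ : forall f : nat -> C, csum f k = (csum f k.-1 + f k.-1)%C); last first.
    by move=> f; rewrite -{1}(prednK k0) csumS.
  have -> : (k %| (k * i + k.-1).+1)%N.
    by rewrite -addnS (prednK k0) dvdn_add ?dvdn_mulr.
  rewrite Cplus_0_r Cmult_comm -csum_scal; apply: csum_ext => r hr.
  have -> : (k %| (k * i + r).+1)%N = false.
    rewrite -addnS dvdn_addr ?dvdn_mulr //; apply/negP => /dvdn_leq; lia.
  by rewrite -addnS Cpow_addn Cpow_muln.
rewrite csum_scal; set s := csum (fun i => _) N; set a := csum _ _.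
have g : (s * (Q ^ k - 1) = (Q ^ k) ^ N - 1)%C := geom_csum (Q ^ k)%C N.
rewrite (_ : (1 - (Q ^ k) ^ N = s * (1 - Q ^ k))%C); first by field.
rewrite (_ : (1 - (Q ^ k) ^ N = - ((Q ^ k) ^ N - 1))%C); last by ring.
by rewrite -g; ring.
Qed.

Let term_bound z m : 0 < Re z ->
  Cmod (RtoC (c m) * (phi k (m.+1%:C * z) / m.+1%:C))%C <= 8 / Re z ^ 2 * inv_sq m.
Proof.
move=> hz; rewrite Cmod_mult Cmod_R Rabs_pos_eq; last by case: (c_bound m).
rewrite (_ : 8 / Re z ^ 2 * inv_sq m = 2 * (4 / Re z ^ 2 * inv_sq m)); last by field; lra.
have h := phi_term_bound k0 hz m; have [h1 h2] := c_bound m.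
by apply: Rmult_le_compat => //; apply: Cmod_ge_0.
Qed.

Let ex_term x : ex_series (fun m => 8 / x ^ 2 * inv_sq m).
Proof. exact: (ex_series_scal (8 / x ^ 2) _ ex_series_inv_sq). Qed.

Lemma log_gen_lim z : 0 < Re z ->
  Clim (csum (fun m => RtoC (c m) * (phi k (m.+1%:C * z) / m.+1%:C))%C) (log_gen z).
Proof.
move=> hz.
have [l Hl] : exists l, Clim (csum (fun m => RtoC (c m) * (phi k (m.+1%:C * z) / m.+1%:C))%C) l.
  apply: csum_abs_cv; apply: ex_series_dom (ex_term (Re z)) => m; split; first exact: Cmod_ge_0.
  exact: term_bound.
exact: CLim_correct Hl.
Qed.

Lemma log_gen_bound z : 0 < Re z -> Cmod (log_gen z) <= 8 / Re z ^ 2 * zeta2.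
Proof.
move=> hz; have := Cmod_csum_lim (fun m => term_bound m hz) (ex_term (Re z)) (log_gen_lim hz).
by rewrite Series_scal_l.
Qed.

(** By [csum_not_dvd], cutting the product at kN changes each term of the logarithm by a relative
    error of at most e^(-N x), whatever y; Cauchy's estimate relies on this uniformity. *)
Lemma reg_prod_cv x eps : 0 < x -> 0 < eps -> exists N0, forall N y, (N0 <= N)%N ->
  Cmod (reg_prod (k * N) (Cexp (- (x, y))) - Cexp (log_gen (x, y))) <= eps.
Proof.
move=> x0 e0; set G := 8 / x ^ 2 * zeta2; set r := exp (- x).
have r0 : 0 < r by apply: exp_pos.
have r1 : r < 1 by rewrite /r -exp_0; apply: exp_increasing; lra.
have G0 : 0 <= G.
  by apply: Rmult_le_pos; [apply: Rdiv_le_0_compat; [lra | apply: pow_lt] | have := zeta2_pos; lra].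
have lim : is_lim_seq (fun N => (6 * exp G * G + G) * r ^ N) 0.
  by apply: lim0_scal; apply: lim_pow0; lra.
have e1 : 0 < Rmin eps 1 by apply: Rmin_pos; lra.
move/is_lim_seq_spec: lim => /(_ (mkposreal _ e1)) [N0 HN0].
exists N0 => N y hN; set z := (x, y); have hz : 0 < Re z by [].
have hq : Cmod (Cexp (- z)) < 1 by apply: Cexp_neg_lt1.
have [L [HL ->]] := reg_prod_exp (k * N) hq.
have hrN : 0 <= r ^ N by apply: pow_le; lra.
have hD : Cmod (log_gen z - L) <= r ^ N * G.
  have H := Clim_minus (log_gen_lim hz) HL.
  have exb : ex_series (fun m => r ^ N * (8 / x ^ 2 * inv_sq m)).
    exact: (ex_series_scal (r ^ N) _ (ex_term x)).
  have := @Cmod_csum_lim (fun m => RtoC (c m) * (phi k (m.+1%:C * z) / m.+1%:C) -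
     RtoC (c m) * (csum (fun j => if (k %| j.+1)%N then RtoC 0 else ((Cexp (- z) ^ m.+1) ^ j.+1)%C) (k * N) / m.+1%:C))%C
     _ (log_gen z - L)%C _ exb.
  rewrite (Series_scal_l (r ^ N)) Series_scal_l -/zeta2 -/G; apply.
    move=> m; have mz : 0 < Re (m.+1%:C * z).
      by rewrite Re_scal; apply: Rmult_lt_0_compat => //; apply: INR_S_pos.
    have eQ : (Cexp (- z) ^ m.+1)%C = Cexp (- (m.+1%:C * z)).
      by rewrite -Cexp_INR; congr Cexp; ring.
    have hQ := Cexp_neg_lt1 mz; rewrite eQ csum_not_dvd // -phi_geom //.
    set Q := Cexp _ in hQ *.
    rewrite (_ : (_ - _)%C = ((Q ^ k) ^ N * (RtoC (c m) * (phi k (m.+1%:C * z) / m.+1%:C)))%C); last first.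
      by field; apply: CINR_neq0.
    rewrite Cmod_mult; apply: Rmult_le_compat => //; try exact: Cmod_ge_0; last exact: (term_bound m hz).
    rewrite !Cmod_pow; apply: pow_incr; split; first by apply: pow_le; apply: Cmod_ge_0.
    have hQr : Cmod Q <= r.
      rewrite Cmod_Cexp Re_opp Re_scal; apply: exp_le_compat.
      have : 1 <= INR m.+1 by apply: (le_INR 1); lia.
      by rewrite (_ : Re z = x) //; nra.
    rewrite -(prednK k0) /=; have q0 := Cmod_ge_0 Q.
    have : 0 <= Cmod Q ^ k.-1 <= 1.
      by split; [apply: pow_le | rewrite -(pow1 k.-1); apply: pow_incr; lra].
    by nra.
  by apply: Clim_ext H => n; rewrite csum_minus.
have := HN0 N ltac:(lia); rewrite /= Rminus_0_r Rabs_pos_eq; last first.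
  by apply: Rmult_le_pos => //; have := exp_pos G; nra.
move=> hlt; have m1 := Rmin_l eps 1; have m2 := Rmin_r eps 1.
have eG := exp_pos G.
have hsm : Cmod (L - log_gen z) <= r ^ N * G by rewrite Cmod_minus_sym.
have h1 : Cmod (L - log_gen z) <= 1 by nra.
rewrite (_ : (Cexp L - Cexp (log_gen z))%C = (Cexp (log_gen z) * (Cexp (L - log_gen z) - 1))%C); last first.
  by rewrite Cexp_minus; field; apply: Cexp_neq0.
rewrite Cmod_mult; have h2 := Cexp_lip h1.
have h3 : Cmod (Cexp (log_gen z)) <= exp G.
  rewrite Cmod_Cexp; apply: exp_le_compat.
  exact: Rle_trans (Rle_trans _ _ _ (Rle_abs _) (re_le_Cmod _)) (log_gen_bound hz).
have h4 : Cmod (Cexp (log_gen z)) * Cmod (Cexp (L - log_gen z) - 1) <= exp G * (6 * (r ^ N * G)).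
  by apply: Rmult_le_compat; try exact: Cmod_ge_0; lra.
have : 0 <= G * r ^ N by apply: Rmult_le_pos.
by nra.
Qed.

End Products.

Definition log_expansion (k : nat) (c : nat -> R) (A c0 s : R) := forall K, exists C0, forall z, 0 < Re z ->
  Cmod (log_gen k c z - (RtoC A / z + RtoC c0 + RtoC s * z)) <= C0 * (Cmod z ^ 2 / Re z) ^ K.+1.

Lemma phi_sum_log_gen k z : (0 < k)%N -> 0 < Re z -> Clim (phi_sum k z) (log_gen k (fun _ => 1) z).
Proof.
move=> k0 hz; have [l Hl] := phi_cv k0 hz.
have H : Clim (csum (fun m => RtoC 1 * (phi k (m.+1%:C * z) / m.+1%:C))%C) l.
  by apply: Clim_ext Hl => n; apply: csum_ext => m _; rewrite Cmult_1_l.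
by apply: Clim_ext (CLim_correct H) => n; apply: csum_ext => m _; rewrite Cmult_1_l.
Qed.

Lemma log_expansion_part k : (1 < k)%N -> exists A c0 s, 0 < A /\ log_expansion k (fun _ => 1) A c0 s.
Proof.
move=> k2; have k0 := ltnW k2; have [c0 H] := near_arc k0.
have kR : 2 <= INR k by apply: (le_INR 2); lia.
exists ((1 - / INR k) * zeta2), c0, (lin_coef k); split.
  apply: Rmult_lt_0_compat zeta2_pos.
  have : / INR k <= / 2 by apply: Rinv_le_contravar; lra.
  by lra.
move=> K; exists (2 * INR (fact K.+1) * INR k ^ K.+1 * zeta2) => z hz.
exact: (H z _ hz (phi_sum_log_gen k0 hz) K).
Qed.

(** The omitted even terms 2 phi (2 i z) / (2 i) add up to the sum at 2 z. *)
Lemma log_gen_odd k z : (1 < k)%N -> 0 < Re z ->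
  log_gen k odd_weight z = (2 * log_gen k (fun _ => 1) z - log_gen k (fun _ => 1) (2 * z))%C.
Proof.
move=> k2 hz; have k0 := ltnW k2.
have hw m : 0 <= odd_weight m <= 2 by rewrite /odd_weight; case: odd; lra.
have H := log_gen_lim k2 hw hz.
have hz2 : 0 < Re (2 * z) by rewrite Re_scal; lra.
have d n : (n <= 2 * n)%N by lia.
apply: (Clim_uniq (Clim_subseq d H)).
apply: Clim_ext (Clim_minus (Clim_scal 2 (Clim_subseq d (phi_sum_log_gen k0 hz))) (phi_sum_log_gen k0 hz2)) => n.
rewrite csum_odd_weight; congr Cminus; apply: csum_ext => i _.
have -> : (2 * i).+2 = (2 * i.+1)%N by lia.
rewrite mult_INR RtoC_mult (_ : INR 2 = 2) //.
rewrite (_ : (2 * INR i.+1 * z)%C = (INR i.+1 * (2 * z))%C); last ring.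
by field; apply: CINR_neq0.
Qed.

(** In 2 T(z) - T(2 z) the coefficient A becomes 2 A - A / 2, c0 is kept and s cancels. *)
Lemma log_expansion_over k : (1 < k)%N -> exists A c0 s, 0 < A /\ log_expansion k odd_weight A c0 s.
Proof.
move=> k2; have [A [c0 [s [A0 H]]]] := log_expansion_part k2.
exists (3 / 2 * A), c0, 0; split; first lra.
move=> K; have [C0 HC] := H K.
exists ((2 + 2 ^ K.+1) * C0) => z hz.
have hz2 : 0 < Re (2 * z) by rewrite Re_scal; lra.
have z0 := Re_pos_neq0 hz.
rewrite log_gen_odd // (_ : (_ - _)%C = (2 * (log_gen k (fun _ => 1) z - (RtoC A / z + RtoC c0 + RtoC s * z))
   - (log_gen k (fun _ => 1) (2 * z) - (RtoC A / (2 * z) + RtoC c0 + RtoC s * (2 * z))))%C); last first.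
  by rewrite RtoC_mult RtoC_div; [field | lra].
apply: Rle_trans (Cmod_triangle _ _) _; rewrite Cmod_opp Cmod_mult Cmod_R Rabs_pos_eq; last lra.
have h1 := HC z hz; have h2 := HC (2 * z)%C hz2.
rewrite Cmod_mult Cmod_R Rabs_pos_eq ?Re_scal in h2; last lra.
rewrite (_ : (2 * Cmod z) ^ 2 / (2 * Re z) = 2 * (Cmod z ^ 2 / Re z)) ?(Rpow_mult_distr 2) in h2; last by field; lra.
lra.
Qed.

(** * Coefficients of e^(A/(1-q)) *)

(* The coefficients of 1 / (1 - q)^j. *)
Fixpoint multiset_count (j n : nat) : R :=
  match j with
  | 0%N => if n == 0%N then 1 else 0
  | j'.+1 => rsum (multiset_count j') n.+1
  end.

Lemma multiset_count_S j n : multiset_count j.+1 n.+1 = multiset_count j.+1 n + multiset_count j n.+1.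
Proof. by rewrite /= [LHS]rsumS. Qed.

Lemma multiset_count_0 j : multiset_count j 0 = 1.
Proof. by elim: j => [|j IH] //=; rewrite rsumS rsum0 IH Rplus_0_l. Qed.

Lemma multiset_count_ge0 j n : 0 <= multiset_count j n.
Proof.
elim: j n => [|j IH] n /=; first by case: eqP; lra.
exact: rsum_ge0.
Qed.

Lemma multiset_count_le j n : multiset_count j n <= 2 ^ n * 2 ^ j.
Proof.
elim: j n => [|j IH] n.
  have h : 1 <= 2 ^ n by apply: pow_R1_Rle; lra.
  by rewrite /=; case: eqP; lra.
have p : 0 < 2 ^ j by apply: pow_lt; lra.
apply: Rle_trans (_ : (2 ^ n.+1 - 1) * 2 ^ j <= _); last by rewrite /=; lra.
elim: n => [|n IHn]; first by rewrite multiset_count_0 /= ; have := IH 0%N; rewrite multiset_count_0 /=; lra.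
by rewrite multiset_count_S; have := IH n.+1; rewrite (_ : 2 ^ n.+2 = 2 * 2 ^ n.+1) //; lra.
Qed.

Lemma multiset_count_ratio j n : INR n.+1 * multiset_count j n.+1 = (INR n + INR j) * multiset_count j n.
Proof.
elim: j n => [|j IH] n.
  by rewrite /=; case: n => [|n] /=; ring.
have h : INR j * multiset_count j.+1 n = (INR n + INR j) * multiset_count j n.
  elim: n => [|n IHn]; first by rewrite !multiset_count_0 /=; ring.
  by rewrite multiset_count_S Rmult_plus_distr_l IHn -IH; ring.
rewrite multiset_count_S Rmult_plus_distr_l IH -h !S_INR; ring.
Qed.

(** Coefficient of q^(n+1) in (1 - q)^2 F' = (j+1) (1 - q)^(-j) for F = (1 - q)^(-(j+1)). *)
Lemma multiset_count_rec j n :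
  INR n.+2 * multiset_count j.+1 n.+2 - 2 * INR n.+1 * multiset_count j.+1 n.+1 + INR n * multiset_count j.+1 n = INR j.+1 * multiset_count j n.+1.
Proof.
have h := multiset_count_ratio j n.+1.
rewrite (_ : multiset_count j.+1 n = multiset_count j.+1 n.+1 - multiset_count j n.+1); last by rewrite multiset_count_S; ring.
rewrite (multiset_count_S j n.+1) (Rmult_plus_distr_l (INR n.+2)) h !S_INR; ring.
Qed.

Lemma ex_series_exp x : 0 <= x -> ex_series (fun j => x ^ j / INR (fact j)).
Proof.
move=> hx; have pos j : 0 <= x ^ j / INR (fact j).
  by apply: Rdiv_le_0_compat; [apply: pow_le | apply: INR_fact_lt_0].
apply: (@ex_series_bounded _ (exp x)) => // n.
apply: Rle_trans (rsum_mono pos (leqnSn n)) _.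
rewrite -sum_n_rsum sum_n_Reals; exact: exp_ge_taylor.
Qed.

Section Laguerre.
Variable A : R.
Hypothesis A0 : 0 < A.

(** The sum over j is e^A times the Laguerre polynomial L_n^(-1) at - A. *)
Definition lag_term (n j : nat) : R := A ^ j / INR (fact j) * multiset_count j n.
(* [lag n] is the coefficient of q^n in exp (A / (1 - q)). *)
Definition lag (n : nat) : R := Series (lag_term n).

Lemma lag_term_ge0 n j : 0 <= lag_term n j.
Proof.
apply: Rmult_le_pos (multiset_count_ge0 _ _).
by apply: Rdiv_le_0_compat; [apply: pow_le; lra | apply: INR_fact_lt_0].
Qed.

Lemma ex_lag n : ex_series (lag_term n).
Proof.
apply: ex_series_dom (ex_series_scal (2 ^ n) _ (ex_series_exp (x := 2 * A) ltac:(lra))) => j.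
split; first exact: lag_term_ge0.
rewrite [scal _ _](_ : _ = 2 ^ n * ((2 * A) ^ j / INR (fact j))) // Rpow_mult_distr /lag_term.
have p : 0 <= A ^ j / INR (fact j).
  by apply: Rdiv_le_0_compat; [apply: pow_le; lra | apply: INR_fact_lt_0].
rewrite (_ : 2 ^ n * (2 ^ j * A ^ j / INR (fact j)) = A ^ j / INR (fact j) * (2 ^ n * 2 ^ j)); last by rewrite /Rdiv; ring.
by apply: Rmult_le_compat_l => //; apply: multiset_count_le.
Qed.

Lemma lag_pos n : 0 < lag n.
Proof.
apply: Rlt_le_trans (_ : lag_term n 1 <= _).
  rewrite /lag_term /= (_ : rsum _ _ = 1).
    by apply: Rmult_lt_0_compat; lra.
  by elim: n => [|n IH]; rewrite rsumS ?IH ?rsum0 /=; lra.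
apply: Rle_trans (rsum_le_Series 2 (lag_term_ge0 n) (ex_lag n)).
by rewrite !rsumS rsum0; have := lag_term_ge0 n 0; lra.
Qed.

(** Coefficient form of (1 - q)^2 F' = A F for F = e^(A/(1-q)): the recurrences [multiset_count_rec]
    are summed with weights A^(j+1) / (j+1)!, the term of index 0 contributing nothing. *)
Lemma lag_rec n : INR n.+2 * lag n.+2 = (2 * INR n.+1 + A) * lag n.+1 - INR n * lag n.
Proof.
have e : INR n.+2 * lag n.+2 - 2 * INR n.+1 * lag n.+1 + INR n * lag n = A * lag n.+1.
  rewrite -!Series_scal_l -Series_minus; try exact: (ex_series_scal_l _ _ (ex_lag _)).
  rewrite -Series_plus; try exact: (ex_series_scal_l _ _ (ex_lag _)); last first.
    by apply: ex_series_minus; exact: (ex_series_scal_l _ _ (ex_lag _)).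
  rewrite Series_incr_1; last first.
    apply: ex_series_plus; last exact: (ex_series_scal_l _ _ (ex_lag _)).
    by apply: ex_series_minus; exact: (ex_series_scal_l _ _ (ex_lag _)).
  have -> : INR n.+2 * lag_term n.+2 0 - 2 * INR n.+1 * lag_term n.+1 0 + INR n * lag_term n 0 = 0.
    rewrite /lag_term (_ : multiset_count 0 n.+2 = 0) // (_ : multiset_count 0 n.+1 = 0) //.
    have hB : INR n * multiset_count 0 n = 0 by case: (n) => [|m] /=; ring.
    set c := A ^ 0 / _; set b := multiset_count 0 n in hB *.
    rewrite (_ : INR n * (c * b) = c * (INR n * b)); last by ring.
    by rewrite hB; ring.
  rewrite Rplus_0_l; apply: Series_ext => j.
  have hf := INR_fact_lt_0 j; have hj := INR_S_pos j.
  have h := multiset_count_rec j n.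
  rewrite /lag_term (_ : fact j.+1 = Nat.mul j.+1 (fact j)) // mult_INR.
  rewrite (_ : A ^ j.+1 = A * A ^ j) //.
  rewrite (_ : A * (A ^ j / INR (fact j) * multiset_count j n.+1) =
    A * A ^ j / (INR j.+1 * INR (fact j)) * (INR j.+1 * multiset_count j n.+1)); last by field; lra.
  by rewrite -h; ring.
lra.
Qed.

End Laguerre.

(** * Comparison of coefficients *)

Lemma disk_series_1 : disk_series (fun _ => RtoC 1) (fun n => RtoC (multiset_count 0 n)).
Proof.
split=> [r hr|q hq].
  apply: (@ex_series_bounded _ 1) => [i|n].
    by apply: Rmult_le_pos (Cmod_ge_0 _) (pow_le _ _ _); lra.
  elim: n => [|n IH]; first by rewrite rsum0; lra.
  case: n IH => [|n] IH; first by rewrite rsumS rsum0 /= Cmod_1; lra.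
  by rewrite rsumS (_ : RtoC (multiset_count 0 n.+1) = 0) // Cmod_0 Rmult_0_l; lra.
apply: (@Clim_csum_eventually _ 1) => [i hi|].
  by case: i hi => [|i] //= _; rewrite Cmult_0_l.
by rewrite csumS csum0 /=; ring.
Qed.

Lemma disk_series_geom j : disk_series (fun q => (/ (1 - q)) ^ j)%C (fun n => RtoC (multiset_count j n)).
Proof.
elim: j => [|j IH]; first exact: disk_series_1.
apply: disk_series_ext (disk_series_div (N := 1) (b := fun n => RtoC (multiset_count j.+1 n)) _ IH _) => //.
  by move=> q hq; rewrite [(q ^ 1)%C](_ : _ = q) 1?Cpow_S /Cdiv; [ring | rewrite /=; ring].
move=> [|n]; rewrite /delay; first by rewrite !multiset_count_0 /=; ring.
by rewrite multiset_count_S RtoC_plus subn1 Cplus_comm.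
Qed.

Lemma disk_series_csum K (f : nat -> C -> C) (a : nat -> nat -> C) :
  (forall i, disk_series (f i) (a i)) ->
  disk_series (fun q => csum (fun i => f i q) K) (fun n => csum (fun i => a i n) K).
Proof.
move=> H; elim: K => [|K IH].
  apply: disk_series_ext (disk_series_scal 0 disk_series_1) => [q _|n]; rewrite csum0; ring.
by apply: disk_series_ext (disk_series_plus IH (H K)) => [q _|n]; rewrite csumS.
Qed.

(** Multiplication by 1 - q on coefficients; the sequence is continued by 0 before index 0. *)
Definition nabla (a : nat -> C) (n : nat) : C := (a n - delay 1 a n)%C.

Lemma disk_series_nabla i f a : disk_series f a ->
  disk_series (fun q => (1 - q) ^ i * f q)%C (iter i nabla a).
Proof.
move=> H; elim: i => [|i IH].
  by apply: disk_series_ext H => // q _; rewrite /=; ring.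
apply: disk_series_ext (disk_series_plus IH (disk_series_scal (- (1))%C (disk_series_delay 1 IH))) => [q _|n].
  by rewrite [((1 - q) ^ i.+1)%C]Cpow_S (_ : (q ^ 1)%C = q); [ring | rewrite /=; ring].
by rewrite iterS /nabla; ring.
Qed.

Lemma nabla_lim (u : nat -> nat -> C) v : (forall n, Clim (fun J => u J n) (v n)) ->
  forall i n, Clim (fun J => iter i nabla (u J) n) (iter i nabla v n).
Proof.
move=> H; elim=> [|i IH] n; first exact: H.
apply: Clim_minus; first exact: IH.
by rewrite /delay; case: ifP => _; [apply: IH | apply: Clim_const].
Qed.

Section Comparison.
Variables (k : nat) (c : nat -> R) (E : C -> C) (A c0 s : R) (a : nat -> R) (cf : nat -> nat -> C).
Hypothesis k2 : (1 < k)%N.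
Hypothesis c_bound : forall m, 0 <= c m <= 2.
Hypothesis c1 : 1 <= c 0%N.
Hypothesis HE : exp_factor c E.
Hypothesis A0 : 0 < A.
Hypothesis T_near : log_expansion k c A c0 s.
Hypothesis cf_series : forall N, disk_series (reg_prod k E N) (cf N).
Hypothesis cf_coef : forall N n, (n <= N)%N -> cf N n = RtoC (a n).

(** Cutting the exponential series at J leaves a finite combination of powers of 1 / (1 - q), within
    reach of the closure lemmas for [disk_series]. *)
Let lagJ J n : C := RtoC (rsum (lag_term A n) J).

Let lagJ_series J : disk_series (fun q => exp_poly J (RtoC A / (1 - q)))%C (lagJ J).
Proof.
apply: disk_series_ext (disk_series_csum J (fun j => disk_series_scal (RtoC (A ^ j / INR (fact j))) (disk_series_geom j))) => [q hq|n].
  apply: csum_ext => j _; have h := one_minus_neq0 hq.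
  rewrite RtoC_div; last exact: INR_fact_neq_0.
  rewrite RtoC_pow /Cdiv Cpow_mult_l.
  by field; apply: fact_neq0.
rewrite /lagJ -csum_RtoC; apply: csum_ext => j _.
by rewrite -RtoC_mult.
Qed.

Let lagJ_lim n : Clim (fun J => lagJ J n) (RtoC (lag A n)).
Proof.
apply: Clim_RtoC; exact: (proj1 (is_series_rsum _ _) (Series_correct _ (ex_lag A0 n))).
Qed.

Let exp_poly_cv x (d : nat -> C) K eps : 0 < x -> 0 < eps -> eventually (fun J => forall y,
  Cmod ((Cexp (RtoC A / uvar (x, y)) - exp_poly J (RtoC A / uvar (x, y))) * csum (fun i => d i * uvar (x, y) ^ i) K)%C <= eps).
Proof.
move=> x0 e0; set X := A * (/ x + 1).
have X0 : 0 <= X by apply: Rmult_le_pos; [lra | have := Rinv_0_lt_compat _ x0; lra].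
set S := rsum (fun i => Cmod (d i) * 2 ^ i) K.
have S0 : 0 <= S by apply: rsum_ge0 => i; apply: Rmult_le_pos (Cmod_ge_0 _) (pow_le _ _ _); lra.
have lim : is_lim_seq (fun J => S * exp X * ((2 * X) ^ J / INR (fact J))) 0.
  apply: lim0_scal; apply/is_lim_seq_Reals; exact: cv_speed_pow_fact.
move/is_lim_seq_spec: lim => /(_ (mkposreal _ e0)); apply: filter_imp => J /=.
rewrite Rminus_0_r => /(Rle_lt_trans _ _ _ (Rle_abs _)) h y.
have hz : 0 < Re (x, y) by [].
have u0 : uvar (x, y) <> 0 by apply: one_minus_neq0; apply: Cexp_neg_lt1.
have hw : Cmod (RtoC A / uvar (x, y)) <= X.
  rewrite Cmod_div // Cmod_R Rabs_pos_eq; last lra.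
  by apply: Rmult_le_compat_l; [lra | apply: u_ge_x].
have u2 := uvar_le2 hz.
rewrite Cmod_mult; have h1 := @csum_pow_le d K _ u2; rewrite -/S in h1.
have h2 := Cexp_taylor_fact J (RtoC A / uvar (x, y)).
apply: Rle_trans (_ : (exp X * ((2 * X) ^ J / INR (fact J))) * S <= _); last lra.
apply: Rmult_le_compat => //; try exact: Cmod_ge_0.
apply: Rle_trans h2 _; rewrite Rpow_mult_distr.
have hf := INR_fact_lt_0 J.
rewrite (_ : exp X * (2 ^ J * X ^ J / INR (fact J)) = 2 ^ J * exp X * (X ^ J / INR (fact J))); last by rewrite /Rdiv; ring.
have p2 : 0 <= 2 ^ J by apply: pow_le; lra.
apply: Rmult_le_compat.
- by apply: Rmult_le_pos => //; apply/Rlt_le/exp_pos.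
- by apply: Rdiv_le_0_compat => //; apply: pow_le; apply: Cmod_ge_0.
- by apply: Rmult_le_compat_l => //; apply: exp_le_compat.
- apply: Rmult_le_compat_r; first by apply/Rlt_le/Rinv_0_lt_compat.
  by apply: pow_incr; split=> //; apply: Cmod_ge_0.
Qed.

(** Cauchy's estimate is applied to the product cut at N and the exponential cut at J. The
    coefficient of the cut product is exact since n <= N; both cuts cost at most eps / 2 uniformly
    on the circle, and J tends to infinity for fixed eps. *)
Lemma comparison K : (0 < K)%N -> exists (d : nat -> C) (C0 x0 : R), [/\ 0 < x0, 0 < Re (d 0%N) &
  forall x n, 0 < x < x0 ->
  Cmod (RtoC (a n) - csum (fun i => d i * iter i nabla (fun m => RtoC (lag A m)) n) K)%C * exp (- x) ^ n
    <= C0 * x ^ K * exp (A / x)].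
Proof.
move=> K0.
have T_lim := fun z hz => log_gen_lim k2 c_bound (z := z) hz.
have [d [C0 [x0 [x0p d0 H]]]] := arcs_bound k2 (fun m => proj1 (c_bound m)) c1 T_lim A0 T_near K0.
exists d, C0, x0; split=> // x n hx; have xp := proj1 hx.
set r := exp (- x); have rp : 0 < r ^ n by apply: pow_lt; apply: exp_pos.
apply: le_epsilon => eps e0; have e2 : 0 < eps / 2 by lra.
have [N0 HN0] := reg_prod_cv k2 c_bound HE xp e2.
set N := (k * maxn N0 n)%N.
have nN : (n <= N)%N by rewrite /N; have := leq_maxr N0 n; nia.
have bJ J := disk_series_csum K (fun i => disk_series_scal (d i) (disk_series_nabla i (lagJ_series J))).
have DJ J := disk_series_plus (cf_series N) (disk_series_scal (- (1))%C (bJ J)).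
have est : eventually (fun J => Cmod (RtoC (a n) - csum (fun i => d i * iter i nabla (lagJ J) n) K)%C <=
    (C0 * x ^ K * exp (A / x) + eps) / r ^ n).
  apply: filter_imp (exp_poly_cv d K xp e2) => J HJ.
  apply/Rle_div_r => //.
  have := @cauchy_estimate _ _ x (C0 * x ^ K * exp (A / x) + eps) n xp (DJ J).
  rewrite cf_coef // -/r (_ : (RtoC (a n) + _)%C = (RtoC (a n) - csum (fun i => d i * iter i nabla (lagJ J) n) K)%C); last ring.
  apply=> y hy; set q := Cexp (- (x, y)).
  have e : (1 - q)%C = uvar (x, y) by [].
  have h1 := H x y hx hy; have h2 := HJ y.
  have h3 := HN0 (maxn N0 n) y (leq_maxl _ _); rewrite -/N -/q in h3.
  rewrite (csum_ext (g := fun i => (exp_poly J (RtoC A / uvar (x, y)) * (d i * uvar (x, y) ^ i))%C)); last first.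
    by move=> i _; rewrite e; ring.
  rewrite csum_scal; set P := csum _ _ in h1 h2 *; set W := Cexp (RtoC A / _) in h1 h2.
  set V := exp_poly _ _ in h2 *; set T := Cexp (log_gen _ _ _) in h1 h3.
  rewrite (_ : (reg_prod k E N q + - (1) * (V * P))%C = ((reg_prod k E N q - T) + ((T - W * P) + (W - V) * P))%C); last ring.
  apply: Rle_trans (Cmod_triangle _ _) _.
  have := Cmod_triangle (T - W * P) ((W - V) * P); lra.
have lim : Clim (fun J => RtoC (a n) - csum (fun i => d i * iter i nabla (lagJ J) n) K)%C
   (RtoC (a n) - csum (fun i => d i * iter i nabla (fun m => RtoC (lag A m)) n) K)%C.
  apply: Clim_minus (Clim_const _) _; apply: Clim_csum_inner => i _.
  by apply: Clim_scal; apply: nabla_lim.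
by have /Rle_div_r := Clim_le est lim; apply.
Qed.

End Comparison.

(** * Ratios of consecutive coefficients *)

(* t = tv n = n^(-1/2), w = wv n = t_(n+1) / t_n and q = qv n satisfy 1 - w = t^2 q,
   which makes the expansions in powers of t stable under the shift n -> n + 1. *)
Definition tR (n : nat) : R := / sqrt (INR n).
Definition tv (n : nat) : C := RtoC (tR n).
Definition wv (n : nat) : C := RtoC (sqrt (INR n / INR n.+1)).
Definition qv (n : nat) : C := (wv n * wv n / (1 + wv n))%C.
Local Notation EV := (eventually : (nat -> Prop) -> Prop).
Lemma ev_filter : Filter EV.
Proof. exact: filter_filter. Qed.
Local Notation EF := ev_filter.
Local Notation X := (expands EV tv).

Lemma ev_pos : EV (fun n => (0 < n)%N).
Proof. by exists 1%N => n /leP. Qed.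

Lemma tR_pos n : (0 < n)%N -> 0 < tR n.
Proof. by move=> h; apply/Rinv_0_lt_compat/sqrt_lt_R0/lt_0_INR; lia. Qed.

Lemma tR_sq n : (0 < n)%N -> tR n * tR n = / INR n.
Proof.
move=> h; have hn : 0 < INR n by apply: lt_0_INR; lia.
by rewrite /tR -Rinv_mult sqrt_sqrt; lra.
Qed.

Lemma tR_lim : is_lim_seq tR 0.
Proof.
have h1 : is_lim_seq (fun n => sqrt (INR n)) p_infty.
  exact: (filterlim_comp _ _ _ INR sqrt _ _ _ is_lim_seq_INR filterlim_sqrt_p).
by have := is_lim_seq_inv _ _ h1 => /(_ ltac:(by [])).
Qed.

Lemma tv_lim0 eps : 0 < eps -> EV (fun n => Cmod (tv n) < eps).
Proof.
move=> h; have /is_lim_seq_spec/(_ (mkposreal _ h)) := tR_lim; apply: filter_imp => n /=.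
by rewrite Rminus_0_r Cmod_R.
Qed.

Lemma tv_neq0 : EV (fun n => tv n <> 0).
Proof. by apply: filter_imp ev_pos => n /tR_pos h; apply: RtoC_neq0; lra. Qed.

Lemma wR_bound n : 0 <= sqrt (INR n / INR n.+1) <= 1.
Proof.
split; first exact: sqrt_pos.
rewrite -[X in _ <= X]sqrt_1; apply: sqrt_le_1_alt; apply/Rle_div_l; first exact: INR_S_pos.
by rewrite S_INR; lra.
Qed.

Lemma tR_S n : (0 < n)%N -> tR n.+1 = tR n * sqrt (INR n / INR n.+1).
Proof.
move=> h; have hn : 0 < INR n by apply: lt_0_INR; lia.
have h1 := INR_S_pos n; rewrite /tR sqrt_div ?Rinv_r //; last lra.
have := sqrt_lt_R0 _ hn; have := sqrt_lt_R0 _ h1 => *.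
by field; lra.
Qed.

Lemma tv_S n : (0 < n)%N -> tv n.+1 = (tv n * wv n)%C.
Proof. by move=> h; rewrite /tv tR_S // RtoC_mult. Qed.

(** Here 1 - w^2 = 1 / (n+1) = t^2 w^2, to be divided by 1 + w. *)
Lemma wv_eq n : (0 < n)%N -> wv n = (1 - tv n * tv n * qv n)%C.
Proof.
move=> h; have hn : 0 < INR n by apply: lt_0_INR; lia.
have h1 := INR_S_pos n.
have e : (wv n * wv n)%C = RtoC (INR n / INR n.+1).
  by rewrite /wv -RtoC_mult sqrt_sqrt //; apply/Rlt_le/Rdiv_lt_0_compat.
have e2 : (tv n * tv n)%C = RtoC (/ INR n) by rewrite /tv -RtoC_mult tR_sq.
have w1 : (1 + wv n)%C <> 0.
  by rewrite /wv -RtoC_plus; apply: RtoC_neq0; have := wR_bound n; lra.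
have e3 : (1 - wv n * wv n)%C = (tv n * tv n * (wv n * wv n))%C.
  rewrite e e2 -RtoC_mult -RtoC_minus; congr RtoC; rewrite S_INR; field; rewrite -S_INR; lra.
rewrite /qv (_ : (tv n * tv n * (wv n * wv n / (1 + wv n)))%C = (tv n * tv n * (wv n * wv n) / (1 + wv n))%C); last by field.
by rewrite -e3; field.
Qed.

Lemma X_inv1w J : X J wv -> X J (fun n => / (1 + wv n))%C.
Proof.
move=> H; have h1 : 0 < 1 by lra.
have h2 : EV (fun n => 1 <= Cmod (1 + wv n)).
  apply: filter_forall => n; rewrite /wv -RtoC_plus Cmod_R.
  by have := wR_bound n => ?; rewrite Rabs_pos_eq; lra.
exact: (expands_inv EF tv_lim0 h1 h2 (expands_plus EF (expands_const EF tv J 1) H)).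
Qed.

Lemma X_qv_aux J : X J wv -> X J qv.
Proof.
move=> H; apply: (expands_mult EF tv_lim0); last exact: X_inv1w.
exact: (expands_mult EF tv_lim0).
Qed.

(** Bootstrapping through w = 1 - t (t q): an expansion of w to order J gives one of q = w^2 / (1 +
    w), hence one of w to order J + 1. *)
Lemma X_wv J : X J wv.
Proof.
elim: J => [|J IH].
  exists 1; apply: filter_forall => n; rewrite /wv Cmod_R.
  by have := wR_bound n => ?; rewrite Rabs_pos_eq; lra.
exists 1, (fun n => - (tv n * qv n))%C; split.
  by apply: filter_imp ev_pos => n /wv_eq {1}->; ring.
apply: (expands_opp EF); apply: (expands_mult EF tv_lim0); first exact: (expands_v EF tv_lim0).
exact: X_qv_aux.
Qed.

Lemma X_qv J : X J qv. Proof. exact/X_qv_aux/X_wv. Qed.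

Lemma ev_S (P : nat -> Prop) : EV P -> EV (fun n => P n.+1).
Proof. by move=> [N HN]; exists N => n hn; apply: HN; lia. Qed.

Lemma X_shift J f : X J f -> X J (fun n => f n.+1).
Proof.
elim: J f => [|J IH] f.
  by move=> [M HM]; exists M; exact: (ev_S HM).
move=> [c [g [Hf /IH Xg]]]; exists c, (fun n => wv n * g n.+1)%C; split.
  apply: filter_imp (filter_and _ _ ev_pos (ev_S Hf)) => n [h ->].
  by rewrite tv_S //; ring.
exact: (expands_mult EF tv_lim0) (X_wv J) Xg.
Qed.

(* The one-step recurrence for the ratios [rho n = lag n.+1 / lag n], divided by [n],
   reads [ratio_defect rho n = 0]. *)
Definition ratio_defect (A : R) (p : nat -> C) (n : nat) : C :=
  ((1 + 2 * (tv n * tv n)) * (p n.+1 * p n) - (2 + (2 + A) * (tv n * tv n)) * p n + 1)%C.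

Ltac expands_tac := repeat first
  [ apply: (expands_const EF) | apply: (expands_v EF tv_lim0) | apply: X_wv | apply: X_qv | assumption
  | apply: (expands_minus EF) | apply: (expands_opp EF) | apply: (expands_plus EF)
  | apply: (expands_pow EF tv_lim0) | apply: (expands_mult EF tv_lim0) | apply: X_shift ].

(** * Formal solution of the recurrence for the ratios *)

Section RatioExpansion.
Variables (A alpha : R).
Hypothesis alpha_pos : 0 < alpha.
Hypothesis alphaA : alpha * alpha = A.

Lemma pow_wv J : exists e : nat -> C, (forall L, X L e) /\
  EV (fun n => (wv n ^ J)%C = (1 - tv n * tv n * e n)%C).
Proof.
elim: J => [|J [e [He H]]].
  exists (fun _ => 0); split; first by move=> L; apply: (expands_const EF).
  by apply: filter_forall => n; rewrite /=; ring.
exists (fun n => wv n * e n + qv n)%C; split; first by move=> L; have := He L => ?; expands_tac.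
apply: filter_imp (filter_and _ _ ev_pos H) => n [h1 h2].
rewrite Cpow_S h2 (_ : (wv n * (1 - tv n * tv n * e n))%C = (wv n - tv n * tv n * (wv n * e n))%C); last ring.
by rewrite {1}(wv_eq h1); ring.
Qed.

(** To leading order the defect is (p - 1)^2 - A t^2, which forces alpha^2 = A. *)
Definition approx (h : nat -> C) (n : nat) : C := (1 + alpha * tv n + tv n * tv n * h n)%C.

(** Adding c t^(J+2) to p changes the defect by 2 alpha c t^(J+3) to leading order, since p_n +
    p_(n+1) - 2 starts with 2 alpha t; c = - d / (2 alpha) thus cancels the leading defect d
    t^(J+3). As h is a polynomial in t, it expands to every order. *)
Lemma ratio_approx J L : exists h g : nat -> C, [/\ forall L', X L' h, X L g &
  EV (fun n => ratio_defect A (approx h) n = (tv n ^ (J + 3) * g n)%C)].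
Proof.
elim: J L => [|J IH] L.
  exists (fun _ => 0), (fun n => - (alpha * qv n) - A * tv n * qv n + 2 * alpha + 2 * alpha * wv n
     + 2 * A * tv n * wv n - (2 + A) * alpha)%C; split.
  - by move=> L'; apply: (expands_const EF).
  - by expands_tac.
  apply: filter_imp ev_pos => n hn.
  rewrite /ratio_defect /approx (tv_S hn) -alphaA RtoC_mult.
  have e := wv_eq hn; set t := tv n in e *; set w := wv n in e *; set q := qv n in e *.
  rewrite (_ : (t ^ (0 + 3))%C = (t * t * t)%C); last by rewrite /=; ring.
  transitivity (alpha * (t * (w - 1)) + alpha * alpha * (t * t) * w + 2 * (t * t) * (1 + alpha * t) * (1 + alpha * (t * w)) - (2 + alpha * alpha) * (t * t) * (1 + alpha * t))%C.
    by ring.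
  rewrite {1}e (_ : (alpha * alpha * (t * t) * w = alpha * alpha * (t * t) * (1 - t * t * q))%C); last by rewrite {1}e.
  by ring.
have [h [g [Hh [d [g1 [Hg Xg1]]] Hd]]] := IH L.+1.
have [e [He Hw]] := pow_wv (J + 2).
pose c := (- (d / (2 * alpha)))%C.
pose p := approx h.
have Xh L' := Hh L'; have Xe L' := He L'.
have Xp L' : X L' p by have := Xh L' => ?; rewrite /p /approx; expands_tac.
pose W n := (wv n ^ (J + 2))%C.
have XW L' : X L' W by rewrite /W; expands_tac.
pose sg n := (- (alpha * tv n * qv n) + wv n * wv n * h n.+1 + h n - e n * p n
  + 2 * (p n.+1 + p n * W n + c * (tv n * tv n * tv n ^ J) * W n) + c * tv n ^ J * W n - (2 + A))%C.
exists (fun n => h n + c * tv n ^ J)%C, (fun n => g1 n + c * sg n)%C; split.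
- by move=> L'; have := Xh L' => ?; expands_tac.
- by have := Xh L => ?; have := Xe L => ?; have := Xp L => ?; have := XW L => ?; rewrite /sg; expands_tac.
apply: filter_imp (filter_and _ _ ev_pos (filter_and _ _ Hw (filter_and _ _ Hg Hd))).
move=> n [hn [hW [hg hd]]].
have ca : RtoC alpha <> 0 by apply: RtoC_neq0; lra.
have hc : (c * (2 * alpha) = - d)%C by rewrite /c; field.
have ew := wv_eq hn.
have e1 : approx (fun n => h n + c * tv n ^ J)%C n = (p n + tv n * tv n * tv n ^ J * c)%C.
  by rewrite /p /approx; ring.
have eW : W n = (wv n * wv n * wv n ^ J)%C by rewrite /W addnC /= Cmult_assoc.
have e2 : approx (fun n => h n + c * tv n ^ J)%C n.+1 = (p n.+1 + tv n * tv n * tv n ^ J * W n * c)%C.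
  by rewrite /p /approx eW (tv_S hn) Cpow_mult_l; ring.
have e3 : p n = (1 + alpha * tv n + tv n * tv n * h n)%C by [].
have e4 : p n.+1 = (1 + alpha * (tv n * wv n) + tv n * wv n * (tv n * wv n) * h n.+1)%C.
  by rewrite /p /approx (tv_S hn).
rewrite /W in hW *.
rewrite (_ : (tv n ^ (J.+1 + 3) = tv n * tv n * tv n * tv n * tv n ^ J)%C); last first.
  by rewrite addnC /= ?add0n; ring.
rewrite (_ : (tv n ^ (J + 3) = tv n * tv n * tv n * tv n ^ J)%C) in hd; last first.
  by rewrite addnC /= add0n; ring.
rewrite -/p hg in hd.
move: hd; rewrite /ratio_defect e1 e2 /sg -/(W n) -/(W n) in hW *.
move: hW; rewrite -/(W n); move: (W n) (tv n) (tv n ^ J)%C (wv n) (qv n) (e n) (h n) (h n.+1) (g1 n) (p n) (p n.+1) ew e3 e4.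
move=> w' t P w q E hn0 hn1 gn pn pn1 ew e3 e4 hW hd.
transitivity ((1 + 2 * (t * t)) * (pn1 * pn) - (2 + (2 + A) * (t * t)) * pn + 1
   + t * t * P * c * ((1 + 2 * (t * t)) * (pn1 + pn * w' + c * (t * t * P) * w') - 2 - (2 + A) * (t * t)))%C.
  by ring.
rewrite hd.
have -> : ((1 + 2 * (t * t)) * (pn1 + pn * w' + c * (t * t * P) * w') - 2 - (2 + A) * (t * t) =
  2 * alpha * t + t * t * (- (alpha * t * q) + w * w * hn1 + hn0 - E * pn + 2 * (pn1 + pn * w' + c * (t * t * P) * w') + c * P * w' - (2 + A)))%C.
  transitivity (pn1 + pn * w' - 2 + t * t * (2 * (pn1 + pn * w' + c * (t * t * P) * w') + c * P * w' - (2 + A)))%C; first ring.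
  have -> : (pn1 + pn * w' - 2 = 2 * alpha * t + t * t * (- (alpha * t * q) + w * w * hn1 + hn0 - E * pn))%C.
    rewrite hW (_ : (pn1 + pn * (1 - t * t * E) - 2 = (pn1 - 1) + (pn - 1) - t * t * (E * pn))%C); last by ring.
    have -> : (pn1 - 1 = alpha * t - alpha * t * t * t * q + t * t * w * w * hn1)%C.
      by rewrite e4 {1}ew; ring.
    have -> : (pn - 1 = alpha * t + t * t * hn0)%C by rewrite e3; ring.
    by ring.
  by ring.
move: (- (alpha * t * q) + _ + _ - _ + _ + _ - _)%C => sig.
transitivity (t * t * t * P * (d + c * (2 * alpha)) + t * t * t * t * P * (gn + c * sig))%C; first ring.
by rewrite hc; ring.
Qed.

End RatioExpansion.

Lemma bernoulli_neg s J : 0 <= s <= 1 -> 1 - INR J * s <= (1 - s) ^ J.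
Proof.
move=> hs; elim: J => [|J IH]; first by rewrite /=; lra.
rewrite S_INR [(1 - s) ^ J.+1]/=.
have := pos_INR J => hJ.
have : (1 - s) * (1 - INR J * s) <= (1 - s) * (1 - s) ^ J by apply: Rmult_le_compat_l; lra.
have : 0 <= INR J * (s * s) by apply: Rmult_le_pos => //; nra.
lra.
Qed.

Lemma tR_pow_S J n : (0 < n)%N -> tR n ^ J * (1 - INR J * (tR n * tR n)) <= tR n.+1 ^ J.
Proof.
move=> hn; have tp := tR_pos hn; have h0 : 1 <= INR n by apply: (le_INR 1); lia.
rewrite tR_S // Rpow_mult_distr; apply: Rmult_le_compat_l; first by apply: pow_le; lra.
rewrite tR_sq //.
have hi : 0 <= / INR n <= 1.
  split; first by apply/Rlt_le/Rinv_0_lt_compat; lra.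
  by rewrite -[X in _ <= X]Rinv_1; apply: Rinv_le_contravar; lra.
apply: Rle_trans (bernoulli_neg J hi) _; apply: pow_incr; split; first lra.
have hx : 0 < INR n / INR n.+1 by apply: Rdiv_lt_0_compat; [lra | apply: INR_S_pos].
have hx2 : 1 - / INR n <= INR n / INR n.+1.
  rewrite S_INR (_ : INR n / (INR n + 1) = 1 - / (INR n + 1)); last by field; lra.
  have : / (INR n + 1) <= / INR n by apply: Rinv_le_contravar; lra.
  lra.
apply: Rle_trans hx2 _.
have := wR_bound n; have := sqrt_sqrt _ (Rlt_le _ _ hx).
set y := sqrt _; nra.
Qed.

Lemma tR_small eps : 0 < eps -> EV (fun n => tR n <= eps).
Proof.
move=> h; apply: filter_imp (tv_lim0 h) => n; rewrite Cmod_R.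
have := Rle_abs (tR n); lra.
Qed.

(** One step shrinks t^J only by a factor 1 - O(t^2), weaker than 1 - a t: half of a t pays for that
    loss, the other half for C t^(J+1) as soon as B >= 2 |C| / a. *)
Lemma contraction (e : nat -> R) a C J : 0 < a -> (forall n, 0 <= e n) ->
  EV (fun n => e n.+1 <= (1 - a * tR n) * e n + C * tR n ^ J.+1) ->
  exists B, EV (fun n => e n <= B * tR n ^ J).
Proof.
move=> a0 he H.
have hJ : 0 < INR J + 1 by have := pos_INR J; lra.
have e1 : 0 < a / (2 * (INR J + 1)) by apply: Rdiv_lt_0_compat; lra.
have e2 : 0 < / a by apply: Rinv_0_lt_compat.
have [N HN] := filter_and _ _ ev_pos (filter_and _ _ H (filter_and _ _ (tR_small e1) (tR_small e2))).
have tN : 0 < tR N ^ J by apply: pow_lt; apply: tR_pos; case: (HN N (le_n _)).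
pose B := 2 * Rabs C / a + e N / tR N ^ J.
have B1 : 2 * Rabs C / a <= B.
  suff : 0 <= e N / tR N ^ J by rewrite /B; lra.
  by apply: Rdiv_le_0_compat.
have B0 : 0 <= B.
  by apply: Rle_trans B1; apply: Rdiv_le_0_compat => //; have := Rabs_pos C; lra.
exists B; exists N => n /leP /subnKC <-; elim: (n - N)%N => [|d IH].
  rewrite addn0; suff : e N / tR N ^ J <= B by move/Rle_div_l; apply; apply: Rlt_gt.
  suff : 0 <= 2 * Rabs C / a by rewrite /B; lra.
  by apply: Rdiv_le_0_compat => //; have := Rabs_pos C; lra.
rewrite addnS; set m := (N + d)%N in IH *.
have [hm [h1 [h2 h3]]] := HN m ltac:(rewrite /m; lia).
have tp := tR_pos hm; set t := tR m in IH h1 h2 h3 tp *.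
have tJ : 0 < t ^ J by apply: pow_lt.
have h4 := tR_pow_S J hm; rewrite -/t in h4.
have at1 : a * t <= 1.
  have : a * t <= a * / a by apply: Rmult_le_compat_l; lra.
  by rewrite Rinv_r; lra.
have s1 : (1 - a * t) * e m <= (1 - a * t) * (B * t ^ J) by apply: Rmult_le_compat_l; lra.
have s2 : C * t ^ J.+1 <= (a * B / 2) * (t * t ^ J).
  rewrite [t ^ J.+1]/=; apply: Rmult_le_compat_r; first by nra.
  apply: Rle_trans (Rle_abs C) _; rewrite (_ : Rabs C = a * (2 * Rabs C / a) / 2); last by field; lra.
  have : a * (2 * Rabs C / a) <= a * B by apply: Rmult_le_compat_l; lra.
  lra.
have s3 : INR J * (t * t) <= a * t / 2.
  have : t * (INR J + 1) <= a / (2 * (INR J + 1)) * (INR J + 1) by apply: Rmult_le_compat_r; lra.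
  rewrite (_ : a / (2 * (INR J + 1)) * (INR J + 1) = a / 2); last by field; lra.
  by nra.
apply: Rle_trans (_ : B * (t ^ J * (1 - INR J * (t * t))) <= _); last by apply: Rmult_le_compat_l.
have p : 0 <= B * t ^ J by apply: Rmult_le_pos; lra.
have : B * t ^ J * (INR J * (t * t)) <= B * t ^ J * (a * t / 2) by apply: Rmult_le_compat_l.
lra.
Qed.

(** * Ratios and growth of the coefficients l_n *)

Section LaguerreRatio.
Variables (A alpha : R).
Hypothesis alpha_pos : 0 < alpha.
Hypothesis alphaA : alpha * alpha = A.
Let A0 : 0 < A. Proof. by rewrite -alphaA; nra. Qed.
Let lag_gt0 n := lag_pos A0 n.

Definition rho (n : nat) : R := lag A n.+1 / lag A n.

Lemma lag_S n : lag A n.+1 = rho n * lag A n.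
Proof. by rewrite /rho; field; apply: Rgt_not_eq. Qed.

(** By [lag_rec], (n+2) (l_(n+2) - l_(n+1)) = n (l_(n+1) - l_n) + A l_(n+1), so monotonicity
    propagates. Index 0 is left out: [rho 0] equals A, which may be below 1. *)
Lemma rho_ge1 n : 1 <= rho n.+1.
Proof.
have h := @lag_gt0 n.+1; apply/Rle_div_r => //; rewrite Rmult_1_l.
have pN m := INR_S_pos m.
elim: n {h} => [|n IH].
  have := lag_rec A0 0; rewrite /= => h; have := @lag_gt0 1; nra.
have := lag_rec A0 n.+1; have := pN n; have := pN n.+1; have := @lag_gt0 n.+2.
rewrite [INR n.+3]S_INR [INR n.+2]S_INR => *.
nra.
Qed.

Let rhoC n : C := RtoC (rho n).

Lemma rho_defect n : (0 < n)%N -> ratio_defect A rhoC n = 0.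
Proof.
move=> hn; have hn0 : 0 < INR n by apply: lt_0_INR; lia.
have h := lag_rec A0 n; have l1 := @lag_gt0 n; have l2 := @lag_gt0 n.+1.
rewrite /ratio_defect /rhoC /tv -!RtoC_mult tR_sq // -!(RtoC_plus, RtoC_mult, RtoC_minus).
congr RtoC; rewrite /rho.
have e : lag A n.+2 = ((2 * INR n.+1 + A) * lag A n.+1 - INR n * lag A n) / INR n.+2.
  by rewrite -h; field; have := INR_S_pos n.+1; lra.
rewrite e; move: (INR_S_pos n.+1); rewrite !S_INR => hh.
by field; do ?split; lra.
Qed.

(** Subtracting the recurrences gives a linear one for the error, with factor 1 - alpha t + O(t^2)
    and forcing O(t^(J+3)); dividing by (1 + 2 t^2) rho >= 1 only helps. Halving alpha absorbs the
    O(t^2), and [contraction] applies. *)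
Lemma rho_near J : exists h : nat -> C, (forall L, X L h) /\
  exists B, EV (fun n => Cmod (rhoC n - approx alpha h n) <= B * tR n ^ (J + 2)).
Proof.
have [h [g [Hh Xg Hd]]] := ratio_approx alpha_pos alphaA J 0.
exists h; split=> //.
have [M [psi_b]] : exists M, 0 <= M /\ EV (fun n => Cmod ((2 + A) - 2 * approx alpha h n.+1 - wv n * wv n * h n.+1 + alpha * tv n * qv n) <= M).
  have X0 : X 0 (fun n => (2 + A) - 2 * approx alpha h n.+1 - wv n * wv n * h n.+1 + alpha * tv n * qv n)%C.
    have h0 := Hh 0%N; have ha : X 0 (approx alpha h) by rewrite /approx; expands_tac.
    by expands_tac.
  have [M HM] := X0; exists (Rabs M); split; first exact: Rabs_pos.
  by apply: filter_imp HM => n; have := Rle_abs M; lra.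
move=> Hpsi.
have [G HG] := Xg.
apply: (@contraction _ (alpha / 2) (Rabs G)); first lra.
  by move=> n; apply: Cmod_ge_0.
have e1 : 0 < / alpha by apply: Rinv_0_lt_compat.
have e2 : 0 < alpha / (2 * (M + 1)) by apply: Rdiv_lt_0_compat; lra.
have pos2 : EV (fun n => (1 < n)%N) by exists 2%N => n /leP.
apply: filter_imp (filter_and _ _ pos2 (filter_and _ _ (filter_and _ _ Hpsi HG) (filter_and _ _ Hd (filter_and _ _ (tR_small e1) (tR_small e2))))).
move=> n [hn [[hpsi hG] [hd [t1 t2]]]].
have hn0 : (0 < n)%N by apply: ltn_trans hn.
have tp := tR_pos hn0.
have hr := rho_defect hn0.
set p := approx alpha h in hpsi hd *.
have r1 : 1 <= rho n by case: (n) hn => [//|m] _; apply: rho_ge1.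
have ew := wv_eq hn0.
have e4 : p n.+1 = (1 + alpha * (tv n * wv n) + tv n * wv n * (tv n * wv n) * h n.+1)%C.
  by rewrite /p /approx (tv_S hn0).
have rel : ((1 + 2 * (tv n * tv n)) * rhoC n * (rhoC n.+1 - p n.+1) =
   (1 - alpha * tv n + tv n * tv n * ((2 + A) - 2 * p n.+1 - wv n * wv n * h n.+1 + alpha * tv n * qv n)) * (rhoC n - p n) - tv n ^ (J + 3) * g n)%C.
  transitivity ((1 + 2 * (tv n * tv n)) * rhoC n * (rhoC n.+1 - p n.+1) - ratio_defect A rhoC n)%C.
    by rewrite hr; ring.
  rewrite -hd /ratio_defect.
  have -> : (1 - alpha * tv n + tv n * tv n * ((2 + A) - 2 * p n.+1 - wv n * wv n * h n.+1 + alpha * tv n * qv n)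
    = 2 + (2 + A) * (tv n * tv n) - (1 + 2 * (tv n * tv n)) * p n.+1)%C.
    transitivity (2 + (2 + A) * (tv n * tv n) - 2 * (tv n * tv n) * p n.+1 -
      (1 + alpha * (tv n * (1 - tv n * tv n * qv n)) + tv n * wv n * (tv n * wv n) * h n.+1))%C; first ring.
    by rewrite -ew -e4; ring.
  by ring.
have ta : alpha * tR n <= 1.
  have : alpha * tR n <= alpha * / alpha by apply: Rmult_le_compat_l; lra.
  by rewrite Rinv_r; lra.
set psi := (2 + A - _ - _ + _)%C in hpsi rel.
have b1 : Cmod (1 - alpha * tv n + tv n * tv n * psi) <= 1 - alpha / 2 * tR n.
  have := Cmod_triangle (RtoC (1 - alpha * tR n)) (RtoC (tR n * tR n) * psi).
  rewrite Cmod_mult !Cmod_R !Rabs_pos_eq; [|nra|lra].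
  rewrite RtoC_minus !RtoC_mult -/(tv n) => h1; apply: Rle_trans h1 _.
  have h2 : tR n * tR n * Cmod psi <= tR n * (alpha / (2 * (M + 1)) * (M + 1)).
    rewrite Rmult_assoc; apply: Rmult_le_compat_l; first lra.
    by apply: Rmult_le_compat; try lra; apply: Cmod_ge_0.
  rewrite (_ : alpha / (2 * (M + 1)) * (M + 1) = alpha / 2) in h2; last by field; lra.
  lra.
have b2 : Cmod (rhoC n.+1 - p n.+1) <= Cmod ((1 + 2 * (tv n * tv n)) * rhoC n * (rhoC n.+1 - p n.+1)).
  rewrite 2!Cmod_mult -[X in X <= _]Rmult_1_l; apply: Rmult_le_compat_r; first exact: Cmod_ge_0.
  rewrite /rhoC Cmod_R (Rabs_pos_eq (rho n)); last lra.
  rewrite /tv -!RtoC_mult -RtoC_plus Cmod_R Rabs_pos_eq; last nra.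
  have : 0 <= tR n * tR n by nra.
  move=> h1; have : 0 <= 2 * (tR n * tR n) * rho n by apply: Rmult_le_pos; lra.
  lra.
apply: Rle_trans b2 _; rewrite rel; apply: Rle_trans (Cmod_triangle _ _) _.
rewrite Cmod_opp !Cmod_mult Cmod_pow Cmod_R (Rabs_pos_eq (tR n)); last lra.
apply: Rplus_le_compat; first by apply: Rmult_le_compat_r b1; apply: Cmod_ge_0.
rewrite Rmult_comm (_ : (J + 2).+1 = (J + 3)%N); last by lia.
apply: Rmult_le_compat_r; first by apply: pow_le; lra.
by have := Rle_abs G; lra.
Qed.

Lemma X_rho J : X J rhoC.
Proof.
have [h [Hh [B HB]]] := rho_near J; have hJ := Hh J.
have Xa : X J (approx alpha h) by rewrite /approx; expands_tac.
have Xe : X J (fun n => rhoC n - approx alpha h n)%C.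
  apply: (expands_le EF tv_lim0 (leq_addr 2 J)).
  apply: (expands_small EF tv_neq0 (M := B)); apply: filter_imp (filter_and _ _ ev_pos HB) => n [hn].
  by rewrite Cmod_R (Rabs_pos_eq (tR n)) //; apply/Rlt_le/tR_pos.
by apply: (expands_ext' EF _ (expands_plus EF Xa Xe)) => n; ring.
Qed.

Lemma rho_lead : exists M, 0 <= M /\ EV (fun n => Rabs (rho n - 1 - alpha * tR n) <= M * (tR n * tR n)).
Proof.
have [h [Hh [B HB]]] := rho_near 0; have [M HM] := Hh 0%N.
exists (Rabs M + Rabs B); split; first by have := Rabs_pos M; have := Rabs_pos B; lra.
apply: filter_imp (filter_and _ _ ev_pos (filter_and _ _ HB HM)) => n [hn [h1 h2]].
have tp := tR_pos hn.
rewrite -Cmod_R 2!RtoC_minus RtoC_mult -/(rhoC n) -/(tv n).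
rewrite (_ : (rhoC n - 1 - alpha * tv n)%C = ((rhoC n - approx alpha h n) + tv n * tv n * h n)%C); last first.
  by rewrite /approx; ring.
apply: Rle_trans (Cmod_triangle _ _) _; rewrite !Cmod_mult Cmod_R (Rabs_pos_eq (tR n)); last lra.
have tt : 0 <= tR n * tR n by nra.
rewrite /= Rmult_1_r in h1.
have := Rle_abs M; have := Rle_abs B; nra.
Qed.

Lemma sqrt_S_diff n : (0 < n)%N -> 2 * (sqrt (INR n.+1) - sqrt (INR n)) <= tR n.
Proof.
move=> hn; have hn0 : 0 < INR n by apply: lt_0_INR; lia.
have hS := INR_S_pos n.
have s1 := sqrt_lt_R0 _ hn0; have s2 := sqrt_lt_R0 _ hS.
have e1 := sqrt_sqrt _ (Rlt_le _ _ hn0); have e2 := sqrt_sqrt _ (Rlt_le _ _ hS).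
have le : sqrt (INR n) <= sqrt (INR n.+1) by apply: sqrt_le_1_alt; rewrite S_INR; lra.
rewrite /tR; apply: (Rmult_le_reg_r (sqrt (INR n))) => //; rewrite Rinv_l; last lra.
have e3 : sqrt (INR n.+1) * sqrt (INR n.+1) = INR n + 1 by rewrite e2 S_INR.
move: (sqrt (INR n)) (sqrt (INR n.+1)) e1 e3 => a b e1 e3.
by have := Rle_0_sqr (b - a); rewrite /Rsqr; nra.
Qed.

(** The sequence l_n e^(-2 alpha sqrt n) n^b is eventually nondecreasing: its ratio is at least (1 +
    alpha t - M t^2) (1 - alpha t) (1 + b t^2), and b > M + A + 1 outweighs the loss (M + A) t^2. *)
Lemma lag_lower : exists (b : nat) (C : R), 0 < C /\
  EV (fun n => exp (2 * alpha * sqrt (INR n)) * (tR n * tR n) ^ b <= C * lag A n).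
Proof.
have [M [M0 HM]] := rho_lead.
have [b hb] := INR_unbounded (M + A + 1).
have bA : 0 < INR b * (M + A) by apply: Rmult_lt_0_compat; lra.
have e1 : 0 < / alpha by apply: Rinv_0_lt_compat.
have e2 : 0 < / (INR b * (M + A) + 1) by apply: Rinv_0_lt_compat; lra.
pose Lq n := lag A n * exp (- (2 * alpha * sqrt (INR n))) * INR n ^ b.
have mono : EV (fun n => (0 < n)%N /\ Lq n <= Lq n.+1).
  apply: filter_imp (filter_and _ _ ev_pos (filter_and _ _ HM (filter_and _ _ (tR_small e1) (filter_and _ _ (tR_small e2) (tR_small Rlt_0_1))))).
  move=> n [hn [h1 [t1 [t2 t3]]]]; split=> //.
  have hn0 : 0 < INR n by apply: lt_0_INR; lia.
  have tp := tR_pos hn; have tsq := tR_sq hn.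
  set t := tR n in h1 t1 t2 t3 tp tsq.
  have ta : alpha * t <= 1.
    have : alpha * t <= alpha * / alpha by apply: Rmult_le_compat_l; lra.
    by rewrite Rinv_r; lra.
  have tt : 0 < t * t by nra.
  have tb : t * t * (INR b * (M + A)) <= 1.
    have : t * (INR b * (M + A) + 1) <= / (INR b * (M + A) + 1) * (INR b * (M + A) + 1) by apply: Rmult_le_compat_r; lra.
    by rewrite Rinv_l; nra.
  have hr : 1 + alpha * t - M * (t * t) <= rho n.
    by move: h1 => /Rabs_le_between; lra.
  have he : exp (- (2 * alpha * sqrt (INR n))) * (1 - alpha * t) <= exp (- (2 * alpha * sqrt (INR n.+1))).
    rewrite (_ : - (2 * alpha * sqrt (INR n.+1)) = - (2 * alpha * sqrt (INR n)) + - (alpha * (2 * (sqrt (INR n.+1) - sqrt (INR n))))); last ring.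
    rewrite exp_plus; apply: Rmult_le_compat_l; first exact/Rlt_le/exp_pos.
    apply: Rle_trans (_ : exp (- (alpha * t)) <= _).
      have [->|h] := Req_dec (- (alpha * t)) 0; last by have := exp_ineq1 _ h; lra.
      by rewrite exp_0; nra.
    apply: exp_le_compat; have := sqrt_S_diff hn; rewrite -/t => h.
    have : alpha * (2 * (sqrt (INR n.+1) - sqrt (INR n))) <= alpha * t by apply: Rmult_le_compat_l; lra.
    lra.
  have hp : INR n ^ b * (1 + INR b * (t * t)) <= INR n.+1 ^ b.
    rewrite (_ : INR n.+1 = INR n * (1 + t * t)); last by rewrite S_INR tsq; field; lra.
    rewrite Rpow_mult_distr; apply: Rmult_le_compat_l; first by apply: pow_le; lra.
    exact: poly.
  have l0 := @lag_gt0 n; have ep := exp_pos (- (2 * alpha * sqrt (INR n))).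
  have np : 0 < INR n ^ b by apply: pow_lt.
  have key : 1 <= rho n * (1 - alpha * t) * (1 + INR b * (t * t)).
    have k1 : 1 - (t * t) * (M + A) <= rho n * (1 - alpha * t).
      apply: Rle_trans (_ : (1 + alpha * t - M * (t * t)) * (1 - alpha * t) <= _); last by apply: Rmult_le_compat_r; lra.
      have : 0 <= M * (t * t) * (alpha * t) by do !apply: Rmult_le_pos; lra.
      by rewrite -alphaA; nra.
    have b0 : 0 <= INR b * (t * t) by apply: Rmult_le_pos; [apply: pos_INR | lra].
    apply: Rle_trans (_ : (1 - t * t * (M + A)) * (1 + INR b * (t * t)) <= _); last by apply: Rmult_le_compat_r; lra.
    have : t * t * (t * t * (INR b * (M + A))) <= t * t * 1 by apply: Rmult_le_compat_l; lra.
    have : t * t * (M + A + 1) <= t * t * INR b by apply: Rmult_le_compat_l; lra.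
    lra.
  rewrite /Lq lag_S.
  set E := exp _ in he ep *; set E' := exp _ in he *.
  have r1 : 0 <= rho n by apply/Rlt_le/Rdiv_lt_0_compat.
  apply: Rle_trans (_ : rho n * lag A n * (E * (1 - alpha * t)) * (INR n ^ b * (1 + INR b * (t * t))) <= _).
    rewrite (_ : rho n * lag A n * (E * (1 - alpha * t)) * (INR n ^ b * (1 + INR b * (t * t))) =
       lag A n * E * INR n ^ b * (rho n * (1 - alpha * t) * (1 + INR b * (t * t)))); last ring.
    rewrite -[X in X <= _]Rmult_1_r; apply: Rmult_le_compat_l => //.
    by do !apply: Rmult_le_pos; lra.
  apply: Rmult_le_compat => //.
  - by apply: Rmult_le_pos; apply: Rmult_le_pos; lra.
  - apply: Rmult_le_pos; first lra.
    by have := pos_INR b; nra.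
  - by apply: Rmult_le_compat_l => //; apply: Rmult_le_pos; lra.
have [N HN] := mono.
have LqN : 0 < Lq N.
  have [hN _] := HN N (le_n _).
  by do !apply: Rmult_lt_0_compat => //; [apply: exp_pos | apply: pow_lt; apply: lt_0_INR; lia].
exists b, (/ Lq N); split; first exact: Rinv_0_lt_compat.
exists N => n /leP hn.
have h : Lq N <= Lq n.
  rewrite -(subnKC hn); elim: (n - N)%N => [|d IH]; first by rewrite addn0; lra.
  rewrite addnS; apply: Rle_trans IH _; have [] := HN (N + d)%N ltac:(lia); lra.
have [hn0 _] := HN n (elimT leP hn).
have hn1 : 0 < INR n by apply: lt_0_INR; lia.
rewrite tR_sq // pow_inv.
have np : 0 < INR n ^ b by apply: pow_lt.
have ep := exp_pos (2 * alpha * sqrt (INR n)).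
have e : lag A n = Lq n * (exp (2 * alpha * sqrt (INR n)) * / INR n ^ b).
  by rewrite /Lq exp_Ropp; field; split; apply: Rgt_not_eq.
rewrite e; set y := _ * / _; have y0 : 0 < y by apply: Rmult_lt_0_compat => //; apply: Rinv_0_lt_compat.
apply: Rle_trans (_ : / Lq N * (Lq N * y) <= _); first by right; field; lra.
apply: Rmult_le_compat_l; first exact/Rlt_le/Rinv_0_lt_compat.
by apply: Rmult_le_compat_r; lra.
Qed.
End LaguerreRatio.

Lemma Clim_tv : Clim tv 0.
Proof. by apply: Clim_RtoC; apply: tR_lim. Qed.

(** * The inequality for ratios *)

Lemma X0_lim g : X 0 g -> Clim (fun n => tv n * g n)%C 0.
Proof.
move=> [M HM]; have H := is_lim_seq_abs_0 tR; have /H{}H := tR_lim.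
apply: (Clim_squeeze (e := fun n => M * Rabs (tR n))); last exact: lim0_scal.
apply: filter_imp HM => n h; rewrite (_ : forall y : C, (y - 0)%C = y); last by move=> y; ring.
by rewrite Cmod_mult Cmod_R Rmult_comm; apply: Rmult_le_compat_r => //; apply: Rabs_pos.
Qed.

Lemma X_const_lim J f c g : EV (fun n => f n = (c + tv n * g n)%C) -> X J g -> Clim f c.
Proof.
move=> Hf /(expands_bdd EF tv_lim0) /X0_lim H; apply: Clim_ext_loc (_ : Clim (fun n => c + tv n * g n)%C c).
  by apply: filter_imp Hf => n ->.
by rewrite -[c in Clim _ c]Cplus_0_r; apply: Clim_plus (Clim_const _) H.
Qed.

Lemma X1_lim f : X 1 f -> exists c, Clim f c.
Proof. by move=> [c [g [Hf Xg]]]; exists c; exact: (X_const_lim (J := 0) Hf Xg). Qed.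

Lemma X_lead J f c : X J.+1 f -> Clim f c -> exists g, EV (fun n => f n = (c + tv n * g n)%C) /\ X J g.
Proof.
move=> [c' [g [Hf Xg]]] Hc; exists g; split=> //.
by rewrite (Clim_uniq Hc (X_const_lim Hf Xg)).
Qed.

Lemma Clim_shift u l : Clim u l -> Clim (fun n => u n.+1) l.
Proof. by apply: (@Clim_subseq u l S). Qed.

Lemma Clim_wv : Clim wv 1.
Proof.
have Hq := X0_lim (X_qv 0).
apply: (@Clim_ext_loc (fun n => 1 - tv n * (tv n * qv n))%C).
  by apply: filter_imp ev_pos => n h; rewrite (wv_eq h); ring.
have H := Clim_minus (Clim_const 1) (Clim_mult Clim_tv Hq).
by rewrite (_ : (1 - 0 * 0)%C = 1) in H; last by ring.
Qed.

Lemma Clim_qv : Clim qv (1 / 2)%C.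
Proof.
rewrite (_ : (1 / 2)%C = (1 * 1 * / (1 + 1))%C); last by field.
apply: Clim_mult; first exact: Clim_mult Clim_wv Clim_wv.
apply: Clim_inv; first by rewrite -RtoC_plus; apply: RtoC_neq0; lra.
exact: Clim_plus (Clim_const _) Clim_wv.
Qed.

(** Constants cancel and t_n^j - t_(n+1)^j has order t^(j+2), so the explicit part starts at t^3;
    the remainder of order J gains nothing and stays in [e]. *)
Lemma X_shift_diff J f : X J f -> exists h e, [/\ X (J - 3) h, X 0 e &
  EV (fun n => (f n - f n.+1)%C = (tv n ^ 3 * h n + tv n ^ J * e n)%C)].
Proof.
elim: J f => [|J IH] f Xf.
  exists (fun _ => 0), (fun n => f n - f n.+1)%C; split; first exact: (expands_const EF).
    by apply: (expands_minus EF) => //; apply: X_shift.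
  by apply: filter_forall => n; rewrite /=; ring.
move: Xf => [c [g [Hf Xg]]]; have [h [e [Xh Xe Hd]]] := IH g Xg.
exists (fun n => tv n * h n + qv n * g n.+1)%C, e; split=> //.
  apply: (expands_plus EF).
    apply: (expands_le EF tv_lim0 (K := (J - 3).+1)); first by lia.
    exact: (expands_mulv EF).
  apply: (expands_le EF tv_lim0 (K := J)); first by lia.
  by have := X_shift Xg => ?; expands_tac.
apply: filter_imp (filter_and _ _ (filter_and _ _ ev_pos Hd) (filter_and _ _ Hf (ev_S Hf))).
move=> n [[hn hd] [-> ->]]; rewrite (tv_S hn) Cpow_S.
transitivity (tv n * (g n - g n.+1) + tv n * (1 - wv n) * g n.+1)%C; first ring.
rewrite hd {1}(wv_eq hn) /=; ring.
Qed.

(* The expansion R = 1 + alpha t + ..., t = n^(-1/2), forces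
   y_n - y_{n+1} = (3 alpha / 4) t^5 + O(t^6) for y_n = R_n (R_n - R_{n+1}). *)
Lemma ratio_ineq (R : nat -> R) alpha M : 0 < alpha -> X 6 (fun n => RtoC (R n)) ->
  EV (fun n => Rabs (R n - 1 - alpha * tR n) <= M * (tR n * tR n)) ->
  EV (fun n => R n.+1 * (R n.+1 - R n.+2) < R n * (R n - R n.+1)).
Proof.
move=> a0 XR HR; set f := (fun n => RtoC (R n)) in XR *.
have aM : is_lim_seq (fun n => (alpha + Rabs M) * Rabs (tR n)) 0.
  by apply: lim0_scal; have H := is_lim_seq_abs_0 tR; have /H := tR_lim.
have f1 : Clim f 1.
  apply: Clim_squeeze aM; apply: filter_imp (filter_and _ _ ev_pos (filter_and _ _ HR (tR_small Rlt_0_1))) => n [hn [h ht]].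
  have tp := tR_pos hn; rewrite /f -RtoC_minus Cmod_R (Rabs_pos_eq (tR n)); last lra.
  have := Rabs_triang (R n - 1 - alpha * tR n) (alpha * tR n).
  rewrite (_ : R n - 1 - alpha * tR n + alpha * tR n = R n - 1); last ring.
  rewrite (Rabs_pos_eq (alpha * tR n)); last nra.
  have := Rle_abs M; have := Rabs_pos M => h1 h2 h3.
  have : M * (tR n * tR n) <= Rabs M * tR n.
    apply: Rle_trans (_ : Rabs M * (tR n * tR n) <= _); first by apply: Rmult_le_compat_r; nra.
    by apply: Rmult_le_compat_l; nra.
  lra.
have [r [Hr Xr]] := X_lead XR f1.
have ra : Clim r alpha.
  apply: (Clim_squeeze (e := fun n => Rabs M * Rabs (tR n))); last first.
    by apply: lim0_scal; have H := is_lim_seq_abs_0 tR; have /H := tR_lim.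
  apply: filter_imp (filter_and _ _ ev_pos (filter_and _ _ HR Hr)) => n [hn [h e]].
  have tp := tR_pos hn; rewrite (Rabs_pos_eq (tR n)); last lra.
  have h2 : tR n * Cmod (r n - alpha) <= tR n * (Rabs M * tR n).
    rewrite -{1}(Rabs_pos_eq (tR n)); last lra.
    rewrite -Cmod_R -Cmod_mult -/(tv n) (_ : (tv n * (r n - alpha))%C = RtoC (R n - 1 - alpha * tR n)).
      rewrite Cmod_R; apply: Rle_trans h _; rewrite (_ : tR n * (Rabs M * tR n) = Rabs M * (tR n * tR n)); last ring.
      by apply: Rmult_le_compat_r (Rle_abs _); nra.
    rewrite 2!RtoC_minus RtoC_mult -/(f n) e /tv; ring.
  exact: Rmult_le_reg_l h2.
have [h [e [Xh Xe Hd]]] := X_shift_diff Xr.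
(* For f = 1 + t r the difference is t (r_n - r_(n+1)) + t (1 - w) r_(n+1) with 1 - w = t^2 q and q
   -> 1/2, so H tends to alpha / 2. *)
pose H n := (qv n * r n.+1 + tv n * h n)%C.
have Xr' := X_shift Xr.
have XH : X 3 H.
  apply: (expands_plus EF); last exact: (expands_mulv EF).
  by apply: (expands_le EF tv_lim0 (K := 5)) => //; expands_tac.
have hb := X0_lim (expands_bdd EF tv_lim0 Xh).
have HHl : Clim H (1 / 2 * alpha + 0)%C.
  by apply: Clim_plus hb; apply: Clim_mult Clim_qv (Clim_shift ra).
have XR3 : X 3 f by apply: (expands_le EF tv_lim0 (K := 6)).
pose k n := (f n * H n)%C.
have Xk : X 3 k by apply: (expands_mult EF tv_lim0).
have Hk : Clim k (1 * (1 / 2 * alpha + 0))%C by apply: Clim_mult.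
have [h2 [e2 [Xh2 Xe2 Hd2]]] := X_shift_diff Xk.
(* From t^3 - (t w)^3 = t^5 q (1 + w + w^2); the limit is 1/2 times 3 times alpha / 2. *)
pose G n := (qv n * (1 + wv n + wv n * wv n) * k n.+1)%C.
have HG : Clim G (RtoC (3 / 4 * alpha)).
  rewrite (_ : RtoC (3 / 4 * alpha) = (1 / 2 * (1 + 1 + 1 * 1) * (1 * (1 / 2 * alpha + 0)))%C).
    apply: Clim_mult (Clim_shift Hk); apply: Clim_mult Clim_qv _.
    apply: Clim_plus; first exact: Clim_plus (Clim_const _) Clim_wv.
    exact: Clim_mult Clim_wv Clim_wv.
  rewrite RtoC_mult RtoC_div; last lra.
  rewrite (_ : RtoC 4 = (2 * 2)%C); last by rewrite -RtoC_mult; congr RtoC; lra.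
  rewrite (_ : RtoC 3 = (1 + 1 + 1)%C); last by rewrite -!RtoC_plus; congr RtoC; lra.
  by field; apply: C2_neq0.
pose err n := (h2 n + e2 n + f n * e n - wv n ^ 6 * f n.+1 * e n.+1)%C.
have [L HL] : X 0 err.
  have X0 : X 0 f by apply: (expands_le EF tv_lim0 (K := 6)).
  by rewrite /err; expands_tac.
have y_eq : EV (fun n => RtoC (R n * (R n - R n.+1)) = (tv n ^ 3 * k n + tv n ^ 6 * (f n * e n))%C).
  apply: filter_imp (filter_and _ _ (filter_and _ _ ev_pos Hd) (filter_and _ _ Hr (ev_S Hr))).
  move=> n [[hn hd] [e0 e1]]; rewrite RtoC_mult RtoC_minus -/(f n) -/(f n.+1) /k -/(f n).
  have -> : (f n - f n.+1 = tv n ^ 3 * H n + tv n ^ 6 * e n)%C.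
    rewrite e0 e1 (tv_S hn).
    transitivity (tv n * (r n - r n.+1) + tv n * (1 - wv n) * r n.+1)%C; first ring.
    by rewrite hd {1}(wv_eq hn) /H /=; ring.
  by ring.
have Reg : EV (fun n => 3 / 8 * alpha <= Re (G n)).
  have p : 0 < 3 / 8 * alpha by lra.
  have /is_lim_seq_spec/(_ (mkposreal _ p)) := Clim_Re HG; apply: filter_imp => n /= /Rabs_lt_between; lra.
have sm : 0 < 3 / 8 * alpha / (Rabs L + 1).
  by apply: Rdiv_lt_0_compat; [lra | have := Rabs_pos L; lra].
apply: filter_imp (filter_and _ _ (filter_and _ _ ev_pos (filter_and _ _ y_eq (ev_S y_eq))) (filter_and _ _ (filter_and _ _ Hd2 HL) (filter_and _ _ Reg (tv_lim0 sm)))).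
move=> n [[hn [y0 y1]] [[d2 hL] [hG ht]]].
have tp := tR_pos hn; rewrite Cmod_R Rabs_pos_eq in ht; last lra.
have key : RtoC (R n * (R n - R n.+1) - R n.+1 * (R n.+1 - R n.+2)) = (RtoC (tR n ^ 5) * G n + RtoC (tR n ^ 6) * err n)%C.
  rewrite RtoC_minus y0 y1 (tv_S hn) !RtoC_pow -/(tv n).
  transitivity (tv n ^ 3 * (k n - k n.+1) + tv n ^ 3 * (1 - wv n) * (1 + wv n + wv n * wv n) * k n.+1 + tv n ^ 6 * (f n * e n - wv n ^ 6 * f n.+1 * e n.+1))%C.
    by rewrite /=; ring.
  by rewrite d2 {1}(wv_eq hn) /G /err /=; ring.
have t5 : 0 < tR n ^ 5 by apply: pow_lt.
have := f_equal Re key; rewrite [Re (RtoC _)]/= Re_plus !Re_scal => E.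
have hr : - Rabs L <= Re (err n).
  have := Rle_trans _ _ _ (re_le_Cmod _) hL => /Rabs_le_between [h3 _].
  by have := Rle_abs L; lra.
have : tR n * Rabs L < 3 / 8 * alpha.
  have : tR n * (Rabs L + 1) < 3 / 8 * alpha.
    apply/Rlt_div_r => //; have := Rabs_pos L; lra.
  lra.
rewrite (_ : tR n ^ 6 = tR n ^ 5 * tR n) in E; last ring.
move=> h5.
have : 0 < tR n ^ 5 * (Re (G n) + tR n * Re (err n)).
  apply: Rmult_lt_0_compat => //.
  have : tR n * - Rabs L <= tR n * Re (err n) by apply: Rmult_le_compat_l; lra.
  lra.
lra.
Qed.

Lemma ev_add (P : nat -> Prop) K : EV P -> EV (fun n => P (n + K)%N).
Proof. by move=> [N HN]; exists N => n hn; apply: HN; lia. Qed.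

Lemma X_shiftn J f K : X J f -> X J (fun n => f (n + K)%N).
Proof.
move=> H; elim: K => [|K IH]; first by apply: (expands_ext' EF _ H) => n; rewrite addn0.
by apply: (expands_ext' EF _ (X_shift IH)) => n; rewrite addSnnS.
Qed.

Lemma tR_anti n K : (0 < n)%N -> tR (n + K) <= tR n.
Proof.
move=> hn; have hn0 : 0 < INR n by apply: lt_0_INR; lia.
apply: Rinv_le_contravar; first exact: sqrt_lt_R0.
by apply: sqrt_le_1_alt; apply: le_INR; lia.
Qed.

(** * From the coefficients l_n to the sequence a *)

Section FinalAsymptotics.
Variables (A alpha : R) (a : nat -> R).
Hypothesis alpha_pos : 0 < alpha.
Hypothesis alphaA : alpha * alpha = A.
Let A0 : 0 < A. Proof. by rewrite -alphaA; nra. Qed.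
Let lag_gt0 n := lag_pos A0 n.
Let lagC n : C := RtoC (lag A n).
Let lag_neq0 n : lagC n <> 0. Proof. by apply: RtoC_neq0; have := lag_gt0 n; lra. Qed.

Hypothesis cmp : forall K, (0 < K)%N -> exists (d : nat -> C) (C0 x0 : R), [/\ 0 < x0, 0 < Re (d 0%N) &
  forall x n, 0 < x < x0 ->
  Cmod (RtoC (a n) - csum (fun i => d i * iter i nabla (fun m => RtoC (lag A m)) n) K)%C * exp (- x) ^ n
    <= C0 * x ^ K * exp (A / x)].

Let rhoC n : C := RtoC (rho A n).

Lemma rho_lim : Clim rhoC 1.
Proof.
have [c Hc] := X1_lim (X_rho alpha_pos alphaA 1).
have [M [M0 HM]] := rho_lead alpha_pos alphaA.
suff H : Clim rhoC 1 by [].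
have H := is_lim_seq_abs_0 tR; have /H{}H := tR_lim.
apply: (Clim_squeeze (e := fun n => (alpha + M) * Rabs (tR n))); last exact: lim0_scal.
apply: filter_imp (filter_and _ _ ev_pos (filter_and _ _ HM (tR_small Rlt_0_1))) => n [hn [h ht]].
have tp := tR_pos hn; rewrite /rhoC -RtoC_minus Cmod_R (Rabs_pos_eq (tR n)); last lra.
have := Rabs_triang (rho A n - 1 - alpha * tR n) (alpha * tR n).
rewrite (_ : rho A n - 1 - alpha * tR n + alpha * tR n = rho A n - 1); last ring.
rewrite (Rabs_pos_eq (alpha * tR n)); last nra.
have : M * (tR n * tR n) <= M * tR n by apply: Rmult_le_compat_l; nra.
lra.
Qed.

Lemma lag_quot J j : X J (fun m => lagC (m + j) / lagC m)%C /\ Clim (fun m => lagC (m + j) / lagC m)%C 1.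
Proof.
elim: j => [|j [IH1 IH2]].
  split; [apply: (expands_ext' EF _ (expands_const EF tv J 1)) => m | apply: Clim_ext (Clim_const 1) => m];
    by rewrite addn0; field.
have e m : (rhoC (m + j) * (lagC (m + j) / lagC m))%C = (lagC (m + j.+1) / lagC m)%C.
  rewrite addnS /lagC (lag_S alpha_pos alphaA) RtoC_mult -/(rhoC _) -/(lagC _) -/(lagC m); field; exact: lag_neq0.
split.
  apply: (expands_ext' EF e); apply: (expands_mult EF tv_lim0) IH1.
  exact: X_shiftn (X_rho alpha_pos alphaA J).
apply: Clim_ext e _; rewrite -[RtoC 1]Cmult_1_l; apply: Clim_mult IH2.
by apply: (@Clim_subseq _ _ (fun m => (m + j)%N) _ rho_lim) => m; rewrite leq_addr.
Qed.

(** For i <= j the differences at m + j stay at indices >= m, away from the boundary value of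
    [delay]. All quotients l_(m+j) / l_m tend to 1, so every proper difference tends to 0. *)
Lemma nabla_quot J i j : (i <= j)%N -> X J (fun m => iter i nabla lagC (m + j)%N / lagC m)%C /\
  Clim (fun m => iter i nabla lagC (m + j)%N / lagC m)%C (if i == 0%N then RtoC 1 else RtoC 0).
Proof.
elim: i j => [|i IH] j hij; first exact: lag_quot.
have [X1 l1] := IH j (ltnW hij); have [X2 l2] := IH j.-1 ltac:(lia).
have e m : (iter i nabla lagC (m + j)%N / lagC m - iter i nabla lagC (m + j.-1)%N / lagC m)%C
   = (iter i.+1 nabla lagC (m + j)%N / lagC m)%C.
  rewrite iterS /nabla /delay; have -> : (0 < m + j)%N by lia.
  rewrite (_ : (m + j - 1)%N = (m + j.-1)%N); last by lia.
  by field; apply: lag_neq0.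
split; first exact: (expands_ext' EF e (expands_minus EF X1 X2)).
apply: Clim_ext e _; have := Clim_minus l1 l2.
by rewrite (_ : forall y : C, (y - y)%C = 0) //; move=> y; ring.
Qed.

(** Dividing a(m + K) by l_m, at an offset of K, lets [nabla_quot] cover all differences of order
    below K. *)
Lemma theta_expand : exists K, exists l : R, [/\ 0 < l, X 6 (fun m => RtoC (a (m + K)%N / lag A m)) &
  Clim (fun m => RtoC (a (m + K)%N / lag A m)) l].
Proof.
have [b [Cl [Cl0 Hl]]] := lag_lower alpha_pos alphaA.
(* [lag_lower] costs t^(2b); the six remaining powers give the order that [ratio_ineq] asks for. *)
pose K := (2 * b + 6)%N.
have K0 : (0 < K)%N by rewrite /K; lia.
have [d [C0 [x0 [x0p d0 H]]]] := cmp K0.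
pose U m := csum (fun i => d i * (iter i nabla lagC (m + K)%N / lagC m))%C K.
have XU : X 6 U.
  apply: (expands_csum EF) => i hi; apply: (expands_scal EF).
  by have [] := nabla_quot 6 (ltnW hi).
have lU : Clim U (d 0%N).
  have -> : d 0%N = csum (fun i => d i * (if i == 0%N then RtoC 1 else RtoC 0))%C K.
    rewrite -(prednK K0) csum_recl (csum_ext (g := fun _ => RtoC 0)); last by move=> i _ /=; ring.
    by rewrite csum_zero /=; ring.
  apply: (@Clim_csum_inner (fun m i => d i * (iter i nabla lagC (m + K)%N / lagC m))%C (fun i => d i * (if i == 0%N then RtoC 1 else RtoC 0))%C) => i hi.
  by have [_ h] := nabla_quot 6 (ltnW hi); exact: Clim_scal h.
have [X0q _] := lag_quot 0 K; have [Q HQ] := X0q.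
pose th m : C := RtoC (a (m + K)%N / lag A m).
have err : EV (fun m => Cmod (th m - U m) <= Rabs C0 * alpha ^ K * Cl * Q * Cmod (tv m) ^ 6).
  have ex0 : 0 < x0 / (2 * alpha) by apply: Rdiv_lt_0_compat; lra.
  apply: filter_imp (filter_and _ _ (filter_and _ _ ev_pos HQ) (filter_and _ _ (ev_add K Hl) (ev_add K (tR_small ex0)))).
  move=> m [[hm hQ] [hl ht]].
  set n := (m + K)%N in hQ hl ht *.
  have hn : (0 < n)%N by rewrite /n; lia.
  have hn0 : 0 < INR n by apply: lt_0_INR; lia.
  have tp := tR_pos hn; have tm := tR_pos hm; have tmn : tR n <= tR m by apply: tR_anti.
  have sn := sqrt_lt_R0 _ hn0; have sq := sqrt_sqrt _ (Rlt_le _ _ hn0).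
  (* At x = alpha t_n both A / x and n x equal alpha sqrt n. *)
  have hx : 0 < alpha * tR n < x0.
    split; first exact: Rmult_lt_0_compat.
    have : alpha * tR n <= alpha * (x0 / (2 * alpha)) by apply: Rmult_le_compat_l; lra.
    by rewrite (_ : alpha * (x0 / (2 * alpha)) = x0 / 2); [lra | field; lra].
  have h := H (alpha * tR n) n hx.
  have e1 : A / (alpha * tR n) = alpha * sqrt (INR n).
    by rewrite -alphaA /tR; field; lra.
  have e2 : exp (- (alpha * tR n)) ^ n = exp (- (alpha * sqrt (INR n))).
    have -> : - (alpha * sqrt (INR n)) = INR n * - (alpha * tR n).
      by rewrite /tR -{2}sq; field; lra.
    move: (- (alpha * tR n)) => y; elim: (n) => [|j IH]; first by rewrite /= Rmult_0_l exp_0.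
    rewrite S_INR Rmult_plus_distr_r exp_plus -IH /= Rmult_1_l; ring.
  rewrite e1 e2 in h.
  have ep := exp_pos (alpha * sqrt (INR n)).
  set Z := (RtoC (a n) - _)%C in h.
  have hZ : Cmod Z <= Rabs C0 * alpha ^ K * tR n ^ K * exp (2 * alpha * sqrt (INR n)).
    rewrite (_ : Cmod Z = (Cmod Z * exp (- (alpha * sqrt (INR n)))) * exp (alpha * sqrt (INR n))); last first.
      by rewrite exp_Ropp; field; lra.
    rewrite (_ : 2 * alpha * sqrt (INR n) = alpha * sqrt (INR n) + alpha * sqrt (INR n)); last ring.
    rewrite exp_plus -Rmult_assoc; apply: Rmult_le_compat_r; first lra.
    apply: Rle_trans h _; apply: Rmult_le_compat_r; first lra.
    rewrite Rpow_mult_distr (Rmult_assoc (Rabs _)); apply: Rmult_le_compat_r (Rle_abs _).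
    by apply: Rmult_le_pos; apply: pow_le; lra.
  have tK : tR n ^ K = (tR n * tR n) ^ b * tR n ^ 6.
    by rewrite /K pow_add pow_mult; congr (_ ^ _ * _); rewrite /=; ring.
  have t6 : tR n ^ 6 <= tR m ^ 6 by apply: pow_incr; lra.
  have t60 : 0 <= tR n ^ 6 by apply: pow_le; lra.
  have aK : 0 < alpha ^ K by apply: pow_lt.
  have ln := lag_gt0 n; have lm := lag_gt0 m.
  have hZ2 : Cmod Z <= Rabs C0 * alpha ^ K * Cl * lag A n * tR m ^ 6.
    apply: Rle_trans hZ _; rewrite tK.
    set y := (tR n * tR n) ^ b in hl *; set E := exp _ in hl *.
    rewrite (_ : Rabs C0 * alpha ^ K * (y * tR n ^ 6) * E = Rabs C0 * alpha ^ K * ((E * y) * tR n ^ 6)); last ring.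
    rewrite (_ : Rabs C0 * alpha ^ K * Cl * lag A n * tR m ^ 6 = Rabs C0 * alpha ^ K * ((Cl * lag A n) * tR m ^ 6)); last ring.
    apply: Rmult_le_compat_l; first by apply: Rmult_le_pos; [apply: Rabs_pos | lra].
    apply: Rmult_le_compat => //.
    apply: Rmult_le_pos; [apply/Rlt_le/exp_pos | apply: pow_le; nra].
  have eth : (th m - U m)%C = (Z / lagC m)%C.
    rewrite /th RtoC_div -/n; last lra.
    rewrite -/(lagC m) /Z (_ : U m = (csum (fun i => d i * iter i nabla (fun m => RtoC (lag A m)) n) K / lagC m)%C).
      by field; apply: lag_neq0.
    rewrite /U -/n /Cdiv Cmult_comm -csum_scal; apply: csum_ext => i _.
    have swap (y1 y2 y3 : C) : (y1 * (y2 * y3))%C = (y3 * (y1 * y2))%C by ring.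
    exact: swap.
  rewrite eth Cmod_div // Cmod_R (Rabs_pos_eq (lag A m)); last lra.
  rewrite Cmod_R (Rabs_pos_eq (tR m)); last lra.
  have hQ2 : lag A n / lag A m <= Q.
    by move: hQ; rewrite /lagC -RtoC_div ?Cmod_R ?Rabs_pos_eq //; [apply/Rlt_le/Rdiv_lt_0_compat | lra].
  apply: Rle_trans (_ : (Rabs C0 * alpha ^ K * Cl * lag A n * tR m ^ 6) / lag A m <= _).
    by apply: Rmult_le_compat_r hZ2; apply/Rlt_le/Rinv_0_lt_compat.
  rewrite (_ : _ / lag A m = (Rabs C0 * alpha ^ K * Cl * tR m ^ 6) * (lag A n / lag A m)); last by field; lra.
  rewrite (_ : _ * Q * _ = (Rabs C0 * alpha ^ K * Cl * tR m ^ 6) * Q); last ring.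
  apply: Rmult_le_compat_l hQ2; do 3!(apply: Rmult_le_pos; last by [lra | apply: pow_le; lra]).
  exact: Rabs_pos.
have Xerr : X 6 (fun m => th m - U m)%C by apply: (expands_small EF tv_neq0 err).
have Xth : X 6 th.
  by apply: (expands_ext' EF _ (expands_plus EF Xerr XU)) => m; ring.
have lth : Clim th (d 0%N).
  have e0 : Clim (fun m => th m - U m)%C 0.
    have := is_lim_seq_abs_0 tR => Hb; have /Hb{}Hb := tR_lim.
    apply: (Clim_squeeze (e := fun m => Rabs (Rabs C0 * alpha ^ K * Cl * Q) * Rabs (tR m))); last exact: lim0_scal.
    apply: filter_imp (filter_and _ _ ev_pos (filter_and _ _ err (tR_small Rlt_0_1))) => m [hm [h t1]].
    have tm := tR_pos hm; rewrite (_ : forall y : C, (y - 0)%C = y); last by move=> y; ring.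
    apply: Rle_trans h _; rewrite Cmod_R (Rabs_pos_eq (tR m)); last lra.
    have p6 : 0 <= tR m ^ 6 <= tR m.
      split; first by apply: pow_le; lra.
      rewrite (_ : tR m ^ 6 = tR m * tR m ^ 5); last ring.
      rewrite -[X in _ <= X]Rmult_1_r; apply: Rmult_le_compat_l; first lra.
      by rewrite -(pow1 5); apply: (pow_incr (tR m) 1 5); lra.
    set c := _ * _ * _ * Q; apply: Rle_trans (_ : Rabs c * tR m ^ 6 <= _).
      by apply: Rmult_le_compat_r (Rle_abs _); lra.
    by apply: Rmult_le_compat_l; [apply: Rabs_pos | lra].
  have := Clim_plus e0 lU; rewrite (_ : (0 + d 0%N)%C = d 0%N); last ring.
  by apply: Clim_ext => m; ring.
exists K, (Re (d 0%N)); split=> //.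
have e : d 0%N = RtoC (Re (d 0%N)).
  exact: (Clim_uniq lth (Clim_RtoC (Clim_Re lth))).
by rewrite -e.
Qed.

(** The differences are cleared so that the inequality transfers verbatim to natural numbers. *)
Lemma final_ineq : EV (fun n =>
   a n.+1 ^ 2 * (a n * a n.+2) + a n ^ 2 * a n.+2 ^ 2 < a n.+1 ^ 4 + a n ^ 2 * (a n.+1 * a n.+3)).
Proof.
have [K [l [l0 Xth lth]]] := theta_expand.
pose th m : C := RtoC (a (m + K)%N / lag A m).
pose R m := a (m + K).+1 / a (m + K)%N.
have th_big : EV (fun m => l / 2 <= Cmod (th m)).
  have l2 : 0 < l / 2 by lra.
  have /is_lim_seq_spec/(_ (mkposreal _ l2)) := Clim_Cmod lth; rewrite Cmod_R (Rabs_pos_eq l); last lra.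
  by apply: filter_imp => m /= /Rabs_lt_between; rewrite -/(th m); lra.
have l2 : 0 < l / 2 by lra.
have Xinv : X 6 (fun m => / th m)%C by apply: (expands_inv EF tv_lim0 l2 th_big Xth).
have an0 : EV (fun m => a (m + K)%N <> 0).
  apply: filter_imp th_big => m h e; move: h; rewrite /th e /Rdiv Rmult_0_l Cmod_0; lra.
have R_eq : EV (fun m => (rhoC m * (th m.+1 * / th m))%C = RtoC (R m)).
  apply: filter_imp an0 => m ham; rewrite /th /rhoC /rho /R addSn.
  have l1 := lag_gt0 m; have l3 := lag_gt0 m.+1.
  have h : a (m + K)%N / lag A m <> 0.
    by apply: Rmult_integral_contrapositive; split => //; apply: Rinv_neq_0_compat; lra.
  by rewrite -RtoC_inv // -!RtoC_mult; congr RtoC; field; do ?split => //; lra.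
have XR : X 6 (fun m => RtoC (R m)).
  apply: (expands_ext EF R_eq); apply: (expands_mult EF tv_lim0); first exact: (X_rho alpha_pos alphaA 6).
  by apply: (expands_mult EF tv_lim0) Xinv; apply: X_shift.
have [g [Hg Xg]] := X_lead Xth lth.
have [lg Hlg] := X1_lim (expands_le EF tv_lim0 (isT : (1 <= 5)%N) Xg).
have [g1 [Hg1 Xg1]] := X_lead Xg Hlg.
(* The increment of [th] is t^2 times the bounded [ph], so consecutive values have ratio 1 + O(t^2)
   and R keeps the terms 1 + alpha t of rho. *)
pose ph m := (- (tv m * qv m * g m.+1) + wv m * g1 m.+1 - g1 m)%C.
have dth : EV (fun m => (th m.+1 - th m)%C = (tv m * tv m * ph m)%C).
  apply: filter_imp (filter_and _ _ (filter_and _ _ Hg (ev_S Hg)) (filter_and _ _ ev_pos (filter_and _ _ Hg1 (ev_S Hg1)))).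
  move=> m [[e0 e1] [hm [e2 e3]]]; rewrite /th e0 e1 (tv_S hm) /ph.
  transitivity (tv m * ((wv m - 1) * g m.+1 + (g m.+1 - g m)))%C; first ring.
  rewrite {2}e3 e2 (tv_S hm) {1}(wv_eq hm); ring.
have [M [M0 HM]] := rho_lead alpha_pos alphaA.
have [L HL] : X 0 (fun m => rhoC m * (ph m * / th m))%C.
  have x1 := X_rho alpha_pos alphaA 0; have x2 := expands_le EF tv_lim0 (isT : (0 <= 6)%N) Xinv.
  have x3 := expands_bdd EF tv_lim0 Xg; have x4 := expands_bdd EF tv_lim0 Xg1.
  by rewrite /ph; expands_tac.
have lead : EV (fun m => Rabs (R m - 1 - alpha * tR m) <= (M + L) * (tR m * tR m)).
  apply: filter_imp (filter_and _ _ (filter_and _ _ ev_pos R_eq) (filter_and _ _ dth (filter_and _ _ th_big (filter_and _ _ HM HL)))).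
  move=> m [[hm hR] [hd [hb [h1 h2]]]]; have tm := tR_pos hm.
  have t0 : th m <> 0 by apply/Cmod_gt_0; lra.
  have e : RtoC (R m - 1 - alpha * tR m) = (RtoC (rho A m - 1 - alpha * tR m) + tv m * tv m * (rhoC m * (ph m * / th m)))%C.
    rewrite !RtoC_minus -hR -/(rhoC m).
    rewrite (_ : (tv m * tv m * (rhoC m * (ph m * / th m)))%C = (rhoC m * ((tv m * tv m * ph m) * / th m))%C); last ring.
    by rewrite -hd; field.
  rewrite -Cmod_R e; apply: Rle_trans (Cmod_triangle _ _) _.
  rewrite !(Cmod_R (_ - _)) (Cmod_mult (tv m * tv m)) Cmod_mult Cmod_R (Rabs_pos_eq (tR m)); last lra.
  have : tR m * tR m * Cmod (rhoC m * (ph m * / th m)) <= tR m * tR m * L by apply: Rmult_le_compat_l; nra.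
  lra.
have main := ratio_ineq alpha_pos XR lead.
have {}main : EV (fun m => (fun n => a n.+1 ^ 2 * (a n * a n.+2) + a n ^ 2 * a n.+2 ^ 2 < a n.+1 ^ 4 + a n ^ 2 * (a n.+1 * a n.+3)) (m + K)%N).
  apply: filter_imp (filter_and _ _ main (filter_and _ _ an0 (filter_and _ _ (ev_S an0) (ev_S (ev_S an0))))).
  move=> m [h [a0 [a1 a2]]]; rewrite !addSn in a1 a2; move: h; rewrite /R !addSn.
  set x0 := a (m + K)%N in a0 *; set x1 := a (m + K).+1 in a1 *; set x2 := a (m + K).+2 in a2 *; set x3 := a (m + K).+3.
  move=> h; have p : 0 < x0 ^ 2 * x1 ^ 2 by apply: Rmult_lt_0_compat; apply: pow2_gt_0.
  have := Rmult_lt_compat_l _ _ _ p h.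
  rewrite (_ : x0 ^ 2 * x1 ^ 2 * (x2 / x1 * (x2 / x1 - x3 / x2)) = x0 ^ 2 * x2 ^ 2 - x0 ^ 2 * (x1 * x3)); last by field.
  rewrite (_ : x0 ^ 2 * x1 ^ 2 * (x1 / x0 * (x1 / x0 - x2 / x1)) = x1 ^ 4 - x1 ^ 2 * (x0 * x2)); last by field.
  lra.
move: main => [N HN]; exists (N + K)%N => n hn.
by have := HN (n - K)%N ltac:(lia); rewrite subnK //; lia.
Qed.

End FinalAsymptotics.

Lemma INR_add m n : INR (m + n)%N = INR m + INR n.
Proof. exact: plus_INR. Qed.

(** * The theorem *)

(** Both factors have the form 1 + w q / (1 - q): 1 / (1 - q) for w = 1, (1 + q) / (1 - q) for w =
    2. The two summands are those of [reg_countS]. *)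
Lemma reg_prod_series k w E N : (forall q, Cmod q < 1 -> E q = (1 + INR w * (q / (1 - q)))%C) ->
  disk_series (reg_prod k E N) (fun n => (reg_count k w N n)%:C).
Proof.
move=> HE; elim: N => [|N IH].
  by apply: disk_series_ext disk_series_1 => // n /=; case: eqP.
case hk : (k %| N.+1)%N.
  apply: disk_series_ext IH => [q _|n]; first by rewrite reg_prodS hk.
  by rewrite reg_countS hk addn0.
pose b n := RtoC (INR (progression_sum N.+1 (reg_count k w N) n)).
have sb := @disk_series_div N.+1 _ _ b (ltn0Sn N) IH _.
have {}/sb sb : forall n, b n = (INR (reg_count k w N n) + delay N.+1 b n)%C.
  move=> n; rewrite /b progression_sumE // INR_add RtoC_plus /delay; congr Cplus.
  by case: ifP.
apply: disk_series_ext (disk_series_plus IH (disk_series_scal (INR w) (disk_series_delay N.+1 sb))) => [q hq|n].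
  rewrite reg_prodS hk HE; first by rewrite /Cdiv; ring.
  rewrite Cmod_pow; apply: Rle_lt_trans (hq); rewrite -[X in _ <= X]Rmult_1_r.
  rewrite (_ : Cmod q ^ N.+1 = Cmod q * Cmod q ^ N) //; apply: Rmult_le_compat_l; first exact: Cmod_ge_0.
  by rewrite -(pow1 N); apply: pow_incr; split; [apply: Cmod_ge_0 | apply: Rlt_le].
rewrite reg_countS hk /= INR_add RtoC_plus /delay; congr Cplus.
by rewrite (leqNgt N.+1 n); case: (n < N.+1)%N => /=; [rewrite Cmult_0_r | rewrite mult_INR RtoC_mult].
Qed.

Lemma reg_sequence_ineq k w c E (a : nat -> nat) : (1 < k)%N -> (forall m, 0 <= c m <= 2) -> 1 <= c 0%N ->
  exp_factor c E -> (forall q, Cmod q < 1 -> E q = (1 + INR w * (q / (1 - q)))%C) ->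
  (exists A c0 s, 0 < A /\ log_expansion k c A c0 s) ->
  (forall N n, (n <= N)%N -> reg_count k w N n = a n) ->
  exists N, forall n, (N <= n)%N ->
   (a n.+1 ^ 2 * (a n * a n.+2) + a n ^ 2 * a n.+2 ^ 2 < a n.+1 ^ 4 + a n ^ 2 * (a n.+1 * a n.+3))%N.
Proof.
move=> k2 hc c1 HE hE [A [c0 [s [A0 HA]]]] ha.
have cmp := comparison k2 hc c1 HE A0 HA (fun N => reg_prod_series k N hE)
  (a := fun n => INR (a n)) (fun N n hn => f_equal (fun m => m%:C) (ha N n hn)).
have [N HN] := final_ineq (sqrt_lt_R0 _ A0) (sqrt_sqrt _ (Rlt_le _ _ A0)) cmp.
exists N => n hn; have := HN n ltac:(lia).
have pw m j : (INR m ^ j = INR (m ^ j)%N).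
  by elim: j => [|j IH] //; rewrite expnS mult_INR -IH.
rewrite !pw -!mult_INR -!plus_INR => /INR_lt; lia.
Qed.

Lemma reg_sequence_eventually k (a : nat -> nat) : (1 < k)%N -> (a = reg_partitions k \/ a = reg_overpartitions k) ->
  exists N, forall n, (N <= n)%N ->
   (a n.+1 ^ 2 * (a n * a n.+2) + a n ^ 2 * a n.+2 ^ 2 < a n.+1 ^ 4 + a n ^ 2 * (a n.+1 * a n.+3))%N.
Proof.
move=> k2 [->|->].
  apply: (reg_sequence_ineq k2 _ _ exp_factor_part (w := 1) _ (log_expansion_part k2)); try by move=> *; lra.
    by move=> q hq; rewrite /=; field; apply: one_minus_neq0.
  exact: reg_partitions_count.
apply: (reg_sequence_ineq k2 _ _ exp_factor_over (w := 2) _ (log_expansion_over k2)).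
- by move=> m; rewrite /odd_weight; case: odd; lra.
- by rewrite /odd_weight /=; lra.
- by move=> q hq; rewrite (_ : INR 2 = 2) //; field; apply: one_minus_neq0.
- exact: reg_overpartitions_count.
Qed.

From mathcomp Require Import all_order all_algebra.
Import Order.TTheory GRing.Theory Num.Theory.
Local Open Scope ring_scope.

Theorem theorem1p5 (k : nat) (hk : (2 <= k)%N) (a : nat -> nat)
    (ha : a = reg_partitions k \/ a = reg_overpartitions k) :
  exists N : nat, forall n : nat, (N <= n)%N ->
    (a n)%:Z ^+ 2 * ((a n)%:Z ^+ 2 - (a n.-1)%:Z * (a n.+1)%:Z)
    > (a n.-1)%:Z ^+ 2 * ((a n.+1)%:Z ^+ 2 - (a n)%:Z * (a n.+2)%:Z).
Proof.
have [N HN] := reg_sequence_eventually hk ha.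
(* The bound N + 1 excludes n = 0, where [n.-1] is truncated; at n + 1 the entries are a(n), ...,
   a(n + 3), as in [HN]. *)
exists N.+1 => -[//|n] hn; have /= := HN n hn; lia.
Qed.
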